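(* Let $(p_n)$ and $(q_n)$ be sequences in $[0,1]$. There exists a strongly consistent estimator for $\mathcal{G}(2n,p_n,q_n)$ if and only if $P(n,p_n,q_n)=o(n^{-1})$. There exists a weakly consistent estimator for $\mathcal{G}(2n,p_n,q_n)$ if and only if $P(n,p_n,q_n)\to 0$.
   Context: Planted bisection model: for $n\in\mathbb{N}$ and $p,q\in[0,1]$, a random labelled graph $(G,\sigma)\sim\mathcal{G}(2n,p,q)$ on a vertex set $V$ of size $2n$ is generated as follows: $\sigma$ is chosen uniformly at random from $\{\tau\in\{1,-1\}^{V}:\sum_u\tau_u=0\}$; then, conditionally on $\sigma$, each unordered pair of distinct vertices $u,v$ is joined by an edge independently with probability $p$ if $\sigma_u=\sigma_v$ and with probability $q$ if $\sigma_u\neq\sigma_v$. An estimator is a map $\mathcal{A}$ (one for each $n$) from graphs on $V$ to labellings in $\{1,-1\}^V$. It is strongly consistent if $\Pr_n(\mathcal{A}(G)=\sigma\text{ or }\mathcal{A}(G)=-\sigma)\to 1$ as $n\to\infty$, where $(G,\sigma)\sim\mathcal{G}(2n,p_n,q_n)$. For $\sigma,\tau\in\{1,-1\}^{2n}$ let $\Delta(\sigma,\tau)=1-\frac{1}{2n}\left|\sum_{i=1}^{2n}\sigma_i\tau_i\right|$; the estimator is weakly consistent if $\Delta(\sigma,\mathcal{A}(G))\to 0$ in probability, with $(G,\sigma)\sim\mathcal{G}(2n,p_n,q_n)$. For integers $m,n\ge 0$ and $p,q\in[0,1]$, let $X\sim\mathrm{Binom}(m,\max\{p,q\})$ and $Y\sim\mathrm{Binom}(n,\min\{p,q\})$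 be independent and define $P(m,n,p,q)=\Pr(Y\ge X)$; write $P(n,p,q)=P(n,n,p,q)$. *)

(* Defs.v *)
From HB Require Import structures.
From mathcomp Require Import all_boot all_order all_algebra.
From mathcomp Require Import all_classical all_reals all_analysis.
Set Implicit Arguments. Unset Strict Implicit. Unset Printing Implicit Defensive.
Import Order.TTheory GRing.Theory Num.Theory numFieldNormedType.Exports.
Local Open Scope classical_set_scope.
Local Open Scope ring_scope.

Notation V n := 'I_(2 * n)%N.

(* Labellings in {1,-1}^V, encoded as booleans: true = +1, false = -1. *)
Definition labelling (n : nat) := {ffun V n -> bool}.

(* A graph on V: a set of ordered pairs; an unordered pair {u,v} with u<v is
   represented by (u,v).  Only subsets of [pairs n] occur with positive
   probability in the model. *)
Definition graph (n : nat) := {set V n * V n}.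

Definition pairs (n : nat) : graph n := finset (fun e : V n * V n => (val e.1 < val e.2)%N).

Definition balanced (n : nat) (s : labelling n) : bool :=
  #|finset (fun i => s i)| == n.

Definition neg_lab (n : nat) (s : labelling n) : labelling n :=
  [ffun i => ~~ s i].

Definition sgprod {R : realType} (b c : bool) : R := if b == c then 1 else -1.

Definition Delta {R : realType} (n : nat) (s t : labelling n) : R :=
  1 - `| \sum_(i : V n) sgprod (s i) (t i) | / (2 * n)%:R.

(* Law of the planted bisection model G(2n,p,q): sigma uniform over the
   balanced labellings, then each pair u<v independently an edge with
   probability p (same label) or q (different labels). *)
Definition edge_prob {R : realType} (n : nat) (p q : R) (s : labelling n)
  (e : V n * V n) : R := if s e.1 == s e.2 then p else q.

Definition model_weight {R : realType} (n : nat) (p q : R)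
  (s : labelling n) (G : graph n) : R :=
  if balanced s && (G \subset pairs n) then
    (#|finset (fun t : labelling n => balanced t)|%:R)^-1 *
    \prod_(e in pairs n)
       (if e \in G then edge_prob p q s e else 1 - edge_prob p q s e)
  else 0.

Definition model_prob {R : realType} (n : nat) (p q : R)
  (E : labelling n -> graph n -> bool) : R :=
  \sum_(s : labelling n) \sum_(G : graph n)
     (if E s G then model_weight p q s G else 0).

Definition estimator := forall n : nat, graph n -> labelling n.

Definition strongly_consistent {R : realType} (p q : nat -> R)
  (A : estimator) : Prop :=
  (fun n => model_prob (p n) (q n)
       (fun s G => (A n G == s) || (A n G == neg_lab s))) @ \oo --> (1 : R).

Definition weakly_consistent {R : realType} (p q : nat -> R)
  (A : estimator) : Prop :=
  forall eps : R, 0 < eps ->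
    (fun n => model_prob (p n) (q n)
       (fun s G => eps < Delta s (A n G))) @ \oo --> (0 : R).

Definition binom_pmf {R : realType} (m : nat) (r : R) (k : nat) : R :=
  'C(m, k)%:R * r ^+ k * (1 - r) ^+ (m - k).

(* P(m,n,p,q) = Pr(Y >= X), X ~ Binom(m, max p q), Y ~ Binom(n, min p q)
   independent. *)
Definition Pmn {R : realType} (m n : nat) (p q : R) : R :=
  \sum_(k < m.+1) \sum_(j < n.+1 | (k <= j)%N)
     binom_pmf m (Num.max p q) k * binom_pmf n (Num.min p q) j.

Definition Pn {R : realType} (n : nat) (p q : R) : R := Pmn n n p q.

(* Main.v *)
(* Write a and b for the larger and the smaller of p and q, and
   rho = (sqrt (a b) + sqrt ((1 - a) (1 - b)))^2.  Two labellings that differ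
   at k vertices of each class have affinity rho^(2k(n-k)).  Hence maximum
   likelihood is weakly consistent when rho^n -> 0, and Le Cam's two-point bound
   for a swap of two vertices gives the converse; an exponential tilt shows that
   P(n) -> 0 if and only if rho^n -> 0.

   If n P(n) does not tend to 0, a second moment computation finds, with
   probability bounded below, two vertices of opposite classes whose swap does
   not decrease the likelihood, so no estimator can be strongly consistent.

   If n P(n) -> 0, the union bound over k only just fails, as rho^n exceeds P(n)
   by a subpolynomial factor.  The likelihood is therefore maximised over the
   labellings for which every vertex has margin (the number of its edges of the
   likelier kind minus the others) above a threshold M.  The true labelling
   qualifies, because further trials on both sides turn a margin M into a margin
   0 and P is nonincreasing in n.  If two qualifying labellings differ on S, then
   each vertex of S has more than M edges inside S: for a sparse graph this is an
   independent unlikely event already with M = 0, and for a dense one a large M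
   rules out all small S.  Complementing the graph reduces to a + b <= 1. *)
Require Import Defs.
From HB Require Import structures.
From mathcomp Require Import all_boot all_order all_algebra.
From mathcomp Require Import all_classical all_reals all_analysis.
From mathcomp Require Import perm ring lra zify.
Set Implicit Arguments. Unset Strict Implicit. Unset Printing Implicit Defensive.
Import Order.TTheory GRing.Theory Num.Theory.
Local Open Scope ring_scope.

(** * Binomial tails *)

(** The gap between P(n) and rho^n is measured on one scale, an integer z with z^24 <= n <= z^25. If
    n rho^n <= 1/z, plain maximum likelihood already has a convergent union bound. Otherwise 1/rho -
    1 is O(ln z / n), the tilt costs a factor below z, and n P(n) <= 1 leaves n rho^n <= z. The k-th
    term of the union bound is then only known to be at most (e^4 z^2 / k)^k, so k needs help of
    more than z^2. If a <= z^-3, the inner edges bring a factor (2 e k / z^3)^k. If a > z^-3, the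
    margin M = 2 z^3 leaves only k > z^3. In the latter case the margin is recovered with z^10
    further trials: their fluctuation exceeds z^3, while a - b is at most 2 z^-11 and gives them
    almost no drift.

    In the second moment, the swap events of two pairs of vertices are dependent only through the
    edges among at most four vertices. Such an edge shifts a comparison of degrees by one, which
    costs a constant factor once a <= 3/4 and b <= 1/2. The case a > 3/4 is settled directly, as rho
    is then bounded away from 1. *)

Section BinomialSums.
Variable R : realType.
Implicit Types (x y a b c : R) (h : nat -> R).

(* [binE n x (1 - x) h] is the expectation of [h] under Binom(n, x); leaving
   the two weights independent makes the family stable under tilting. *)
Fixpoint binE (n : nat) x y h : R :=
  if n is m.+1 then x * binE m x y (fun k => h k.+1) + y * binE m x y h
  else h 0%N.

Lemma eq_binE n x y h h' : h =1 h' -> binE n x y h = binE n x y h'.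
Proof.
elim: n h h' => [|n IH] h h' e /=; first exact: e.
by rewrite (IH _ (fun k => h' k.+1)) ?(IH h h') // => k.
Qed.

Lemma le_binE n x y h h' : 0 <= x -> 0 <= y ->
  (forall k, (k <= n)%N -> h k <= h' k) -> binE n x y h <= binE n x y h'.
Proof.
move=> x0 y0; elim: n h h' => [|n IH] h h' e /=; first exact: e.
apply: lerD; apply: ler_wpM2l => //; apply: IH => k kn; apply: e => //.
exact: leqW.
Qed.

Lemma binED n x y h h' :
  binE n x y (fun k => h k + h' k) = binE n x y h + binE n x y h'.
Proof. by elim: n h h' => [|n IH] h h' //=; rewrite !IH; ring. Qed.

Lemma binEZ n x y c h : binE n x y (fun k => c * h k) = c * binE n x y h.
Proof. by elim: n h => [|n IH] h //=; rewrite !IH; ring. Qed.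

Lemma binEZr n x y c h : binE n x y (fun k => h k * c) = binE n x y h * c.
Proof. by elim: n h => [|n IH] h //=; rewrite !IH; ring. Qed.

Lemma binE_cst n x y c : binE n x y (fun=> c) = (x + y) ^+ n * c.
Proof. by elim: n => [|n IH] /=; rewrite ?IH ?exprS; ring. Qed.

Lemma binE_ge0 n x y h : 0 <= x -> 0 <= y -> (forall k, 0 <= h k) ->
  0 <= binE n x y h.
Proof.
move=> x0 y0 h0; have := @le_binE n x y (fun=> 0) h x0 y0 (fun k _ => h0 k).
by rewrite binE_cst mulr0.
Qed.

Lemma binE_exchange m n x y x' y' (h : nat -> nat -> R) :
  binE m x y (fun i => binE n x' y' (h i)) =
  binE n x' y' (fun j => binE m x y (h^~ j)).
Proof.
elim: m h => [|m IH] h /=; first exact: eq_binE.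
by rewrite !IH -!binEZ -binED.
Qed.

Lemma binE_addn m n x y h :
  binE (m + n) x y h = binE m x y (fun i => binE n x y (fun j => h (i + j)%N)).
Proof.
elim: m h => [|m IH] h /=; first exact: eq_binE.
by rewrite !IH.
Qed.

Lemma binE_tilt n x y l c h :
  binE n (c * l * x) (c * y) h = c ^+ n * binE n x y (fun k => l ^+ k * h k).
Proof.
elim: n h => [|n IH] h /=; first by rewrite !expr0 !mul1r.
have e : binE n x y (fun k => l ^+ k.+1 * h k.+1) =
         l * binE n x y (fun k => l ^+ k * h k.+1).
  by rewrite -binEZ; apply: eq_binE => k; rewrite exprS mulrA.
by rewrite e !IH exprS; ring.
Qed.

Lemma binE_sum n x y h :
  binE n x y h = \sum_(k < n.+1) 'C(n, k)%:R * x ^+ k * y ^+ (n - k) * h k.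
Proof.
elim: n h => [|n IH] h; first by rewrite big_ord1 bin0 !expr0 !mul1r.
rewrite big_ord_recl /= bin0 expr0 !mul1r subn0 !IH.
under [X in _ = _ + X]eq_bigr => i _.
  rewrite /bump /= add1n binS natrD 2!mulrDl mulrDl subSS addrC.
  over.
rewrite big_split /= addrCA; congr (_ + _).
  by rewrite mulr_sumr; apply: eq_bigr => i _; rewrite exprS; ring.
rewrite big_ord_recl /= bin0 expr0 subn0 mulrDr exprS !mul1r mulrA; congr (_ + _).
rewrite big_ord_recr /= bin_small // !mul0r addr0 mulr_sumr.
apply: eq_bigr => i _; rewrite /bump /= add1n.
rewrite -(@subnSK i n (ltn_ord i)) (exprS y); ring.
Qed.

End BinomialSums.

Section BinomialPairs.
Variable R : realType.
Implicit Types (x y a b c : R).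

Definition binE2 m n x y x' y' (h : nat -> nat -> R) : R :=
  binE m x y (fun i => binE n x' y' (h i)).

Definition pr2 m n a b (E : nat -> nat -> bool) : R :=
  binE2 m n a (1 - a) b (1 - b) (fun i j => (E i j)%:R).

Lemma eq_binE2 m n x y x' y' (h h' : nat -> nat -> R) : h =2 h' ->
  binE2 m n x y x' y' h = binE2 m n x y x' y' h'.
Proof. by move=> e; apply: eq_binE => i; apply: eq_binE => j. Qed.

Lemma le_binE2 m n x y x' y' (h h' : nat -> nat -> R) :
  0 <= x -> 0 <= y -> 0 <= x' -> 0 <= y' ->
  (forall i j, (i <= m)%N -> (j <= n)%N -> h i j <= h' i j) ->
  binE2 m n x y x' y' h <= binE2 m n x y x' y' h'.
Proof.
move=> x0 y0 x'0 y'0 e; apply: le_binE => // i im; apply: le_binE => // j jn.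
exact: e.
Qed.

Lemma binE2D m n x y x' y' (h h' : nat -> nat -> R) :
  binE2 m n x y x' y' (fun i j => h i j + h' i j) =
  binE2 m n x y x' y' h + binE2 m n x y x' y' h'.
Proof. by rewrite /binE2 -binED; apply: eq_binE => i; rewrite binED. Qed.

Lemma binE2Z m n x y x' y' c (h : nat -> nat -> R) :
  binE2 m n x y x' y' (fun i j => c * h i j) = c * binE2 m n x y x' y' h.
Proof. by rewrite /binE2 -binEZ; apply: eq_binE => i; rewrite binEZ. Qed.

Lemma binE2_cst m n x y x' y' c :
  binE2 m n x y x' y' (fun _ _ => c) = (x + y) ^+ m * (x' + y') ^+ n * c.
Proof.
rewrite /binE2 -mulrA -binE_cst; apply: eq_binE => i; exact: binE_cst.
Qed.

Lemma binE2SS m n x y x' y' h :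
  binE2 m.+1 n.+1 x y x' y' h =
    x * x' * binE2 m n x y x' y' (fun i j => h i.+1 j.+1) +
    x * y' * binE2 m n x y x' y' (fun i j => h i.+1 j) +
    y * x' * binE2 m n x y x' y' (fun i j => h i j.+1) +
    y * y' * binE2 m n x y x' y' h.
Proof. by rewrite /binE2 /= !binED !binEZ; ring. Qed.

Lemma binE2_sym n x y (h : nat -> nat -> R) :
  binE2 n n x y x y h = binE2 n n x y x y (fun i j => h j i).
Proof. exact: binE_exchange. Qed.

Lemma pr2_ge0 m n a b E : 0 <= a <= 1 -> 0 <= b <= 1 -> 0 <= pr2 m n a b E.
Proof.
move=> /andP[a0 a1] /andP[b0 b1].
by apply: binE_ge0 => //; rewrite ?subr_ge0 // => i; apply: binE_ge0;
  rewrite ?subr_ge0.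
Qed.

Lemma le_pr2 m n a b (E E' : nat -> nat -> bool) :
  0 <= a <= 1 -> 0 <= b <= 1 ->
  (forall i j, (i <= m)%N -> (j <= n)%N -> E i j -> E' i j) ->
  pr2 m n a b E <= pr2 m n a b E'.
Proof.
move=> /andP[a0 a1] /andP[b0 b1] e.
apply: le_binE2; rewrite ?subr_ge0 // => i j im jn.
by rewrite ler_nat; case: (E i j) (e i j im jn) => // ->.
Qed.

Lemma pr2_addn m n m' n' a b (E E' E'' : nat -> nat -> bool) :
  0 <= a <= 1 -> 0 <= b <= 1 ->
  (forall i j i' j', E i j -> E' i' j' -> E'' (i + i')%N (j + j')%N) ->
  pr2 m n a b E * pr2 m' n' a b E' <= pr2 (m + m') (n + n') a b E''.
Proof.
move=> /andP[a0 a1] /andP[b0 b1] e.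
rewrite /pr2 /binE2 binE_addn -binEZr.
apply: le_binE; rewrite ?subr_ge0 // => i im.
rewrite -[leLHS]binEZ.
apply: le_binE; rewrite ?subr_ge0 // => i' im'.
rewrite binE_addn -binEZr.
apply: le_binE; rewrite ?subr_ge0 // => j jn.
rewrite -[leLHS]binEZ.
apply: le_binE; rewrite ?subr_ge0 // => j' jn'.
rewrite -natrM ler_nat.
by case: (E i j) (e i j i' j') => //; case: (E' i' j') => // ->.
Qed.

Lemma Pn_pr2 n p q : Pn n p q = pr2 n n (Num.max p q) (Num.min p q) leq :> R.
Proof.
rewrite /Pn /Pmn /pr2 /binE2 binE_sum; apply: eq_bigr => i _.
rewrite binE_sum big_mkcond /= mulr_sumr; apply: eq_bigr => j _.
by rewrite /binom_pmf; case: leqP => _ /=; rewrite ?mulr1 ?mulr0.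
Qed.

Lemma binE_rev n x y (h : nat -> R) :
  binE n x y h = binE n y x (fun k => h (n - k)%N).
Proof.
elim: n h => [|n IH] h //=; rewrite addrC; congr (_ * _ + _ * _).
  by rewrite IH; apply: eq_binE => k; rewrite subSS.
rewrite IH !binE_sum; apply: eq_bigr => k _.
by rewrite subSn // -ltnS.
Qed.

(** Count failures: n - Y and n - X are binomial with parameters 1 - b and 1 - a, and n - Y <= n - X
    says again that X <= Y. *)
Lemma pr2_compl n a b : pr2 n n (1 - b) (1 - a) leq = pr2 n n a b leq.
Proof.
rewrite /pr2 /binE2 !subKr [in RHS]binE_exchange binE_rev.
rewrite !binE_sum; apply: eq_bigr => i _; congr (_ * _).
rewrite binE_rev !binE_sum; apply: eq_bigr => j _; congr (_ * _).
by rewrite leq_sub2lE // -ltnS.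
Qed.

(* The difference is [b (1 - a) Pr(X = Y + 1) - a (1 - b) Pr(X = Y)]. *)
Lemma pr2_leqS n a b :
  pr2 n.+1 n.+1 a b leq = pr2 n n a b leq +
    (b * (1 - a) * pr2 n n a b (fun i j => i == j.+1) -
     a * (1 - b) * pr2 n n a b (fun i j => i == j)).
Proof.
have e1 : pr2 n n a b (fun i j => i < j.+2)%N =
    pr2 n n a b leq + pr2 n n a b (fun i j => i == j.+1).
  rewrite /pr2 -binE2D; apply: eq_binE2 => i j.
  rewrite -natrD; congr (_%:R); lia.
have e2 : pr2 n n a b (fun i j => i < j)%N =
    pr2 n n a b leq - pr2 n n a b (fun i j => i == j).
  apply/eqP; rewrite eq_sym subr_eq; apply/eqP; rewrite /pr2 -binE2D.
  by apply: eq_binE2 => i j; rewrite -natrD; congr (_%:R); lia.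
rewrite {1}/pr2 binE2SS -!/(pr2 _ _ _ _ _) /=.
rewrite -[X in _ * X + _ + _ + _]/(pr2 n n a b leq).
rewrite -[X in _ + _ * X + _ + _]/(pr2 n n a b (fun i j => i < j)%N).
rewrite -[X in _ + _ + _ * X + _]/(pr2 n n a b (fun i j => i < j.+2)%N).
rewrite -[X in _ + _ + _ + _ * X]/(pr2 n n a b leq).
rewrite e1 e2; ring.
Qed.

(** With g the common binomial weights, the two sides are the sums of g(k+1) g(k) and of g(k)^2. A
    sequence correlates best with itself unshifted, because g(i) g(j) <= (g(i)^2 + g(j)^2) / 2. *)
Lemma shifted_diagonal_le n x y : 0 <= x -> 0 <= y ->
  binE2 n n x y x y (fun i j => (i == j.+1)%:R) <=
  binE2 n n x y x y (fun i j => (i == j)%:R).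
Proof.
move=> x0 y0.
pose g k := 'C(n, k)%:R * x ^+ k * y ^+ (n - k).
have gd k (F : nat -> R) :
    binE n x y (fun j => (k == j)%:R * F j) = if (k <= n)%N then g k * F k else 0.
  rewrite binE_sum; case: leqP => kn.
    rewrite (bigD1 (Ordinal (n:=n.+1) (m:=k) kn)) //= big1 ?addr0 ?eqxx ?mul1r //.
    move=> i; rewrite -val_eqE /= eq_sym => /negPf ->; by rewrite mul0r mulr0.
  rewrite big1 // => i _; rewrite (_ : (k == i) = false) ?mul0r ?mulr0 //.
  by apply/eqP => e; have := ltn_ord i; rewrite -e ltnS leqNgt kn.
have d0 : binE2 n n x y x y (fun i j => (i == j)%:R) = \sum_(k < n.+1) g k * g k.
  rewrite /binE2 binE_sum; apply: eq_bigr => i _.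
  rewrite (eq_binE _ _ _ (h' := fun j => (val i == j)%:R * 1)) => [|j]; last by rewrite mulr1.
  by rewrite gd -ltnS ltn_ord mulr1.
have d1 : binE2 n n x y x y (fun i j => (i == j.+1)%:R) = \sum_(k < n) g k.+1 * g k.
  rewrite /binE2 binE_sum big_ord_recl /= [X in _ * X](_ : _ = 0) ?mulr0 ?add0r.
    apply: eq_bigr => i _; rewrite /bump /= add1n -/(g _).
    rewrite (eq_binE _ _ _ (h' := fun j => (val i == j)%:R * 1)) => [|j]; last by rewrite eqSS mulr1.
    by rewrite gd (ltnW (ltn_ord i)) mulr1.
  rewrite (eq_binE _ _ _ (h' := fun=> 0)) //; by rewrite binE_cst mulr0.
have gg i j : g i * g j <= (g i * g i + g j * g j) / 2.
  have := sqr_ge0 (g i - g j); rewrite expr2; nra.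
rewrite d0 d1; apply: (@le_trans _ _ (\sum_(k < n) (g k.+1 * g k.+1 + g k * g k) / 2)).
  by apply: ler_sum => i _; exact: gg.
rewrite -mulr_suml big_split /=.
have s1 : \sum_(k < n.+1) g k * g k = g 0%N * g 0%N + \sum_(i < n) g i.+1 * g i.+1.
  by rewrite big_ord_recl.
have s2 : \sum_(k < n.+1) g k * g k = \sum_(i < n) g i * g i + g n * g n.
  by rewrite big_ord_recr.
have p0 := sqr_ge0 (g 0%N); have pn := sqr_ge0 (g n); rewrite !expr2 in p0 pn.
rewrite ler_pdivrMr //; lra.
Qed.

End BinomialPairs.

(** * Bounds on P(n) by powers of the affinity *)

Section Affinity.
Variable R : realType.
Implicit Types (a b c u : R).

(** The Bhattacharyya coefficient of Bernoulli(a) and Bernoulli(b). *)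
Definition affinity a b : R := Num.sqrt (a * b) + Num.sqrt ((1 - a) * (1 - b)).

Definition rho a b : R := affinity a b ^+ 2.

Lemma affinity_ge0 a b : 0 <= affinity a b.
Proof. by rewrite addr_ge0 ?sqrtr_ge0. Qed.

Lemma rho_ge0 a b : 0 <= rho a b.
Proof. exact: sqr_ge0. Qed.

(** The affinity is the cosine of the angle between the unit vectors (sqrt a, sqrt (1 - a)) and
    (sqrt b, sqrt (1 - b)); the left side is the squared sine. *)
Lemma rho_sin a b : 0 <= a <= 1 -> 0 <= b <= 1 ->
  (Num.sqrt (a * (1 - b)) - Num.sqrt (b * (1 - a))) ^+ 2 = 1 - rho a b.
Proof.
move=> /andP[a0 a1] /andP[b0 b1]; rewrite /rho /affinity.
have a1' : 0 <= 1 - a by rewrite subr_ge0.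
have b1' : 0 <= 1 - b by rewrite subr_ge0.
rewrite !sqrtrM //.
have := sqr_sqrtr a0; have := sqr_sqrtr a1'.
have := sqr_sqrtr b0; have := sqr_sqrtr b1'.
set A := Num.sqrt a; set A' := Num.sqrt (1 - a).
set B := Num.sqrt b; set B' := Num.sqrt (1 - b) => eB' eB eA' eA.
have s1 : A ^+ 2 + A' ^+ 2 = 1 by rewrite eA eA'; ring.
have s2 : B ^+ 2 + B' ^+ 2 = 1 by rewrite eB eB'; ring.
rewrite (_ : 1 = (A ^+ 2 + A' ^+ 2) * (B ^+ 2 + B' ^+ 2)); last by rewrite s1 s2 mulr1.
ring.
Qed.

Lemma rho_le1 a b : 0 <= a <= 1 -> 0 <= b <= 1 -> rho a b <= 1.
Proof.
by move=> a01 b01; rewrite -subr_ge0 -rho_sin // sqr_ge0.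
Qed.

(** Here u is the square root of the odds ratio of b to a. Tilting X by 1/u and Y by u gives both
    variables the same weights. The normalising constants of the two tilts are inverse to each other
    and cancel, since both variables have n trials; the common weights sum to the affinity, not to
    1. *)
Lemma binE2_tilt n a b : 0 < b -> b <= a -> a < 1 ->
  exists u, [/\ 0 < u, u <= 1, u ^+ 2 * (a * (1 - b)) = b * (1 - a) &
   forall h, binE2 n n a (1 - a) b (1 - b) h =
     binE2 n n (Num.sqrt (a * b)) (Num.sqrt ((1 - a) * (1 - b)))
               (Num.sqrt (a * b)) (Num.sqrt ((1 - a) * (1 - b)))
        (fun i j => u^-1 ^+ i * u ^+ j * h i j)].
Proof.
move=> b0 ba a1.
have a0 : 0 < a by exact: lt_le_trans ba.
have b1 : b < 1 by exact: le_lt_trans a1.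
have a1' : 0 < 1 - a by rewrite subr_gt0.
have b1' : 0 < 1 - b by rewrite subr_gt0.
rewrite !sqrtrM ?(ltW a0) ?(ltW a1') //.
have := sqr_sqrtr (ltW a0); have := sqr_sqrtr (ltW a1').
have := sqr_sqrtr (ltW b0); have := sqr_sqrtr (ltW b1').
have : 0 < Num.sqrt a by rewrite sqrtr_gt0.
have : 0 < Num.sqrt b by rewrite sqrtr_gt0.
have : 0 < Num.sqrt (1 - a) by rewrite sqrtr_gt0.
have : 0 < Num.sqrt (1 - b) by rewrite sqrtr_gt0.
have : Num.sqrt b <= Num.sqrt a by exact: ler_wsqrtr.
have : Num.sqrt (1 - a) <= Num.sqrt (1 - b) by rewrite ler_wsqrtr // lerB.
set A := Num.sqrt a; set A' := Num.sqrt (1 - a).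
set B := Num.sqrt b; set B' := Num.sqrt (1 - b).
move=> AB' BA B'0 A'0 B0 A0 eB' eB eA' eA.
have [nA nA' nB nB'] : [/\ A != 0, A' != 0, B != 0 & B' != 0] by split; rewrite gt_eqF.
exists (A' * B / (A * B')); split.
- by rewrite divr_gt0 // mulr_gt0.
- by rewrite ler_pdivrMr ?mulr_gt0 // mul1r mulrC ler_pM // ltW.
- by rewrite -eA' -eB' -eA -eB; field; rewrite nA nB'.
move=> h; rewrite -eA' -eB' -eA -eB.
rewrite {1}/binE2.
rewrite (_ : A ^+ 2 = A' / B' * (A' * B / (A * B'))^-1 * (A * B)); last first.
  by field; rewrite nA nA' nB nB'.
rewrite (_ : A' ^+ 2 = A' / B' * (A' * B')); last by field; rewrite nB'.
rewrite binE_tilt.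
set u := A' * B / _.
rewrite -binEZ; apply: eq_binE => i.
rewrite (_ : B ^+ 2 = B' / A' * u * (A * B)); last first.
  by rewrite /u; field; rewrite nA nA' nB'.
rewrite (_ : B' ^+ 2 = B' / A' * (A' * B')); last by field; rewrite nA'.
rewrite binE_tilt mulrCA [X in _ * X]mulrA -exprMn (_ : A' / B' * (B' / A') = 1) ?expr1n ?mul1r; last first.
  by field; rewrite nA' nB'.
by rewrite -binEZ; apply: eq_binE => j; rewrite mulrA.
Qed.

Section Facts.
Variables a b : R.
Hypotheses (b0 : 0 <= b) (ba : b <= a) (a1 : a <= 1).

Let a0 : 0 <= a. Proof. exact: le_trans ba. Qed.
Let b1 : b <= 1. Proof. exact: le_trans a1. Qed.
Let a01 : 0 <= a <= 1. Proof. by rewrite a0. Qed.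
Let b01 : 0 <= b <= 1. Proof. by rewrite b0. Qed.

(** The tilting factor is constant on each of the two diagonals, 1/u for i = j + 1 and 1 for i = j,
    so [shifted_diagonal_le] applies. *)
Let diag1 n u : 0 < u ->
  binE2 n n (Num.sqrt (a * b)) (Num.sqrt ((1 - a) * (1 - b)))
            (Num.sqrt (a * b)) (Num.sqrt ((1 - a) * (1 - b)))
        (fun i j => u^-1 ^+ i * u ^+ j * (i == j.+1)%:R) <=
  u^-1 * binE2 n n (Num.sqrt (a * b)) (Num.sqrt ((1 - a) * (1 - b)))
            (Num.sqrt (a * b)) (Num.sqrt ((1 - a) * (1 - b)))
        (fun i j => u^-1 ^+ i * u ^+ j * (i == j)%:R).
Proof.
move=> u0; have nu : u != 0 by rewrite gt_eqF.
rewrite (@eq_binE2 _ _ _ _ _ _ _ _ (fun i j => u^-1 * (i == j.+1)%:R)); last first.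
  move=> i j; case: eqP => [->|]; rewrite ?mulr0 // !mulr1 exprS exprVn.
  by rewrite -mulrA mulVf ?mulr1 // expf_neq0.
rewrite [in leRHS](@eq_binE2 _ _ _ _ _ _ _ _ (fun i j => (i == j)%:R)); last first.
  move=> i j; case: eqP => [->|]; rewrite ?mulr0 // !mulr1 exprVn.
  by rewrite mulVf // expf_neq0.
rewrite binE2Z ler_pM2l ?invr_gt0 //.
by apply: shifted_diagonal_le; rewrite sqrtr_ge0.
Qed.

(** This is u Pr(X = Y + 1) <= Pr(X = Y) squared, with u^2 the odds ratio. The squared form without
    division also covers b = 0 and a = 1, where there is no tilt. *)
Lemma pr2_shift_sqr n :
  b * (1 - a) * pr2 n n a b (fun i j => i == j.+1) ^+ 2 <=
  a * (1 - b) * pr2 n n a b (fun i j => i == j) ^+ 2.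
Proof.
have rhs0 : 0 <= a * (1 - b) * pr2 n n a b (fun i j => i == j) ^+ 2.
  by rewrite mulr_ge0 ?sqr_ge0 // mulr_ge0 ?subr_ge0.
move: b0 rhs0; rewrite le_eqVlt => /orP[/eqP <- /=|b_gt0 rhs0]; first by rewrite !mul0r.
move: a1; rewrite le_eqVlt => /orP[/eqP ->|a_lt1].
  by rewrite subrr mulr0 mul0r mulr_ge0 ?sqr_ge0 // mulr_ge0 ?subr_ge0.
have [u [u0 u1 ue tilt]] := binE2_tilt n b_gt0 ba a_lt1.
have := diag1 n u0; rewrite -!tilt.
rewrite -/(pr2 _ _ _ _ (fun i j => i == j.+1)) -/(pr2 _ _ _ _ (fun i j => i == j)).
have J0 := @pr2_ge0 _ n n _ _ (fun i j => i == j.+1) a01 b01.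
have I0 := @pr2_ge0 _ n n _ _ (fun i j => i == j) a01 b01.
set J := pr2 _ _ _ _ _ in J0 *; set I := pr2 _ _ _ _ _ in I0 * => JI.
have uJ : u * J <= I by rewrite mulrC -ler_pdivlMr // mulrC.
rewrite -ue mulrAC -exprMn [leRHS]mulrC ler_wpM2r ?mulr_ge0 ?subr_ge0 //.
by rewrite ler_sqr ?nnegrE // mulr_ge0 // ltW.
Qed.

(** Put x = b (1 - a) and y = a (1 - b), and let J, I be the probabilities of X = Y + 1 and X = Y.
    By [pr2_leqS] it remains to see x J <= y I. Its square is the product of x <= y and of x J^2 <=
    y I^2, which is [pr2_shift_sqr]. *)
Lemma pr2_leq_nonincr n : pr2 n.+1 n.+1 a b leq <= pr2 n n a b leq.
Proof.
rewrite pr2_leqS gerDl subr_le0.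
have J0 := @pr2_ge0 _ n n _ _ (fun i j => i == j.+1) a01 b01.
have I0 := @pr2_ge0 _ n n _ _ (fun i j => i == j) a01 b01.
have := pr2_shift_sqr n.
set J := pr2 _ _ _ _ _ in J0 *; set I := pr2 _ _ _ _ _ in I0 * => H.
have x0 : 0 <= b * (1 - a) by rewrite mulr_ge0 // subr_ge0.
have xy : b * (1 - a) <= a * (1 - b) by rewrite !mulrBr !mulr1 [b * a]mulrC lerD2r.
move: H xy x0; set x := b * _; set y := a * _ => H xy x0.
have y0 : 0 <= y := le_trans x0 xy.
rewrite -ler_sqr ?nnegrE; [|exact: mulr_ge0..].
have e c d : (c * d) ^+ 2 = c * (c * d ^+ 2) by ring.
rewrite !e; apply: ler_pM => //.
by rewrite mulr_ge0 // sqr_ge0.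
Qed.

Lemma pr2_leq_mono m n : (m <= n)%N -> pr2 n n a b leq <= pr2 m m a b leq.
Proof.
move=> /subnK <-; elim: (n - m)%N => [|k IH]; first by rewrite add0n.
by rewrite addSn; apply: le_trans (pr2_leq_nonincr _) IH.
Qed.

Lemma rho_degenerate : b = 0 \/ a = 1 -> rho a b = (1 - a) * (1 - b) + a * b.
Proof.
case=> e; rewrite /rho /affinity e.
  by rewrite mulr0 sqrtr0 add0r addr0 sqr_sqrtr // subr0 mulr1 subr_ge0.
by rewrite subrr !mul0r sqrtr0 add0r addr0 sqr_sqrtr // mul1r.
Qed.

(** If b = 0, then Y = 0 and only X = 0 counts; a = 1 is the complementary case. These are the two
    cases that [binE2_tilt] excludes. *)
Lemma pr2_leq_degenerate n : b = 0 \/ a = 1 -> pr2 n n a b leq = rho a b ^+ n.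
Proof.
have key c : pr2 n n c 0 leq = (1 - c) ^+ n :> R.
  rewrite /pr2 /binE2 (eq_binE _ _ _ (h' := fun i => (i <= 0)%N%:R)).
    elim: n => [|n IH] //=.
    by rewrite IH binE_cst !mulr0 add0r exprS.
  move=> i; elim: n => [|n IH] //=.
  by rewrite IH mul0r add0r subr0 mul1r.
move=> e; rewrite rho_degenerate //; case: e => ->.
  by rewrite key subr0 mulr1 mulr0 addr0.
by rewrite -pr2_compl subrr key subKr !mul0r mul1r add0r.
Qed.

(** Chernoff bound: after the tilt the event X <= Y carries the factor u^(Y - X) <= 1, and the total
    tilted mass is rho^n. *)
Lemma pr2_leq_rho n : pr2 n n a b leq <= rho a b ^+ n.
Proof.
have [d|d] := eqVneq b 0; first by rewrite pr2_leq_degenerate //; left.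
have [d'|d'] := eqVneq a 1; first by rewrite pr2_leq_degenerate //; right.
have b_gt0 : 0 < b by rewrite lt0r d.
have a_lt1 : a < 1 by rewrite lt_neqAle d'.
have [u [u0 u1 ue tilt]] := binE2_tilt n b_gt0 ba a_lt1.
rewrite /pr2 tilt.
apply: (@le_trans _ _ (binE2 n n (Num.sqrt (a * b)) (Num.sqrt ((1 - a) * (1 - b)))
   (Num.sqrt (a * b)) (Num.sqrt ((1 - a) * (1 - b))) (fun _ _ => 1))).
  apply: le_binE2; rewrite ?sqrtr_ge0 // => i j _ _.
  case: leqP => ij; last by rewrite mulr0.
  rewrite mulr1 -{1}(subnKC ij) exprD exprVn mulrA mulVf ?mul1r.
    by rewrite exprn_ile1 // ltW.
  by rewrite expf_neq0 // gt_eqF.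
by rewrite binE2_cst mulr1 -exprMn -expr2.
Qed.

(** The variance of the difference of two independent Binom(n, x / (x + y)) variables, for
    unnormalised weights and cleared of denominators. *)
Lemma binE2_sqdiff n x y :
  (x + y) ^+ 2 * binE2 n n x y x y (fun i j => (i%:R - j%:R) ^+ 2) =
  2 * n%:R * (x * y) * (x + y) ^+ (2 * n) :> R.
Proof.
elim: n => [|n IH]; first by rewrite /binE2 /= subrr expr0n /= !mulr0 !mul0r.
rewrite binE2SS.
rewrite (@eq_binE2 _ _ _ _ _ _ _ (fun i j => (i.+1%:R - j.+1%:R) ^+ 2)
   (fun i j => (i%:R - j%:R) ^+ 2)); last by move=> i j; congr (_ ^+ 2); rewrite -2!natr1; ring.
set S := binE2 _ _ _ _ _ _ _ in IH *.
set Sl := binE2 _ _ _ _ _ _ _; set Sr := binE2 _ _ _ _ _ _ _.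
have SlE : Sl + Sr = 2 * S + 2 * (x + y) ^+ (2 * n).
  rewrite /Sl /Sr /S -binE2Z mulrC mul2n -addnn exprD -binE2_cst -!binE2D.
  by apply: eq_binE2 => i j; rewrite -!natr1; ring.
rewrite (_ : x * x * S + _ + _ + _ = (x * x + y * y) * S + x * y * (Sl + Sr)); last by ring.
rewrite SlE mulnS exprD -natr1.
transitivity ((x + y) ^+ 2 * ((x + y) ^+ 2 * S) + (x + y) ^+ 2 * (2 * (x * y) * (x + y) ^+ (2 * n))).
  ring.
by rewrite IH; ring.
Qed.

(* Tilting turns both variables into the same binomial law, up to the factor
   [rho ^+ n], and the event [X <= Y] costs at most [exp (- s |X - Y|)] with
   [s ^+ 2 * variance <= 4 (1 / rho - 1)]. *)
Lemma pr2_leq_ge n c : 0 < rho a b -> 0 < c ->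
  8 * n%:R * ((rho a b)^-1 - 1) <= c ^+ 2 ->
  rho a b ^+ n * expR (- c) / 2 <= pr2 n n a b leq.
Proof.
move=> r0 c0 hc.
have rn0 : 0 <= rho a b ^+ n by rewrite exprn_ge0 // ltW.
have deg : b = 0 \/ a = 1 -> rho a b ^+ n * expR (- c) / 2 <= pr2 n n a b leq.
  move=> d; rewrite pr2_leq_degenerate // -mulrA ler_piMr // ler_pdivrMr // mul1r.
  by apply: (@le_trans _ _ 1); rewrite ?ler1n // -expR0 ler_expR oppr_le0 ltW.
have [d|d] := eqVneq b 0; first by apply: deg; left.
have [d'|d'] := eqVneq a 1; first by apply: deg; right.
have b_gt0 : 0 < b by rewrite lt0r d.
have a_lt1 : a < 1 by rewrite lt_neqAle d'.
have a_gt0 : 0 < a by exact: lt_le_trans ba.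
have b_lt1 : b < 1 by exact: le_lt_trans a_lt1.
have [u [u0 u1 ue tilt]] := binE2_tilt n b_gt0 ba a_lt1.
have nu : u != 0 by rewrite gt_eqF.
rewrite /pr2 tilt.
have -> : rho a b = (Num.sqrt (a * b) + Num.sqrt ((1 - a) * (1 - b))) ^+ 2 by [].
have sin := rho_sin a01 b01.
have x0 : 0 <= Num.sqrt (a * b) by rewrite sqrtr_ge0.
have y0 : 0 <= Num.sqrt ((1 - a) * (1 - b)) by rewrite sqrtr_ge0.
have xyE : Num.sqrt (a * b) * Num.sqrt ((1 - a) * (1 - b)) =
    Num.sqrt (a * (1 - b)) * Num.sqrt (b * (1 - a)).
  rewrite -!sqrtrM ?mulr_ge0 ?subr_ge0 //; congr Num.sqrt; ring.
have uE : u * Num.sqrt (a * (1 - b)) = Num.sqrt (b * (1 - a)).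
  by rewrite -ue [in RHS]sqrtrM ?sqr_ge0 // sqrtr_sqr ger0_norm // ltW.
rewrite -/(affinity a b) in r0 *.
have rE : rho a b = affinity a b ^+ 2 by [].
move: x0 y0 xyE; rewrite /affinity in rE *.
set x := Num.sqrt (a * b) in rE *; set y := Num.sqrt ((1 - a) * _) in rE *.
set w := Num.sqrt (a * (1 - b)) in sin uE *.
have w0 : 0 <= w by rewrite sqrtr_ge0.
move=> x0 y0 xyE.
pose s : R := - ln u.
have s0 : 0 <= s by rewrite oppr_ge0 ln_le0.
have us : u = expR (- s) by rewrite opprK lnK // posrE.
pose v := Num.sqrt u.
have v0 : 0 < v by rewrite sqrtr_gt0.
have v2 : v ^+ 2 = u by rewrite sqr_sqrtr // ltW.
have nv : v != 0 by rewrite gt_eqF.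
have v1 : v <= 1 by rewrite -sqrtr1 ler_sqrt.
(* [s = 2 ln (1 / v) <= 2 (1 / v - 1)]; passing to the square root keeps the
   bound sharp for large ratios. *)
have sv : s * v <= 2 * (1 - v).
  have -> : s = 2 * ln v^-1.
    by rewrite lnV ?posrE // /s -v2 lnXn // mulr2n; ring.
  have h : ln v^-1 <= v^-1 - 1.
    have := @le_ln1Dx R (v^-1 - 1); rewrite subrKC; apply.
    by rewrite ltrBrDl subrr invr_gt0.
  have := ler_wpM2r (ltW v0) h; rewrite mulrBl mulVf // mul1r; lra.
have s2 : s ^+ 2 * (x * y) <= 4 * (1 - rho a b).
  rewrite xyE -uE -sin -uE -v2.
  have -> : s ^+ 2 * (w * (v ^+ 2 * w)) = (s * v * w) ^+ 2 by ring.
  have -> : 4 * (w - v ^+ 2 * w) ^+ 2 = (2 * (1 - v) * ((1 + v) * w)) ^+ 2 by ring.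
  have v'0 : 0 <= 1 - v by rewrite subr_ge0.
  have v''0 : 0 <= 1 + v by rewrite addr_ge0 // ltW.
  have sv0 : 0 <= s * v by rewrite mulr_ge0 // ltW.
  rewrite ler_sqr ?nnegrE; [|by rewrite mulr_ge0|by rewrite !mulr_ge0].
  apply: ler_pM => //.
  by rewrite ler_peMl // lerDl ltW.
have moment := binE2_sqdiff n x y.
set Q := binE2 _ _ _ _ _ _ _ in moment.
have tot k : binE2 n n x y x y (fun _ _ => k) = rho a b ^+ n * k.
  by rewrite binE2_cst -exprD addnn -mul2n exprM -rE.
rewrite exprM -rE in moment.
have QE : s ^+ 2 * Q <= c ^+ 2 * rho a b ^+ n.
  have -> : Q = 2 * n%:R * (x * y) * rho a b ^+ n / rho a b.
    by rewrite -moment mulrAC mulfV ?mul1r // gt_eqF.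
  apply: (@le_trans _ _ (8 * n%:R * ((rho a b)^-1 - 1) * rho a b ^+ n)); last first.
    by rewrite ler_wpM2r.
  have -> : s ^+ 2 * (2 * n%:R * (x * y) * rho a b ^+ n / rho a b) =
      2 * n%:R * (s ^+ 2 * (x * y)) * ((rho a b)^-1 * rho a b ^+ n) by ring.
  have -> : 8 * n%:R * ((rho a b)^-1 - 1) * rho a b ^+ n =
      2 * n%:R * (4 * (1 - rho a b)) * ((rho a b)^-1 * rho a b ^+ n).
    by field; rewrite gt_eqF.
  by rewrite ler_wpM2r ?mulr_ge0 ?invr_ge0 ?(ltW r0) // ler_wpM2l ?mulr_ge0.
pose F i j : R := u^-1 ^+ i * u ^+ j * (i <= j)%N%:R.
rewrite -/(binE2 n n x y x y F).
(* The tilted law is symmetric in i and j, so F may be symmetrised, and F i j + F j i >= exp (- s |i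
   - j|). *)
have F2 : expR (- c) * (rho a b ^+ n) <= 2 * binE2 n n x y x y F.
  have -> : 2 * binE2 n n x y x y F = binE2 n n x y x y (fun i j => F i j + F j i).
    by rewrite binE2D -binE2_sym; ring.
  (* With W = s |i - j|, exp (- W) >= e^-c (1 + c - W) >= e^-c (1 + c/2 - W^2 / (2 c)), the last
     step being (W - c)^2 >= 0. This minorant needs only the second moment, and W^2 has mean at most
     c^2. *)
  apply: (@le_trans _ _ (binE2 n n x y x y (fun i j => expR (- c) *
      (1 + c / 2) + (- (expR (- c) * s ^+ 2 / (2 * c))) * (i%:R - j%:R) ^+ 2))).
    rewrite binE2D tot binE2Z -/Q.
    have : expR (- c) / (2 * c) * (s ^+ 2 * Q) <= expR (- c) / (2 * c) * (c ^+ 2 * rho a b ^+ n).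
      by rewrite ler_wpM2l // divr_ge0 ?expR_ge0 // mulr_ge0 // ltW.
    have -> : expR (- c) / (2 * c) * (c ^+ 2 * rho a b ^+ n) = expR (- c) * (c / 2) * rho a b ^+ n.
      by field; rewrite gt_eqF.
    have -> : - (expR (- c) * s ^+ 2 / (2 * c)) * Q = - (expR (- c) / (2 * c) * (s ^+ 2 * Q)).
      by field; rewrite gt_eqF.
    lra.
  apply: le_binE2 => // i j _ _.
  wlog ij : i j / (i <= j)%N.
    move=> W; case: (leqP i j) => [/W //|/ltnW /W].
    rewrite [F j i + _]addrC; congr (_ <= _); congr (_ + _ * _); ring.
  have F0 k l : 0 <= F k l.
    by rewrite /F !mulr_ge0 // exprn_ge0 // ?invr_ge0 ltW.
  apply: (@le_trans _ _ (F i j)); last by rewrite lerDl.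
  have -> : F i j = expR (- (s * (j%:R - i%:R))).
    rewrite /F ij mulr1 -{1}(subnKC ij) exprD exprVn mulrA mulVf ?mul1r ?expf_neq0 //.
    by rewrite us -expRM_natl -natrB //; congr expR; ring.
  set W := s * (j%:R - i%:R).
  have -> : expR (- c) * (1 + c / 2) + - (expR (- c) * s ^+ 2 / (2 * c)) * (i%:R - j%:R) ^+ 2 =
     expR (- c) * (1 + c / 2 - W ^+ 2 / (2 * c)).
    by rewrite /W; field; rewrite gt_eqF.
  have -> : - W = - c + (c - W) by ring.
  rewrite expRD ler_wpM2l ?expR_ge0 //.
  apply: le_trans (expR_ge1Dx _).
  have : 0 <= (W - c) ^+ 2 / (2 * c) by rewrite divr_ge0 ?sqr_ge0 // mulr_ge0 // ltW.
  have -> : (W - c) ^+ 2 / (2 * c) = W ^+ 2 / (2 * c) - W + c / 2.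
    by field; rewrite gt_eqF.
  lra.
by rewrite ler_pdivrMr // [_ ^+ n * _]mulrC [leRHS]mulrC.
Qed.

End Facts.
End Affinity.

(** * Anticoncentration of the difference of two binomials *)

Section Anticoncentration.
Variable R : realType.
Implicit Types (a b c : R).

Lemma bernoulli_ineq n (d : R) : 0 <= d <= 1 -> 1 - n%:R * d <= (1 - d) ^+ n.
Proof.
move=> /andP[d0 d1]; elim: n => [|n IH]; first by rewrite mul0r subr0.
rewrite exprS; apply: (@le_trans _ _ ((1 - d) * (1 - n%:R * d))).
  rewrite -natr1; have : 0 <= n%:R * d ^+ 2 by rewrite mulr_ge0 // sqr_ge0.
  by rewrite expr2; lra.
by rewrite ler_wpM2l // subr_ge0.
Qed.

Lemma binE2_sqdiff1 n b :
  binE2 n n b (1 - b) b (1 - b) (fun i j => (i%:R - j%:R) ^+ 2) =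
  2 * n%:R * (b * (1 - b)).
Proof.
by have := binE2_sqdiff n b (1 - b); rewrite subrKC !expr1n mul1r mulr1.
Qed.

(** One more trial on each side adds to i - j an independent symmetric increment in {-1, 0, 1},
    which gives a recursion involving the second moment. *)
Lemma binE2_4diff n b :
  binE2 n n b (1 - b) b (1 - b) (fun i j => (i%:R - j%:R) ^+ 4) =
  2 * n%:R * (b * (1 - b)) + 12 * (b * (1 - b)) ^+ 2 * (n%:R * (n%:R - 1)).
Proof.
elim: n => [|n IH]; first by rewrite /binE2 /= subrr expr0n /= !(mulr0, mul0r) addr0.
rewrite binE2SS.
rewrite (@eq_binE2 _ _ _ _ _ _ _ (fun i j => (i.+1%:R - j.+1%:R) ^+ 4)
   (fun i j => (i%:R - j%:R) ^+ 4)); last by move=> i j; congr (_ ^+ 4); rewrite -2!natr1; ring.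
set S := binE2 _ _ _ _ _ _ _ in IH *.
set Sl := binE2 _ _ _ _ _ _ _; set Sr := binE2 _ _ _ _ _ _ _.
have SlE : Sl + Sr = 2 * S + 12 * (2 * n%:R * (b * (1 - b))) + 2.
  have c2 := binE2_cst n n b (1 - b) b (1 - b) (2 : R).
  rewrite subrKC !expr1n !mul1r in c2.
  rewrite -binE2_sqdiff1 /Sl /Sr /S -[in X in _ = _ + X]c2 -!binE2Z.
  by rewrite -!binE2D; apply: eq_binE2 => i j; rewrite -!natr1; ring.
transitivity ((b * b + (1 - b) * (1 - b)) * S + b * (1 - b) * (Sl + Sr)); first by ring.
by rewrite SlE IH -natr1; ring.
Qed.

(* A second/fourth moment argument: [4 (X - m) (K - X) / (K - m)^2] is a
   minorant of the indicator of [m <= X]. *)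
Lemma pr2_symmetric_tail n b M : 0 <= b <= 1 ->
  1 <= 2 * n%:R * (b * (1 - b)) ->
  10 * M%:R ^+ 2 <= 2 * n%:R * (b * (1 - b)) ->
  1 / 12 <= pr2 n n b b (fun i j => i + M <= j)%N.
Proof.
move=> b01 s1 hM; have /andP[b0 b1] := b01.
set E := pr2 _ _ _ _ _.
have e2 := binE2_sqdiff1 n b; have e4 := binE2_4diff n b.
set v := 2 * _ * _ in s1 hM e2 e4.
set m := M%:R ^+ 2 in hM.
have m0 : 0 <= m by rewrite sqr_ge0.
(* For X = (i - j)^2 the mean of (X - m)(K - X) is at least -4 v^2 + (K + m) v - m K. With K = 6 v
   this is 2 v^2 - 5 m v, of order v^2 because 10 m <= v. *)
pose K := 6 * v.
have Km : 0 < K - m by rewrite /K; lra.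
have e4le : binE2 n n b (1 - b) b (1 - b) (fun i j => (i%:R - j%:R) ^+ 4) <= 4 * v ^+ 2.
  rewrite e4; have : v <= v ^+ 2 by rewrite expr2 ler_peMl // (le_trans ler01).
  have -> : 12 * (b * (1 - b)) ^+ 2 * (n%:R * (n%:R - 1)) =
      3 * v ^+ 2 - 12 * (b * (1 - b)) ^+ 2 * n%:R by rewrite /v; ring.
  have : 0 <= 12 * (b * (1 - b)) ^+ 2 * n%:R by rewrite mulr_ge0 // mulr_ge0 // sqr_ge0.
  lra.
have E2 : E + E = binE2 n n b (1 - b) b (1 - b)
    (fun i j => (i + M <= j)%N%:R + (j + M <= i)%N%:R).
  by rewrite binE2D; congr (_ + _); rewrite /E /pr2 binE2_sym.
have low : binE2 n n b (1 - b) b (1 - b) (fun i j => 4 / (K - m) ^+ 2 *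
     (- (i%:R - j%:R) ^+ 4 + ((K + m) * (i%:R - j%:R) ^+ 2 + - (m * K)))) <= E + E.
  rewrite E2; apply: le_binE2; rewrite ?subr_ge0 // => i j _ _.
  set X := (i%:R - j%:R) ^+ 2.
  have -> : (i%:R - j%:R) ^+ 4 = X ^+ 2 by rewrite /X -exprM.
  rewrite mulrAC ler_pdivrMr ?exprn_gt0 //.
  have [ij|ij] := boolP ((i + M <= j) || (j + M <= i))%N.
    apply: (@le_trans _ _ (1 * (K - m) ^+ 2)).
      have := sqr_ge0 (2 * X - K - m); nra.
    rewrite ler_wpM2r ?sqr_ge0 // -natrD ler1n.
    by case/orP: ij => ->; rewrite ?addn1.
  have Xm : X <= m.
    move: ij; rewrite negb_or -!ltnNge => /andP[h1 h2].
    have {}h1 : (j%:R : R) <= i%:R + M%:R by rewrite -natrD ler_nat ltnW.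
    have {}h2 : (i%:R : R) <= j%:R + M%:R by rewrite -natrD ler_nat ltnW.
    have : 0 <= (M%:R - (i%:R - j%:R)) * (M%:R + (i%:R - j%:R)) :> R.
      by rewrite mulr_ge0 //; lra.
    by rewrite /X /m; nra.
  have -> : ((i + M <= j)%N%:R : R) = 0 by move: ij; case: leqP.
  have -> : ((j + M <= i)%N%:R : R) = 0 by move: ij; rewrite negb_or => /andP[_ /negPf ->].
  rewrite addr0 mul0r.
  have : 0 <= (m - X) * (K - X) by rewrite mulr_ge0 // subr_ge0 // (le_trans Xm) // ltW // -subr_gt0.
  nra.
move: low; rewrite binE2Z binE2D binE2D binE2Z e2.
rewrite (@eq_binE2 _ _ _ _ _ _ _ _ (fun i j => -1 * (i%:R - j%:R) ^+ 4)); last first.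
  by move=> i j; rewrite mulN1r.
rewrite binE2Z binE2_cst subrKC !expr1n !mul1r.
set Q4 := binE2 _ _ _ _ _ _ _ in e4le *.
move=> low.
have : 1 / 6 <= E + E.
  apply: le_trans low; rewrite mulrAC ler_pdivlMr ?exprn_gt0 //.
  have : 0 <= m * (v - 10 * m) by rewrite mulr_ge0 // subr_ge0.
  have : 0 <= v * (v - 10 * m) by rewrite mulr_ge0 ?subr_ge0 // (le_trans ler01).
  rewrite /K; nra.
lra.
Qed.

(** A trial of parameter a is a trial of parameter b to which, after a failure, a second chance of
    parameter d = (a - b) / (1 - b) is added. With probability (1 - d)^n no second chance succeeds,
    and then the outcome is that of Binom(n, b). *)
Lemma binE_thin n a b (h : nat -> R) : 0 <= b -> b <= a -> a <= 1 -> b < 1 ->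
  (forall k, 0 <= h k) ->
  (1 - (a - b) / (1 - b)) ^+ n * binE n b (1 - b) h <= binE n a (1 - a) h.
Proof.
move=> b0 ba a1 b1 h0.
have b1' : 0 < 1 - b by rewrite subr_gt0.
set d := (a - b) / (1 - b).
have d0 : 0 <= d by rewrite divr_ge0 ?subr_ge0 // ltW.
have d1 : 0 <= 1 - d by rewrite subr_ge0 ler_pdivrMr // mul1r lerB.
have e : (1 - d) * (1 - b) = 1 - a by rewrite /d; field; rewrite gt_eqF.
elim: n h h0 => [|n IH] h h0 /=; first by rewrite mul1r.
have -> : (1 - d) ^+ n.+1 * (b * binE n b (1 - b) (fun k => h k.+1) + (1 - b) * binE n b (1 - b) h) =
   ((1 - d) * b) * ((1 - d) ^+ n * binE n b (1 - b) (fun k => h k.+1)) +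
   ((1 - d) * (1 - b)) * ((1 - d) ^+ n * binE n b (1 - b) h) by rewrite exprS; ring.
have bE k' : 0 <= (1 - d) ^+ n * binE n b (1 - b) (fun k => h (k' + k)%N).
  by rewrite mulr_ge0 ?exprn_ge0 // binE_ge0 // ltW.
apply: lerD.
  apply: ler_pM; [exact: mulr_ge0|exact: (bE 1%N)| |exact: IH].
  by apply: le_trans ba; rewrite ler_piMl // lerBlDr lerDl.
rewrite e ler_wpM2l ?subr_ge0 //; exact: IH.
Qed.

(** The constant is 1/4 for the failure of the additional trial of X, times 1/2 for reducing a to b
    by [binE_thin], times 1/12 from the symmetric case. *)
Lemma pr2_tail_ge r a b M : 0 <= b -> b <= 1 / 2 -> b <= a -> a <= 3 / 4 ->
  r%:R * (2 * (a - b)) <= 1 / 2 ->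
  1 <= r%:R * b -> 10 * M%:R ^+ 2 <= r%:R * b ->
  1 / 96 <= pr2 r.+1 r a b (fun i j => i + M <= j)%N.
Proof.
move=> b0 b2 ba a34 hr h1 hM.
have b01 : 0 <= b <= 1 by lra.
have hv : r%:R * b <= 2 * r%:R * (b * (1 - b)).
  have : 0 <= r%:R * b * (1 - 2 * b) by rewrite mulr_ge0 //; lra.
  nra.
have sym := pr2_symmetric_tail b01 (le_trans h1 hv) (le_trans hM hv).
have b1' : 0 < 1 - b by lra.
have d01 : 0 <= (a - b) / (1 - b) <= 1.
  by rewrite divr_ge0 ?ler_pdivrMr ?mul1r //; lra.
have bern : 1 / 2 <= (1 - (a - b) / (1 - b)) ^+ r.
  apply: le_trans (bernoulli_ineq r d01).
  have : (a - b) / (1 - b) <= 2 * (a - b) by rewrite ler_pdivrMr //; nra.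
  move=> /(ler_wpM2l (ler0n R r)); lra.
have thin : (1 - (a - b) / (1 - b)) ^+ r * pr2 r r b b (fun i j => i + M <= j)%N <=
    pr2 r r a b (fun i j => i + M <= j)%N.
  apply: binE_thin; rewrite ?(le_lt_trans b2) //; try lra.
  by move=> k; apply: binE_ge0 => //; lra.
have S : (1 - a) * pr2 r r a b (fun i j => i + M <= j)%N <=
    pr2 r.+1 r a b (fun i j => i + M <= j)%N.
  rewrite /pr2 /binE2 /= lerDr mulr_ge0 //; try lra.
  by apply: binE_ge0; try lra; move=> k; apply: binE_ge0; try lra; move=> k'.
have P' : 1 / 2 * (1 / 12) <= pr2 r r a b (fun i j => i + M <= j)%N.
  by apply: le_trans thin; apply: ler_pM => //; lra.
have : 1 / 4 * (1 / 2 * (1 / 12)) <= (1 - a) * pr2 r r a b (fun i j => i + M <= j)%N.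
  by apply: ler_pM => //; lra.
lra.
Qed.

End Anticoncentration.

(** * Random subsets of a finite type *)

Section RandomSubset.
Variables (R : realType) (T : finType).
Implicit Types (w : T -> R) (A B G : {set T}) (F H : {set T} -> R).

Definition bern w G : R := \prod_e (if e \in G then w e else 1 - w e).

Definition Ex w F : R := \sum_G bern w G * F G.

Lemma sum_prod_set (f g : T -> R) :
  \sum_(G : {set T}) \prod_e (if e \in G then f e else g e) = \prod_e (f e + g e).
Proof. by rewrite bigA_distr. Qed.

Lemma eq_Ex w F H : F =1 H -> Ex w F = Ex w H.
Proof. by move=> e; apply: eq_bigr => G _; rewrite e. Qed.

Lemma Ex_cst w c : Ex w (fun=> c) = c.
Proof.
rewrite /Ex -mulr_suml sum_prod_set big1 ?mul1r // => e _; exact: subrKC.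
Qed.

Lemma ExD w F H : Ex w (fun G => F G + H G) = Ex w F + Ex w H.
Proof. by rewrite /Ex -big_split; apply: eq_bigr => G _; rewrite mulrDr. Qed.

Lemma ExZ w c F : Ex w (fun G => c * F G) = c * Ex w F.
Proof. by rewrite /Ex mulr_sumr; apply: eq_bigr => G _; rewrite mulrCA. Qed.

Lemma Ex_sum (I : finType) (P : pred I) w (F : I -> {set T} -> R) :
  Ex w (fun G => \sum_(i | P i) F i G) = \sum_(i | P i) Ex w (F i).
Proof.
by rewrite /Ex exchange_big; apply: eq_bigr => G _; rewrite mulr_sumr.
Qed.

Section Monotone.
Variable w : T -> R.
Hypothesis w01 : forall e, 0 <= w e <= 1.

Lemma bern_ge0 G : 0 <= bern w G.
Proof.
by apply: prodr_ge0 => e _; have /andP[? ?] := w01 e; case: ifP; rewrite ?subr_ge0.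
Qed.

Lemma le_Ex F H : (forall G, F G <= H G) -> Ex w F <= Ex w H.
Proof. by move=> e; apply: ler_sum => G _; rewrite ler_wpM2l ?bern_ge0. Qed.

Lemma Ex_ge0 F : (forall G, 0 <= F G) -> 0 <= Ex w F.
Proof. by move=> e; apply: sumr_ge0 => G _; rewrite mulr_ge0 ?bern_ge0. Qed.

End Monotone.

Definition depends_on A F := forall G, F (G :&: A) = F G.

Lemma depends_onS A B F : A \subset B -> depends_on A F -> depends_on B F.
Proof. by move=> /finset.setIidPr AB d G; rewrite -d -finset.setIA AB d. Qed.

Lemma depends_onM A F H : depends_on A F -> depends_on A H ->
  depends_on A (fun G => F G * H G).
Proof. by move=> dF dH G; rewrite dF dH. Qed.

(* Swapping the [A]-parts of two independent copies of the random set. *)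
Lemma Ex_indep w A B F H : [disjoint A & B] -> depends_on A F -> depends_on B H ->
  Ex w (fun G => F G * H G) = Ex w F * Ex w H.
Proof.
move=> dAB dF dH.
have dH' G : H (G :\: A) = H G.
  rewrite -dH -[RHS]dH; congr H; apply/setP => e; rewrite !inE.
  case eB: (e \in B); rewrite ?andbF //= !andbT.
  by rewrite (disjointFl dAB).
pose sw (u : {set T} * {set T}) := (u.1 :&: A :|: u.2 :\: A, u.2 :&: A :|: u.1 :\: A).
have swK : involutive sw.
  by case=> X Y; congr (_, _); apply/setP => e; rewrite !inE /=;
     case: (e \in A) (e \in X) (e \in Y) => [] [] [].
have swW u : bern w (sw u).1 * bern w (sw u).2 = bern w u.1 * bern w u.2.
  rewrite /bern -!big_split; apply: eq_bigr => e _ /=; rewrite !inE.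
  by case: (e \in A); rewrite !(andbT, andbF, orbF, orFb) //= mulrC.
transitivity (\sum_(u : {set T} * {set T}) bern w u.1 * bern w u.2 * (F u.1 * H u.1)).
  rewrite -[RHS](pair_bigA _ (fun X Y => bern w X * bern w Y * (F X * H X))) /=.
  apply: eq_bigr => X _; have := Ex_cst w (1 : R); rewrite /Ex => c1.
  rewrite -[LHS]mulr1 -c1 mulr_sumr; apply: eq_bigr => Y _; ring.
rewrite (reindex_inj (inv_inj swK)) /=.
rewrite /Ex mulr_suml -[LHS](pair_bigA _ (fun X Y =>
   bern w (sw (X, Y)).1 * bern w (sw (X, Y)).2 *
   (F (sw (X, Y)).1 * H (sw (X, Y)).1))) /=.
apply: eq_bigr => X _; rewrite mulr_sumr; apply: eq_bigr => Y _.
rewrite (swW (X, Y)) /=.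
have -> : F (X :&: A :|: Y :\: A) = F X.
  rewrite -dF -[RHS]dF; congr F; apply/setP => e; rewrite !inE.
  by case: (e \in A); rewrite ?andbF ?andbT ?orbF.
have -> : H (X :&: A :|: Y :\: A) = H Y.
  rewrite -dH' -[RHS]dH'; congr H; apply/setP => e; rewrite !inE.
  by case: (e \in A); rewrite ?andbF.
ring.
Qed.

Lemma Ex_mem w e : Ex w (fun G => (e \in G)%:R) = w e.
Proof.
transitivity (\sum_(G : {set T}) \prod_x
    (if x \in G then w x else if x == e then 0 else 1 - w x)).
  apply: eq_bigr => G _; rewrite /bern; case: (boolP (e \in G)) => eG.
    rewrite mulr1; apply: eq_bigr => x _; case: ifP => // xG.
    by case: eqP => // xe; rewrite xe eG in xG.
  by rewrite mulr0 (bigD1 e) //= (negPf eG) eqxx mul0r.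
rewrite sum_prod_set (bigD1 e) //= eqxx addr0 big1 ?mulr1 // => x /negPf ->.
exact: subrKC.
Qed.

(** The function g may look at the set outside A, so that the lemma can be applied again to a
    second, disjoint set, as in [Ex_count2]. *)
Lemma Ex_count w A x (g : nat -> {set T} -> R) : {in A, forall e, w e = x} ->
  (forall k, depends_on (~: A) (g k)) ->
  Ex w (fun G => g #|G :&: A| G) = binE #|A| x (1 - x) (fun k => Ex w (g k)).
Proof.
move En : #|A| => n; elim: n A En g => [|n IH] A En g wA dg.
  apply: eq_Ex => G /=; move/eqP: En; rewrite cards_eq0 => /eqP ->.
  by rewrite finset.setI0 cards0.
have [e eA] : exists e, e \in A by apply/set0Pn; rewrite -card_gt0 En.
pose A' := A :\ e.
have En' : #|A'| = n by move: En; rewrite (cardsD1 e) eA => -[].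
have wA' : {in A', forall e, w e = x} by move=> y /setD1P[_ /wA].
have dg' k : depends_on (~: A') (g k).
  by apply: depends_onS (dg k); rewrite finset.setCS subD1set.
have cnt G : #|G :&: A| = ((e \in G) + #|G :&: A'|)%N.
  by rewrite (cardsD1 e) finset.in_setI eA andbT; congr (_ + _)%N; apply: eq_card => y;
    rewrite !inE; case: (y == e); rewrite ?andbF.
have dA1 : depends_on [set e] (fun G => (e \in G)%:R).
  by move=> G; rewrite !inE eqxx andbT.
have d2 k : depends_on (~: [set e]) (fun G => g (k + #|G :&: A'|)%N G).
  move=> G; rewrite (_ : G :&: ~: [set e] :&: A' = G :&: A'); last first.
    by apply/setP => y; rewrite !inE; case: (y == e); rewrite ?andbF ?andbT.
  rewrite -(dg _ (G :&: _)) -[RHS](dg _ G); congr (g _ _); apply/setP => y.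
  by rewrite !inE; case: eqP => [->|]; rewrite ?eA ?andbF // andbT.
have dis : [disjoint [set e] & ~: [set e]] by rewrite -setI_eq0 finset.setICr.
(* Condition on one element e of A, writing the indicator of its absence as 1 minus that of its
   presence. *)
transitivity (Ex w (fun G => (e \in G)%:R * g (1 + #|G :&: A'|)%N G +
     (g (0 + #|G :&: A'|)%N G + -1 * ((e \in G)%:R * g (0 + #|G :&: A'|)%N G)))).
  apply: eq_Ex => G; rewrite cnt; case: (e \in G).
    by rewrite !mul1r mulN1r subrr addr0.
  by rewrite !mul0r mulr0 addr0 add0r.
rewrite !ExD ExZ !(Ex_indep _ dis) // Ex_mem wA //.
rewrite (IH A' En' (fun k => g (1 + k)%N)) // (IH A' En' (fun k => g (0 + k)%N)) //=.
rewrite /= ; ring.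
Qed.

Lemma Ex_count1 w A x (h : nat -> R) : {in A, forall e, w e = x} ->
  Ex w (fun G => h #|G :&: A|) = binE #|A| x (1 - x) h.
Proof.
move=> wA; rewrite (@Ex_count _ _ _ (fun k _ => h k) wA) //.
by apply: eq_binE => k; rewrite Ex_cst.
Qed.

Lemma Ex_count2 w A B x y (h : nat -> nat -> R) : [disjoint A & B] ->
  {in A, forall e, w e = x} -> {in B, forall e, w e = y} ->
  Ex w (fun G => h #|G :&: A| #|G :&: B|) =
  binE2 #|A| #|B| x (1 - x) y (1 - y) h.
Proof.
move=> dAB wA wB; rewrite (@Ex_count _ _ _ (fun k G => h k #|G :&: B|) wA).
  by apply: eq_binE => k; rewrite (Ex_count1 _ wB).
have AB : ~: A :&: B = B.
  by apply/finset.setIidPr; rewrite -finset.disjoints_subset disjoint_sym.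
by move=> k G; rewrite -finset.setIA AB.
Qed.

End RandomSubset.

(** * Graphs and labellings *)

Section Graphs.
Variable n : nat.
Implicit Types (u v : V n) (s t : labelling n) (G : graph n) (B C S : {set V n}).

Definition ed u v : V n * V n := if (val u < val v)%N then (u, v) else (v, u).

Lemma ed_pairs u v : u != v -> ed u v \in pairs n.
Proof.
rewrite /ed !inE -val_eqE /=.
by case: (ltngtP (val u) (val v)) => //=.
Qed.

Lemma edC u v : ed u v = ed v u.
Proof.
by rewrite /ed; case: (ltngtP (val u) (val v)) => // /val_inj ->.
Qed.

Lemma ed_eq u v u' v' : ed u v = ed u' v' ->
  (u = u' /\ v = v') \/ (u = v' /\ v = u').
Proof. by rewrite /ed; case: ifP => _; case: ifP => _ [-> ->]; tauto. Qed.

Lemma pairs_edP e : e \in pairs n -> e = ed e.1 e.2.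
Proof. by rewrite inE /ed; case: e => u v /= ->. Qed.

Lemma ed_sym (T : eqType) (f : V n -> T) u v :
  (f (ed u v).1 == f (ed u v).2) = (f u == f v).
Proof. by rewrite /ed; case: ifP => _ //=; rewrite eq_sym. Qed.

Definition star u B : graph n := ed u @: B.

Lemma card_star u B : u \notin B -> #|star u B| = #|B|.
Proof.
move=> uB; apply: card_in_imset => v v' vB v'B /ed_eq [[]//|[e _]].
by rewrite e v'B in uB.
Qed.

Lemma starS u B C : B \subset C -> star u B \subset star u C.
Proof. exact: imsetS. Qed.

Lemma star_disjoint u B C : [disjoint B & C] -> u \notin B ->
  [disjoint star u B & star u C].
Proof.
move=> dBC uB; rewrite -setI_eq0; apply/eqP/setP => e; rewrite !inE.
apply/negP => /andP[/imsetP[v vB ->] /imsetP[v' v'C /ed_eq [[_ e1]|[e1 e2]]]].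
  by rewrite -e1 (disjointFr dBC vB) in v'C.
by rewrite -e2 vB in uB.
Qed.

Lemma star_disjoint2 u u' B C : u != u' -> (u' \notin B) || (u \notin C) ->
  [disjoint star u B & star u' C].
Proof.
move=> uu' h; rewrite -setI_eq0; apply/eqP/setP => e; rewrite !inE.
apply/negP => /andP[/imsetP[v vB ->] /imsetP[v' v'C /ed_eq [[e1 _]|[e1 e2]]]].
  by rewrite e1 eqxx in uu'.
by move: h; rewrite e1 v'C -e2 vB.
Qed.

Definition deg G u B := #|G :&: star u B|.

Lemma deg_sum G u B : u \notin B -> deg G u B = (\sum_(v in B) (ed u v \in G))%N.
Proof.
move=> uB; rewrite /deg -sum1_card (eq_bigl (fun e => (e \in star u B) && (e \in G))).
  rewrite big_mkcondr /= big_imset /=.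
    by apply: eq_bigr => v _; case: (_ \in G).
  move=> v v' vB v'B /ed_eq [[]//|[e _]]; by rewrite e v'B in uB.
by move=> e; rewrite inE andbC.
Qed.

Lemma deg_disjointU G u B C : [disjoint B & C] -> u \notin B -> u \notin C ->
  deg G u (B :|: C) = (deg G u B + deg G u C)%N.
Proof.
move=> dBC uB uC; rewrite !deg_sum ?inE ?negb_or ?uB //.
rewrite (eq_bigl (fun v => v \in [predU B & C])) => [|v]; last by rewrite !inE.
by rewrite bigU.
Qed.

Lemma degS G u B C : B \subset C -> (deg G u B <= deg G u C)%N.
Proof. by move=> BC; apply: subset_leq_card; apply: finset.setIS; exact: starS. Qed.

Lemma deg_le G u B : (deg G u B <= #|B|)%N.
Proof.
apply: leq_trans (leq_imset_card (ed u) B).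
by apply: subset_leq_card; rewrite subsetIr.
Qed.

(* The likelier pairs, of edge probability [max p q], are those with equal
   labels if [o] is true (q <= p) and those with distinct labels otherwise. *)
Definition hotv o s u := [set v | (v != u) && ((s u == s v) == o)].
Definition coldv o s u := [set v | (v != u) && ((s u == s v) != o)].

Lemma hotv_notin o s u : u \notin hotv o s u.
Proof. by rewrite inE eqxx. Qed.

Lemma coldv_notin o s u : u \notin coldv o s u.
Proof. by rewrite inE eqxx. Qed.

Lemma hot_cold_disjoint o s u : [disjoint hotv o s u & coldv o s u].
Proof.
rewrite -setI_eq0; apply/eqP/setP => v; rewrite !inE.
by case: (v == u); case: (_ == o).
Qed.

Lemma card_class s c : balanced s -> #|[set v | s v == c]| = n.
Proof.
rewrite /balanced => /eqP bs.
have cT : #|[set v | s v == true]| = n.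
  by rewrite -[RHS]bs; apply: eq_card => v; rewrite !inE eqb_id.
case: c => //.
have := cardsC [set v | s v == true]; rewrite cT card_ord.
rewrite (_ : ~: _ = [set v | s v == false]); first lia.
by apply/setP => v; rewrite !inE; case: (s v).
Qed.

(** The vertex u is missing from its own class, which is the hot side if [o] is true and the cold
    side otherwise; hence [o] and [~~ o] read as numbers. *)
Lemma card_hotv_cold o s u : balanced s ->
  #|hotv o s u| = (n - o)%N /\ #|coldv o s u| = (n - ~~ o)%N.
Proof.
move=> bs.
have h1 : #|[set v | (v != u) && (s u == s v)]| = n.-1.
  apply/eqP; rewrite -eqSS prednK; last first.
    by rewrite -(card_class (s u) bs) card_gt0; apply/set0Pn; exists u; rewrite inE.
  rewrite -[X in _ == X](card_class (s u) bs) (cardsD1 u [set v | _ == _]) inE eqxx add1n eqSS.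
  by apply/eqP; apply: eq_card => v; rewrite !inE [s v == _]eq_sym.
have h2 : #|[set v | (v != u) && (s u != s v)]| = n.
  rewrite -[RHS](card_class (~~ s u) bs); apply: eq_card => v; rewrite !inE.
  by case: eqP => [->|_] /=; case: (s u) => //; case: (s v).
rewrite /hotv /coldv; case: o; split.
- by rewrite subn1 -h1; apply: eq_card => v; rewrite !inE eqb_id.
- by rewrite subn0 -[RHS]h2; apply: eq_card => v; rewrite !inE eqb_id.
- by rewrite subn0 -[RHS]h2; apply: eq_card => v; rewrite !inE eqbF_neg.
- by rewrite subn1 -h1; apply: eq_card => v; rewrite !inE eqbF_neg negbK.
Qed.

Definition diffset s t := [set v | s v != t v].
Definition boundary S : graph n := [set e in pairs n | (e.1 \in S) != (e.2 \in S)].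
Definition inner S : graph n := [set e in pairs n | (e.1 \in S) && (e.2 \in S)].

Lemma card_boundary S : #|boundary S| = (#|S| * #|~: S|)%N.
Proof.
rewrite -cardsX -(card_in_imset (f := fun e => ed e.1 e.2) (D := finset.setX S (~: S))).
  apply: eq_card => e; rewrite inE; apply/andP/imsetP.
    case=> eP h; case e1 : (e.1 \in S) h => h.
      exists e; last exact: pairs_edP.
      by rewrite !inE e1 /=; case: (e.2 \in S) h.
    exists (e.2, e.1); last by rewrite edC; exact: pairs_edP.
    by rewrite !inE e1 /= andbT; case: (e.2 \in S) h.
  case=> -[u v]; rewrite !inE /= => /andP[uS vS] -> /=.
  have uv : u != v by apply: contraNneq vS => <-.
  split; first by have := ed_pairs uv; rewrite inE.
  by rewrite (ed_sym (fun x => x \in S)) uS (negPf vS).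
move=> [u v] [u' v']; rewrite !inE /= => /andP[uS vS] /andP[u'S v'S].
move=> /ed_eq [[-> ->]//|[e _]]; by rewrite -e uS in v'S.
Qed.

(** Since [inner S] keeps one orientation of each pair, it is disjoint from its mirror image, and
    both lie in S x S. *)
Lemma card_inner S : (2 * #|inner S| <= #|S| * #|S|)%N.
Proof.
rewrite mul2n -addnn -cardsX.
pose sw (e : V n * V n) := (e.2, e.1).
have swi : injective sw by move=> [u v] [u' v'] [-> ->].
rewrite -{2}(card_imset _ swi).
have dis : [disjoint inner S & sw @: inner S].
  rewrite -setI_eq0; apply/eqP/setP => e; rewrite !inE.
  apply/negP => /andP[/andP[h _] /imsetP[e']]; rewrite !inE => /andP[h' _] ee.
  by move: h; rewrite ee /= ltnNge ltnW.
rewrite -cardsUI; move: dis; rewrite -setI_eq0 => /eqP ->; rewrite cards0 addn0.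
apply: subset_leq_card; apply/fintype.subsetP => e; rewrite !inE.
case/orP => [/andP[_ ->]//|/imsetP[e']].
by rewrite !inE => /andP[_ /andP[h1 h2]] -> /=; rewrite h1 h2.
Qed.

(** Handshake count: every edge inside S is seen from its two ends. *)
Lemma sum_deg_inner G S : (\sum_(u in S) deg G u (S :\ u) <= 2 * #|G :&: inner S|)%N.
Proof.
pose f u v : nat := (val u < val v)%N && ((u, v) \in G).
have E u v : v != u -> (ed u v \in G) = (f u v + f v u)%N :> nat.
  rewrite /f /ed -val_eqE /=; case: ltngtP => //= _ _; rewrite ?addn0 //.
rewrite (eq_bigr (fun u => \sum_(v in S :\ u) (f u v + f v u)))%N; last first.
  move=> u uS; rewrite deg_sum ?inE ?eqxx //; apply: eq_bigr => v.
  by rewrite !inE => /andP[/E].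
apply: (@leq_trans (\sum_(u in S) \sum_(v in S) (f u v + f v u))).
  apply: leq_sum => u uS; rewrite [leqRHS](bigD1 u) //=.
  rewrite (eq_bigl (fun v => (v \in S) && (v != u))) ?leq_addl // => v.
  by rewrite !inE andbC.
under eq_bigr => u _ do rewrite big_split.
rewrite big_split /= [X in (_ + X <= _)%N]exchange_big /= addnn -mul2n leq_mul2l /=.
rewrite pair_big /= -sum1_card [leqRHS]big_mkcond [leqLHS]big_mkcond /=.
apply: leq_sum => -[u v] _; rewrite /f !inE /=.
by case: (u \in S); case: (v \in S); case: (_ < _)%N; case: ((u, v) \in G).
Qed.

(* Flipping [S] exchanges hot and cold exactly for the pairs leaving [S]. *)
Lemma margin_inner o s t G u M : u \in diffset s t ->
  (deg G u (coldv o s u) + M < deg G u (hotv o s u))%N ->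
  (deg G u (coldv o t u) + M < deg G u (hotv o t u))%N ->
  (M < deg G u (diffset s t :\ u))%N.
Proof.
set S := diffset s t => uS.
have split B : u \notin B -> deg G u B = (deg G u (B :&: S) + deg G u (B :\: S))%N.
  move=> uB; rewrite -deg_disjointU ?inE ?(negPf uB) ?andbF //.
    by rewrite finset.setID.
  rewrite -setI_eq0; apply/eqP/setP => v; rewrite !inE.
  by case: (_ != _); rewrite ?andbF.
rewrite !(split (coldv _ _ _)) ?coldv_notin // !(split (hotv _ _ _)) ?hotv_notin //.
move: uS; rewrite inE => uS.
have -> : hotv o t u :&: S = hotv o s u :&: S.
  apply/setP => v; rewrite !inE; case: (v == u) => //=.
  by move: uS; case: (s u); case: (t u); case: (s v); case: (t v); case: o.
have -> : coldv o t u :&: S = coldv o s u :&: S.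
  apply/setP => v; rewrite !inE; case: (v == u) => //=.
  by move: uS; case: (s u); case: (t u); case: (s v); case: (t v); case: o.
have -> : hotv o t u :\: S = coldv o s u :\: S.
  apply/setP => v; rewrite !inE; case: (v == u); rewrite /= ?andbF //.
  by move: uS; case: (s u); case: (t u); case: (s v); case: (t v); case: o.
have -> : coldv o t u :\: S = hotv o s u :\: S.
  apply/setP => v; rewrite !inE; case: (v == u); rewrite /= ?andbF //.
  by move: uS; case: (s u); case: (t u); case: (s v); case: (t v); case: o.
have : (deg G u (hotv o s u :&: S) <= deg G u (S :\ u))%N.
  apply: degS; apply/fintype.subsetP => v; rewrite !inE.
  by case: (v == u); rewrite ?andbF //= => /andP[].
move: (deg G u (S :\ u)) (deg G u (hotv o s u :&: S)) (deg G u (hotv o s u :\: S)).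
move: (deg G u (coldv o s u :&: S)) (deg G u (coldv o s u :\: S)); lia.
Qed.

(** As class c has n vertices under both labellings, as many vertices enter it as leave it. *)
Lemma balanced_diffset s t c : balanced s -> balanced t ->
  (2 * #|diffset s t :&: [set v | s v == c]| = #|diffset s t|)%N.
Proof.
move=> bs bt; set S := diffset s t.
have card2 d : #|S :&: [set v | s v == d]| = #|S :&: [set v | t v == d]|.
  have e1 := cardsID S [set v | s v == d]; have e2 := cardsID S [set v | t v == d].
  rewrite !card_class // in e1 e2.
  have e3 : [set v | s v == d] :\: S = [set v | t v == d] :\: S.
    by apply/setP => v; rewrite !inE; case: (s v); case: (t v).
  rewrite ![S :&: _]finset.setIC; rewrite e3 in e1.
  by apply/eqP; rewrite -(eqn_add2r #|[set v | t v == d] :\: S|) e1 e2.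
have <- := cardsID [set v | s v == c] S.
rewrite mul2n -addnn; congr (_ + _)%N.
by rewrite card2; apply: eq_card => v; rewrite !inE; case: (s v); case: (t v); case: c.
Qed.

(** A labelling is determined by its difference set, which meets each of the two classes of s in k
    vertices. *)
Lemma card_labellings_at s k : balanced s ->
  (#|[set t | balanced t & #|diffset s t| == (2 * k)%N]| <= 'C(n, k) ^ 2)%N.
Proof.
move=> bs.
pose f t := (diffset s t :&: [set v | s v == true], diffset s t :&: [set v | s v == false]).
have finj : injective f.
  move=> t t' [/setP e1 /setP e2]; apply/ffunP => v.
  have := e1 v; have := e2 v; rewrite !inE.
  by case: (s v); case: (t v); case: (t' v).
rewrite -(card_imset _ finj).
pose D c := [set B : {set V n} | B \subset [set v | s v == c] & #|B| == k].
apply: (@leq_trans #|finset.setX (D true) (D false)|).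
  apply: subset_leq_card; apply/fintype.subsetP => x /imsetP[t].
  rewrite inE => /andP[bt /eqP ct] ->; rewrite !inE !subsetIr /=.
  have := balanced_diffset true bs bt; have := balanced_diffset false bs bt.
  by rewrite ct => /eqP; rewrite eqn_mul2l /= => -> /eqP; rewrite eqn_mul2l /= => ->.
by rewrite cardsX !cards_draws !card_class // mulnn.
Qed.

End Graphs.

(** * Likelihoods and the union bound *)

Section RootWeights.
Variables (R : realType) (T : finType).
Implicit Types (w : T -> R) (G : {set T}).

(** A product of roots, so that the affinity of two edge laws factorises over the pairs. *)
Definition rbern w G : R :=
  \prod_e (if e \in G then Num.sqrt (w e) else Num.sqrt (1 - w e)).

Lemma rbern_ge0 w G : 0 <= rbern w G.
Proof. by apply: prodr_ge0 => e _; case: ifP; rewrite sqrtr_ge0. Qed.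

Lemma rbern_sqr w G : (forall e, 0 <= w e <= 1) -> rbern w G ^+ 2 = bern w G.
Proof.
move=> w01; rewrite /rbern /bern -prodrXl; apply: eq_bigr => e _.
by have /andP[? ?] := w01 e; case: ifP => _; rewrite sqr_sqrtr // subr_ge0.
Qed.

(** The smaller of two likelihoods is at most their geometric mean. *)
Lemma bern_le_rbern w w' G : (forall e, 0 <= w e <= 1) ->
  (forall e, 0 <= w' e <= 1) -> bern w G <= bern w' G ->
  bern w G <= rbern w G * rbern w' G.
Proof.
move=> w01 w01'; rewrite -!rbern_sqr // ler_sqr ?nnegrE ?rbern_ge0 // => h.
by rewrite expr2 ler_wpM2l ?rbern_ge0.
Qed.

(* Le Cam: two experiments with affinity [Z] have at least [Z^2 / 2] in common. *)
Lemma affinity_min w w' (F : {set T} -> bool) : (forall e, 0 <= w e <= 1) ->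
  (forall e, 0 <= w' e <= 1) ->
  (\sum_G rbern w G * rbern w' G) ^+ 2 <=
  2 * \sum_G (if F G then bern w G else bern w' G).
Proof.
move=> w01 w01'; set Z := \sum_G _; set m := \sum_G _.
have Z0 : 0 <= Z by apply: sumr_ge0 => G _; rewrite mulr_ge0 ?rbern_ge0.
have m0 : 0 <= m by apply: sumr_ge0 => G _; case: ifP => _; rewrite bern_ge0.
move: Z0; rewrite le_eqVlt => /orP[/eqP <-|Z0]; first by rewrite expr0n /= mulr_ge0.
have tot : \sum_G (if F G then bern w' G else bern w G) <= 2.
  have := Ex_cst w (1 : R); have := Ex_cst w' (1 : R); rewrite /Ex.
  under eq_bigr do rewrite mulr1; move=> e1; under eq_bigr do rewrite mulr1; move=> e2.
  have -> : (2 : R) = 1 + 1 by [].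
  rewrite -{1}e1 -{1}e2 -big_split /=; apply: ler_sum => G _.
  by case: ifP => _; rewrite ?lerDl ?lerDr bern_ge0.
(* Weighted AM-GM with weights 2/Z and Z/2: for each G the likelihood selected by F goes to m, the
   other one into a sum of at most 2. The weights are chosen so that the second part absorbs only
   half of 2 Z. *)
have : 2 * Z <= 2 / Z * m + Z / 2 * 2.
  apply: (@le_trans _ _ (2 / Z * m + Z / 2 * \sum_G (if F G then bern w' G else bern w G))).
    rewrite /Z /m !mulr_sumr -big_split /= -/Z; apply: ler_sum => G _.
    rewrite -!rbern_sqr //; set r := rbern w G; set r' := rbern w' G.
    have amgm (x y : R) : 2 * (x * y) <= 2 / Z * x ^+ 2 + Z / 2 * y ^+ 2.
      have -> : 2 / Z * x ^+ 2 + Z / 2 * y ^+ 2 =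
          2 * (x * y) + (2 * x - Z * y) ^+ 2 / (2 * Z).
        by field; rewrite gt_eqF.
      by rewrite lerDl divr_ge0 ?sqr_ge0 // mulr_ge0 // ltW.
    by case: ifP => _; [|rewrite [r * r']mulrC]; exact: amgm.
  by rewrite lerD2l ler_wpM2l // divr_ge0 // ltW.
rewrite divfK // => h.
have : Z <= 2 / Z * m by lra.
by rewrite mulrAC ler_pdivlMr // -expr2.
Qed.

End RootWeights.

Section Model.
Variables (R : realType) (n : nat) (o : bool) (a b : R).
Implicit Types (s t : labelling n) (G : graph n).

(** Weight 0 outside [pairs n] makes [bern (wt s)] a law on all sets of ordered pairs that is
    carried by the subsets of [pairs n]. The flag [o] treats p >= q and p < q at once. *)
Definition wt s (e : V n * V n) : R :=
  if e \in pairs n then (if (s e.1 == s e.2) == o then a else b) else 0.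

Hypotheses (b0 : 0 <= b) (ba : b <= a) (a1 : a <= 1).

Let a0 : 0 <= a. Proof. exact: le_trans ba. Qed.
Let b1 : b <= 1. Proof. exact: le_trans a1. Qed.

Lemma wt01 s e : 0 <= wt s e <= 1.
Proof. by rewrite /wt; case: ifP => _; [case: ifP => _|]; apply/andP. Qed.

Lemma wt_hot s u v : v \in hotv o s u -> wt s (ed u v) = a.
Proof.
rewrite inE eq_sym => /andP[vu h]; rewrite /wt ed_pairs //.
by rewrite (ed_sym s) h.
Qed.

Lemma wt_cold s u v : v \in coldv o s u -> wt s (ed u v) = b.
Proof.
rewrite inE eq_sym => /andP[vu h]; rewrite /wt ed_pairs //.
by rewrite (ed_sym s) (negPf h).
Qed.

Lemma Ex_deg2 s u (B C : {set V n}) (h : nat -> nat -> R) :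
  B \subset hotv o s u -> C \subset coldv o s u ->
  Ex (wt s) (fun G => h (deg G u B) (deg G u C)) =
  binE2 #|B| #|C| a (1 - a) b (1 - b) h.
Proof.
move=> Bh Cc.
have uB : u \notin B by apply: contra (fintype.subsetP Bh u) (hotv_notin o s u).
have uC : u \notin C by apply: contra (fintype.subsetP Cc u) (coldv_notin o s u).
rewrite (@Ex_count2 _ _ _ _ _ a b) ?card_star //.
- apply: star_disjoint => //; apply: disjointWl Bh _; apply: disjointWr Cc _.
  exact: hot_cold_disjoint.
- by move=> e /imsetP[v vB ->]; apply: wt_hot; apply: (fintype.subsetP Bh).
- by move=> e /imsetP[v vC ->]; apply: wt_cold; apply: (fintype.subsetP Cc).
Qed.

Lemma wt_neg s : wt (neg_lab s) = wt s.
Proof.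
apply: funext => e; rewrite /wt !ffunE.
by case: (s e.1); case: (s e.2).
Qed.

Lemma edge_affinity s t e : e \in boundary (diffset s t) ->
  Num.sqrt (wt s e) * Num.sqrt (wt t e) +
  Num.sqrt (1 - wt s e) * Num.sqrt (1 - wt t e) = affinity a b.
Proof.
rewrite inE => /andP[eP]; rewrite /wt eP /diffset !inE => h.
rewrite /affinity !sqrtrM ?subr_ge0 //.
move: h; case: (s e.1); case: (s e.2); case: (t e.1); case: (t e.2); case: o => //= _;
  by rewrite mulrC [X in _ + X]mulrC.
Qed.

Lemma wt_off_boundary s t e : e \notin boundary (diffset s t) -> wt t e = wt s e.
Proof.
rewrite inE negb_and negbK /wt /diffset !inE => /orP[/negPf -> //|].
by case: (s e.1); case: (s e.2); case: (t e.1); case: (t e.2).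
Qed.

Let sqrt_unit (x : R) : 0 <= x <= 1 ->
  Num.sqrt x * Num.sqrt x = x /\ Num.sqrt (1 - x) * Num.sqrt (1 - x) = 1 - x.
Proof. by case/andP=> x0 x1; rewrite -!expr2 !sqr_sqrtr ?subr_ge0. Qed.

(** A pair off the boundary has the same weight w under both labellings and contributes w + (1 - w)
    = 1. *)
Lemma sum_rbern s t :
  \sum_G rbern (wt s) G * rbern (wt t) G = affinity a b ^+ #|boundary (diffset s t)|.
Proof.
rewrite (eq_bigr (fun G => \prod_e (if e \in G then Num.sqrt (wt s e) * Num.sqrt (wt t e)
    else Num.sqrt (1 - wt s e) * Num.sqrt (1 - wt t e)))); last first.
  by move=> G _; rewrite -big_split /=; apply: eq_bigr => e _; case: ifP.
rewrite sum_prod_set -prodr_const [RHS]big_mkcond; apply: eq_bigr => e _.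
case: ifPn => [/edge_affinity //|/wt_off_boundary ->].
by have [-> ->] := sqrt_unit (wt01 s e); rewrite subrKC.
Qed.

(* The exponential moment in [z] of the edges inside [S] is independent of the
   affinity, which comes from the boundary of [S] alone. *)
Lemma affinity_inner s t (z : R) : 1 <= z ->
  \sum_G rbern (wt s) G * rbern (wt t) G * z ^+ #|G :&: inner (diffset s t)| <=
  affinity a b ^+ #|boundary (diffset s t)| *
  (1 + a * z) ^+ #|inner (diffset s t)|.
Proof.
move=> z1; set S := diffset s t.
have z0 : 0 <= z by exact: le_trans z1.
pose f e := Num.sqrt (wt s e) * Num.sqrt (wt t e) * (if e \in inner S then z else 1).
pose g e := Num.sqrt (1 - wt s e) * Num.sqrt (1 - wt t e).
have f0 e : 0 <= f e by rewrite /f !mulr_ge0 ?sqrtr_ge0 //; case: ifP.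
have g0 e : 0 <= g e by rewrite /g mulr_ge0 ?sqrtr_ge0.
rewrite (eq_bigr (fun G => \prod_e (if e \in G then f e else g e))); last first.
  move=> G _; rewrite /rbern -big_split /=.
  have -> : z ^+ #|G :&: inner S| = \prod_e (if e \in G then (if e \in inner S then z else 1) else 1).
    rewrite -prodr_const big_mkcond /=; apply: eq_bigr => e _.
    by rewrite inE; case: (e \in G).
  rewrite -big_split /=; apply: eq_bigr => e _; rewrite /f /g.
  by case: (e \in G); rewrite ?mulr1.
rewrite sum_prod_set.
apply: (@le_trans _ _ (\prod_e ((if e \in boundary S then affinity a b else 1) *
    (if e \in inner S then 1 + a * z else 1)))); last first.
  by rewrite big_split /= -!big_mkcond /= !prodr_const.
apply: ler_prod => e _; rewrite addr_ge0 //= /f /g.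
have [eB|eB] := boolP (e \in boundary S).
  have -> : (e \in inner S) = false.
    by move: eB; rewrite !inE; case: (_ != t e.1); case: (_ != t e.2); rewrite ?andbF.
  by rewrite !mulr1 edge_affinity.
have /andP[w0 w1] := wt01 s e.
rewrite (wt_off_boundary eB); have [-> ->] := sqrt_unit (wt01 s e).
rewrite mul1r; case: ifP => _; last by rewrite mulr1 subrKC.
have wa : wt s e <= a by rewrite /wt; case: ifP => // _; case: ifP.
have := ler_wpM2r z0 wa; lra.
Qed.

Definition valid_margin M s G :=
  [forall u, deg G u (coldv o s u) + M < deg G u (hotv o s u)]%N.

Lemma Ex_invalid M s : balanced s ->
  Ex (wt s) (fun G => (~~ valid_margin M s G)%:R) <=
  (2 * n)%:R * pr2 (n - o) (n - ~~ o) a b (fun i j => i <= j + M)%N.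
Proof.
move=> bs.
apply: (@le_trans _ _ (Ex (wt s) (fun G => \sum_u (deg G u (hotv o s u) <= deg G u (coldv o s u) + M)%N%:R))).
  apply: le_Ex => [e|G]; first exact: wt01.
  have [|h] := boolP (valid_margin M s G); first by rewrite sumr_ge0.
  move: h; rewrite negb_forall => /existsP[u]; rewrite -leqNgt => h.
  by rewrite (bigD1 u) //= h lerDl sumr_ge0.
rewrite Ex_sum (eq_bigr (fun=> pr2 (n - o) (n - ~~ o) a b (fun i j => i <= j + M)%N)).
  by rewrite sumr_const card_ord mulr_natl.
move=> u _; rewrite (Ex_deg2 (fun i j => (i <= j + M)%N%:R)) //.
by have [-> ->] := card_hotv_cold o u bs.
Qed.

Lemma valid_margin_inner M s t G : valid_margin M s G -> valid_margin M t G ->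
  (#|diffset s t| * M.+1 <= 2 * #|G :&: inner (diffset s t)|)%N.
Proof.
move=> /forallP vs /forallP vt; apply: leq_trans (sum_deg_inner G _).
rewrite -sum_nat_const; apply: leq_sum => u uS; exact: (margin_inner uS (vs u) (vt u)).
Qed.

(** A single vertex of the difference set already has more than M neighbours in it. *)
Lemma valid_margin_card M s t G : (0 < #|diffset s t|)%N ->
  valid_margin M s G -> valid_margin M t G -> (M < #|diffset s t|)%N.
Proof.
rewrite card_gt0 => /set0Pn[u uS] /forallP vs /forallP vt.
apply: leq_trans (margin_inner uS (vs u) (vt u)) (leq_trans (deg_le _ _ _) _).
by apply: subset_leq_card; exact: subD1set.
Qed.

Lemma valid_margin_neg M s G : valid_margin M (neg_lab s) G = valid_margin M s G.
Proof.
rewrite /valid_margin; apply: eq_forallb => u.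
have -> : hotv o (neg_lab s) u = hotv o s u.
  by apply/setP => v; rewrite !inE !ffunE; case: (s u); case: (s v).
have -> // : coldv o (neg_lab s) u = coldv o s u.
by apply/setP => v; rewrite !inE !ffunE; case: (s u); case: (s v).
Qed.

Lemma balanced_neg s : balanced s -> balanced (neg_lab s).
Proof.
move=> bs; rewrite /balanced -[X in _ == X](card_class false bs); apply/eqP.
by apply: eq_card => v; rewrite !inE ffunE; case: (s v).
Qed.

Lemma likelihood_estimator (valid : labelling n -> graph n -> bool) :
  exists f : graph n -> labelling n, forall G s, balanced s -> valid s G ->
    [/\ balanced (f G), valid (f G) G & bern (wt s) G <= bern (wt (f G)) G].
Proof.
pose P G := [pred t | balanced t && valid t G].
pose best G t := P G t && [forall t', P G t' ==> (bern (wt t') G <= bern (wt t) G)].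
(* The default is taken only if no balanced labelling is valid for G, which the premises on s
   exclude. *)
exists (fun G => odflt [ffun=> true] [pick t | best G t]) => G s bs vs.
case: pickP => [t /andP[/andP[bt vt] /forallP m]|none].
  by split => //; have := m s; rewrite /= bs vs.
have Ps : P G s by rewrite /= bs vs.
have [t Pt m] := @arg_maxP _ _ _ s (P G) (fun t => bern (wt t) G) Ps.
have := none t; rewrite /best /= in Pt *; rewrite Pt => /negP[] /=.
by apply/forallP => t'; apply/implyP => /m.
Qed.

(** If s is valid and the output is bad, the output has at least the likelihood of s, and it or its
    negative is a valid labelling near s. Validity and likelihood do not see the global sign, so
    only near labellings have to be summed, each at the price of a geometric mean restricted to
    graphs for which both labellings are valid. *)
Lemma union_bound (valid : labelling n -> graph n -> bool)
    (f : graph n -> labelling n) (bad near : rel (labelling n)) s :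
  (forall G t, balanced t -> valid t G ->
    [/\ balanced (f G), valid (f G) G & bern (wt t) G <= bern (wt (f G)) G]) ->
  (forall t G, valid (neg_lab t) G = valid t G) ->
  balanced s ->
  (forall t, balanced t -> bad s t -> near s t || near s (neg_lab t)) ->
  Ex (wt s) (fun G => (bad s (f G))%:R) <=
  Ex (wt s) (fun G => (~~ valid s G)%:R) +
  \sum_(t | balanced t && near s t)
     \sum_G rbern (wt s) G * rbern (wt t) G * (valid s G && valid t G)%:R.
Proof.
move=> hf vneg bs hbad; rewrite exchange_big /= /Ex -big_split /=.
apply: ler_sum => G _.
have S0 (P : pred (labelling n)) (c : labelling n -> bool) :
    0 <= \sum_(t | P t) rbern (wt s) G * rbern (wt t) G * (c t)%:R.
  by apply: sumr_ge0 => t _; rewrite !mulr_ge0 ?rbern_ge0.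
have B0 : 0 <= bern (wt s) G by apply: bern_ge0 => e; exact: wt01.
have [vs|_] := boolP (valid s G); last first.
  rewrite mulr1 -[leLHS]addr0; apply: lerD; last exact: S0.
  by rewrite ler_piMr // lern1 leq_b1.
rewrite mulr0 add0r.
have [bf|_] := boolP (bad s (f G)); last by rewrite mulr0.
have [bal vf le] := hf G s bs vs.
have key t : balanced t -> near s t -> valid t G -> bern (wt s) G <= bern (wt t) G ->
    bern (wt s) G * true%:R <= \sum_(t | balanced t && near s t)
      rbern (wt s) G * rbern (wt t) G * (valid s G && valid t G)%:R.
  move=> bt nt vt h; rewrite mulr1 (bigD1 t) /=; last by rewrite bt.
  rewrite vs vt mulr1 -[leLHS]addr0; apply: lerD; last by rewrite -vs; exact: S0.
  by apply: bern_le_rbern => // e; exact: wt01.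
have := hbad (f G) bal bf; case/orP => h.
  by have := key _ bal h vf le; rewrite vs.
by have := key _ (balanced_neg bal) h; rewrite vneg wt_neg vs; apply.
Qed.

End Model.

Section ModelProbability.
Variables (R : realType) (n : nat).
Implicit Types (p q : R) (s t : labelling n) (G : graph n) (E : labelling n -> graph n -> bool).

Lemma exists_balanced : exists s : labelling n, balanced s.
Proof.
exists [ffun i : V n => (val i < n)%N].
have h : (n <= 2 * n)%N by lia.
have inj : injective (widen_ord h) by move=> i j [e]; apply: val_inj.
rewrite /balanced -[X in _ == X](card_ord n) -(card_imset _ inj).
apply/eqP/eq_card => i; rewrite !inE ffunE; apply/idP/imsetP => [lt|[j _ ->]] //=.
by exists (Ordinal lt) => //; apply: val_inj.
Qed.

Definition balanced_count : R := #|[set t : labelling n | balanced t]|%:R.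

Lemma balanced_count_gt0 : 0 < balanced_count.
Proof.
have [s bs] := exists_balanced.
by rewrite ltr0n card_gt0; apply/set0Pn; exists s; rewrite inE.
Qed.

Definition model_wt p q s := wt (q <= p) (Num.max p q) (Num.min p q) s.

Lemma edge_probE p q s e : e \in pairs n -> edge_prob p q s e = model_wt p q s e.
Proof.
move=> eP; rewrite /model_wt /wt /edge_prob eP.
by case: leP => _; case: (s e.1 == s e.2).
Qed.

Lemma model_weightE p q s G : balanced s ->
  model_weight p q s G = balanced_count^-1 * bern (model_wt p q s) G.
Proof.
move=> bs; rewrite /model_weight bs /=; case: ifPn => [GP|].
  congr (_ * _); rewrite big_mkcond /bern; apply: eq_bigr => e _.
  case: ifPn => [eP|eP]; first by rewrite edge_probE.
  by rewrite (contraNF (fintype.subsetP GP e) eP) /model_wt /wt (negPf eP) subr0.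
case/subsetPn => e eG eP.
by rewrite /bern (bigD1 e) //= eG {1}/model_wt /wt (negPf eP) mul0r mulr0.
Qed.

Lemma model_probE p q E : model_prob p q E =
  balanced_count^-1 * \sum_(s : labelling n | balanced s)
     Ex (model_wt p q s) (fun G => (E s G)%:R).
Proof.
rewrite /model_prob mulr_sumr [RHS]big_mkcond; apply: eq_bigr => s _.
case: ifPn => bs.
  rewrite /Ex mulr_sumr; apply: eq_bigr => G _.
  by rewrite model_weightE // mulrA; case: ifP; rewrite ?mulr1 ?mulr0.
by rewrite big1 // => G _; rewrite /model_weight (negPf bs); case: ifP.
Qed.

Lemma model_prob_le p q (E : labelling n -> graph n -> bool) c :
  (forall s, balanced s -> Ex (model_wt p q s) (fun G => (E s G)%:R) <= c) ->
  model_prob p q E <= c.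
Proof.
move=> h; rewrite model_probE mulrC ler_pdivrMr ?balanced_count_gt0 //.
apply: (@le_trans _ _ (\sum_(s : labelling n | balanced s) c)).
  by apply: ler_sum => s; exact: h.
rewrite sumr_const -mulr_natr /balanced_count.
have -> // : #|(fun s : labelling n => balanced s)| = #|[set t : labelling n | balanced t]|.
by apply: eq_card => t; rewrite !inE.
Qed.

Lemma model_wt01 p q s e : 0 <= p <= 1 -> 0 <= q <= 1 -> 0 <= model_wt p q s e <= 1.
Proof.
move=> /andP[p0 p1] /andP[q0 q1]; apply: wt01.
- by rewrite le_min p0.
- by rewrite ge_min le_max lexx.
- by rewrite ge_max p1.
Qed.

Lemma model_prob_ge0 p q E : 0 <= p <= 1 -> 0 <= q <= 1 ->
  0 <= model_prob p q E.
Proof.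
move=> p01 q01; rewrite model_probE mulr_ge0 ?invr_ge0 ?(ltW balanced_count_gt0) //.
apply: sumr_ge0 => s _; apply: Ex_ge0 => // e; exact: model_wt01.
Qed.

Lemma model_prob_not p q E :
  model_prob p q (fun s G => ~~ E s G) = 1 - model_prob p q E.
Proof.
rewrite !model_probE; apply/eqP; rewrite eq_sym subr_eq eq_sym -mulrDr -big_split /=.
rewrite (eq_bigr (fun=> 1)) => [|s _].
  rewrite sumr_const mulrC; apply/eqP.
  have -> : #|(fun s : labelling n => balanced s)| = #|[set t : labelling n | balanced t]|.
    by apply: eq_card => t; rewrite !inE.
  by rewrite divff // gt_eqF // balanced_count_gt0.
rewrite -ExD -[RHS](Ex_cst (model_wt p q s)); apply: eq_Ex => G.
by case: (E s G); rewrite ?addr0 ?add0r.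
Qed.

Lemma model_prob_compl p q E :
  model_prob p q (fun s G => E s (pairs n :\: G)) = model_prob (1 - p) (1 - q) E :> R.
Proof.
rewrite /model_prob; apply: eq_bigr => s _.
(* The complement within [pairs n] is not injective on all sets of ordered pairs. The symmetric
   difference with [pairs n] is an involution, and agrees with it on graphs. *)
pose c G := (pairs n :\: G) :|: (G :\: pairs n).
have cK : involutive c.
  by move=> G; apply/setP => e; rewrite !inE; case: (_ < _)%N; case: (e \in G).
have cS G : (c G \subset pairs n) = (G \subset pairs n).
  rewrite /c finset.subUset subsetDl /= -finset.setD_eq0 -[RHS]finset.setD_eq0.
  by congr (_ == _); apply/setP => e; rewrite !inE; case: (_ < _)%N.
rewrite [RHS](reindex_inj (inv_inj cK)) /=; apply: eq_bigr => G _.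
rewrite /model_weight cS.
have [GP|_] := boolP (balanced s && (G \subset pairs n)); last by rewrite !if_same.
have -> : pairs n :\: G = c G.
  apply/setP => e; rewrite !inE; move/andP: GP => [_ /fintype.subsetP/(_ e)]; rewrite inE.
  by case: (e \in G); case: (_ < _)%N => //= h; have := h isT.
case: ifP => // _; congr (_ * _); apply: eq_bigr => e; rewrite inE => eP.
rewrite !inE eP /= andbT /edge_prob orbF; case: (e \in G) => /=; case: ifP => _ //;
  by rewrite subKr.
Qed.

End ModelProbability.

Section NearLabellings.
Variables (R : realType) (n : nat).
Implicit Types (s t : labelling n).

Lemma diffset_neg s t : diffset s (neg_lab t) = ~: diffset s t.
Proof. by apply/setP => v; rewrite !inE ffunE; case: (s v); case: (t v). Qed.

Lemma diffset_eq0 s t : (diffset s t == finset.set0) = (t == s).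
Proof.
apply/eqP/eqP => [/setP e|->]; last by apply/setP => v; rewrite !inE eqxx.
apply/ffunP => v; have := e v; rewrite !inE; by case: (s v); case: (t v).
Qed.

Lemma diffset_neg_card s t : #|diffset s (neg_lab t)| = (2 * n - #|diffset s t|)%N.
Proof.
have := cardsC (diffset s t); rewrite diffset_neg card_ord => e.
by apply/eqP; rewrite -(eqn_add2l #|diffset s t|) e subnKC // -[X in (_ <= X)%N]e leq_addr.
Qed.

Lemma diffset_card_le s t : (#|diffset s t| <= 2 * n)%N.
Proof. by rewrite -[X in (_ <= X)%N](card_ord (2 * n)) max_card. Qed.

Lemma neg_labK : involutive (@neg_lab n).
Proof. by move=> s; apply/ffunP => v; rewrite !ffunE negbK. Qed.

(** The difference sets of t and of its negative are complementary, so one of them has at most n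
    vertices. *)
Lemma near_or_neg s t : ~~ ((t == s) || (t == neg_lab s)) ->
  (0 < #|diffset s t| <= n)%N || (0 < #|diffset s (neg_lab t)| <= n)%N.
Proof.
rewrite negb_or -(inv_eq neg_labK) -!diffset_eq0.
rewrite -[diffset s t == _]cards_eq0 -[diffset s (neg_lab t) == _]cards_eq0.
by rewrite diffset_neg_card; move: (#|diffset s t|) => k; lia.
Qed.

Lemma sum_near s (F : labelling n -> R) (T : nat -> R) : balanced s ->
  (forall k, 0 <= T k) ->
  (forall t k, balanced t -> #|diffset s t| = (2 * k)%N -> (0 < k)%N -> (2 * k <= n)%N ->
     F t <= T k) ->
  \sum_(t | balanced t && (0 < #|diffset s t| <= n)%N) F t <=
  \sum_(1 <= k < n.+1 | (2 * k <= n)%N) ('C(n, k) ^ 2)%:R * T k.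
Proof.
move=> bs T0 FT.
apply: (@le_trans _ _ (\sum_(t | balanced t && (0 < #|diffset s t| <= n)%N)
   \sum_(1 <= k < n.+1 | (2 * k <= n)%N) (#|diffset s t| == 2 * k)%N%:R * T k)).
  apply: ler_sum => t /andP[bt /andP[S0 Sn]].
  have e := balanced_diffset true bs bt.
  set k := #|_ :&: _| in e.
  rewrite -e in S0 Sn.
  have k0 : (0 < k)%N by move: S0; clearbody k; lia.
  have kn : (k < n.+1)%N by move: Sn; clearbody k; lia.
  rewrite big_mkcond (bigD1_seq k) ?iota_uniq ?mem_index_iota ?k0 //=.
  rewrite Sn e eqxx mul1r -[leLHS]addr0 lerD ?(FT t k) //.
  by apply: sumr_ge0 => i _; case: ifP => // _; rewrite mulr_ge0.
rewrite exchange_big /=; apply: ler_sum => k kn.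
rewrite -mulr_suml ler_wpM2r // -natr_sum ler_nat.
apply: leq_trans (card_labellings_at k bs).
rewrite -sum1_card big_mkcond [leqRHS]big_mkcond /=; apply: leq_sum => t _.
by rewrite inE; case: (balanced t) => //=; case: ifP => // _; case: (_ == _).
Qed.

End NearLabellings.

(** * Sufficiency for strong consistency *)

Section Estimates.
Variable R : realType.

Lemma sum_geometric_le (F : nat -> R) (P : pred nat) (x : R) n : 0 <= x <= 1 / 2 ->
  (forall k, (0 < k)%N -> (k <= n)%N -> P k -> F k <= x ^+ k) ->
  \sum_(1 <= k < n.+1 | P k) F k <= 2 * x.
Proof.
move=> /andP[x0 x2] hF.
have closed m : (1 - x) * \sum_(1 <= k < m.+1) x ^+ k = x - x ^+ m.+1.
  elim: m => [|m IH]; first by rewrite big_geq // mulr0 subrr.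
  by rewrite big_nat_recr //= mulrDr IH !exprS; ring.
apply: (@le_trans _ _ (\sum_(1 <= k < n.+1) x ^+ k)).
  rewrite big_mkcond big_nat [leRHS]big_nat; apply: ler_sum => k /andP[k0 kn].
  by case: ifP => [/hF ->//|_]; rewrite exprn_ge0.
have S0 : 0 <= \sum_(1 <= k < n.+1) x ^+ k by apply: sumr_ge0 => k _; rewrite exprn_ge0.
have := closed n; have : 0 <= x ^+ n.+1 by rewrite exprn_ge0.
have := ler_wpM2r S0 x2; lra.
Qed.

(** Half of Stirling's formula, by induction from (1 + 1/k)^k <= e. *)
Lemma expn_le_fact k : k%:R ^+ k <= expR 1 ^+ k * (k`!)%:R :> R.
Proof.
elim: k => [|k IH]; first by rewrite !expr0 mul1r.
have step : (k.+1%:R : R) ^+ k <= expR 1 * k%:R ^+ k.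
  case: k {IH} => [|k]; first by rewrite !expr0 mulr1 -[leLHS]expR0 ler_expR.
  have -> : (k.+2%:R : R) = (1 + k.+1%:R^-1) * k.+1%:R.
    by rewrite mulrDl mul1r mulVf ?pnatr_eq0 // natr1.
  rewrite exprMn ler_wpM2r ?exprn_ge0 //.
  have -> : expR 1 = expR (k.+1%:R^-1) ^+ k.+1 :> R.
    by rewrite -expRM_natl -mulr_natl mulr1 mulfV // pnatr_eq0.
  by rewrite lerXn2r ?nnegrE ?expR_ge0 ?addr_ge0 ?invr_ge0 ?expR_ge1Dx.
rewrite exprS factS natrM; apply: le_trans (ler_wpM2l (ler0n _ _) step) _.
have := ler_wpM2l (mulr_ge0 (ler0n R k.+1) (expR_ge0 1)) IH.
by rewrite [_ ^+ k.+1]exprS; lra.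
Qed.

Lemma ffact_le_expn n k : (n ^_ k <= n ^ k)%N.
Proof. by elim: k => // k IH; rewrite ffactnSr expnSr leq_mul // leq_subr. Qed.

Lemma bin_le_expn n k : 'C(n, k)%:R * k%:R ^+ k <= (expR 1 * n%:R) ^+ k :> R.
Proof.
apply: le_trans (ler_wpM2l (ler0n _ _) (expn_le_fact k)) _.
rewrite mulrCA exprMn ler_wpM2l ?exprn_ge0 ?expR_ge0 //.
by rewrite -natrM bin_ffact -natrX ler_nat ffact_le_expn.
Qed.

(* [n^(2k/n) <= e^2 k] because [ln (n/k) <= n/k]. *)
Lemma rho_pow_le (r th m : R) n k : 0 <= r -> 0 < th -> th <= m -> th ^+ 2 <= m ->
  n%:R * r ^+ n <= th -> (0 < k)%N -> (2 * k <= n)%N ->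
  r ^+ (2 * (n - k)) <= expR 2 * k%:R * m / n%:R ^+ 2.
Proof.
move=> r0 th0 thm th2m rn k0 kn.
have n0 : (0 < n)%N by lia.
have nk0 : (0 < 2 * (n - k))%N by lia.
have kn' : (k <= n)%N by lia.
have m0 : 0 < m by exact: lt_le_trans thm.
have nR : 0 < n%:R :> R by rewrite ltr0n.
have kR : 0 < k%:R :> R by rewrite ltr0n.
have rhs : 0 < expR 2 * k%:R * m / n%:R ^+ 2.
  by rewrite divr_gt0 ?exprn_gt0 // mulr_gt0 // mulr_gt0 // expR_gt0.
move: r0; rewrite le_eqVlt => /orP[/eqP <-|r0].
  by rewrite expr0n gtn_eqF ?nk0 ?ltW.
rewrite -(@lnK _ (r ^+ _)) ?posrE ?exprn_gt0 // -[leRHS]lnK ?posrE // ler_expR.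
rewrite lnXn // !lnM ?posrE ?invr_gt0 ?exprn_gt0 ?mulr_gt0 ?expR_gt0 //.
rewrite expRK lnV ?posrE ?exprn_gt0 // lnXn //.
set L := ln r.
have hL : n%:R * L <= ln th - ln n%:R.
  have : ln (n%:R * r ^+ n) <= ln th by rewrite ler_ln ?posrE // mulr_gt0 // exprn_gt0.
  by rewrite lnM ?posrE ?exprn_gt0 // lnXn // -mulr_natl -/L; lra.
have h1 : ln th <= ln m by rewrite ler_ln ?posrE.
have h2 : 2 * ln th <= ln m.
  have : ln (th ^+ 2) <= ln m by rewrite ler_ln ?posrE // exprn_gt0.
  by rewrite lnXn // mulr_natl.
pose kap : R := k%:R / n%:R.
have kap0 : 0 <= kap by rewrite divr_ge0.
have kap2 : 2 * kap <= 1 by rewrite mulrA ler_pdivrMr // mul1r -natrM ler_nat.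
have nk : kap * n%:R = k%:R by rewrite /kap divfK // gt_eqF.
have hk : kap * (ln n%:R - ln k%:R) <= 1.
  have : ln (n%:R / k%:R) <= n%:R / k%:R :> R.
    have h : ln (n%:R / k%:R) <= n%:R / k%:R - 1 :> R.
      have := @le_ln1Dx R (n%:R / k%:R - 1); rewrite subrKC; apply.
      by rewrite ltrBrDl subrr divr_gt0.
    by apply: le_trans h _; rewrite lerBlDr lerDl.
  rewrite ln_div ?posrE // => /(ler_wpM2l kap0).
  by rewrite /kap mulrA divfK ?gt_eqF // divff ?gt_eqF.
have lnk : 0 <= ln k%:R :> R by rewrite ln_ge0 // ler1n.
have e : (L *+ (2 * (n - k))) = 2 * (1 - kap) * (n%:R * L).
  have e' : ((2 * (n - k))%N%:R : R) = 2 * (n%:R - k%:R) by rewrite natrM natrB.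
  by rewrite -[L *+ _]mulr_natl e' -nk; ring.
rewrite e -[ln _ *+ 2]mulr_natl.
have c0 : 0 <= 2 * (1 - kap) by lra.
apply: le_trans (ler_wpM2l c0 hL) _.
(* The exponent 2 (1 - kap) of th lies between 1 and 2, which is why m has to dominate both th and
   th^2. *)
have h3 : 2 * (1 - kap) * ln th <= ln m.
  have : (1 - 2 * kap) * (2 * ln th) <= (1 - 2 * kap) * ln m.
    by rewrite ler_wpM2l //; lra.
  have : 2 * kap * ln th <= 2 * kap * ln m by rewrite ler_wpM2l //; lra.
  lra.
have h4 : 2 * kap * ln k%:R <= 1 * ln k%:R :> R by rewrite ler_wpM2r.
lra.
Qed.

(** The binomial coefficient is at most (e n / k)^k, and [rho_pow_le] bounds the k-th root of the
    power of r; the powers of n cancel in (e n / k)^2 (e^2 k m / n^2). *)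
Lemma swap_term_le (r th m : R) n k : 0 <= r -> 0 < th -> th <= m -> th ^+ 2 <= m ->
  n%:R * r ^+ n <= th -> (0 < k)%N -> (2 * k <= n)%N ->
  ('C(n, k) ^ 2)%:R * r ^+ (2 * k * (n - k)) <= (expR 4 * m / k%:R) ^+ k.
Proof.
move=> r0 th0 thm th2m rn k0 kn.
have h := rho_pow_le r0 th0 thm th2m rn k0 kn.
have n0 : (0 < n)%N by lia.
have nR : 0 < n%:R :> R by rewrite ltr0n.
have kR : 0 < k%:R :> R by rewrite ltr0n.
have b := bin_le_expn n k.
have {}b : 'C(n, k)%:R <= (expR 1 * n%:R / k%:R) ^+ k :> R.
  by rewrite exprMn exprVn ler_pdivlMr // exprn_gt0.
rewrite natrX mulnAC exprM.
have {}b : 'C(n, k)%:R ^+ 2 <= ((expR 1 * n%:R / k%:R) ^+ 2) ^+ k :> R.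
  have q0 : 0 <= expR 1 * n%:R / k%:R :> R by rewrite !mulr_ge0 ?invr_ge0 ?expR_ge0.
  by rewrite -exprM mulnC exprM lerXn2r ?nnegrE ?exprn_ge0.
apply: (@le_trans _ _ (((expR 1 * n%:R / k%:R) ^+ 2) ^+ k * (expR 2 * k%:R * m / n%:R ^+ 2) ^+ k)).
  apply: ler_pM => //; rewrite ?exprn_ge0 //.
  by rewrite lerXn2r ?nnegrE ?exprn_ge0 // (le_trans _ h) // exprn_ge0.
rewrite -exprMn (_ : (expR 1 * n%:R / k%:R) ^+ 2 * _ = expR 4 * m / k%:R) //.
have -> : expR 4 = expR 1 ^+ 2 * expR 2 :> R.
  by rewrite -expRM_natl -expRD; congr expR; rewrite -mulr_natl; lra.
by field; rewrite !gt_eqF.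
Qed.

End Estimates.

Section StrongUpper.
Variables (R : realType) (a b : R).
Hypotheses (b0 : 0 <= b) (ba : b <= a) (a1 : a <= 1).

Let a0 : 0 <= a. Proof. exact: le_trans ba. Qed.
Let b1 : b <= 1. Proof. exact: le_trans a1. Qed.
Let a01 : 0 <= a <= 1. Proof. by rewrite a0. Qed.
Let b01 : 0 <= b <= 1. Proof. by rewrite b0. Qed.

(** Taking a trial from X and giving one to Y both favour the event; the common part of m and n
    trials is in between. *)
Lemma pr2_swap_trial m n M :
  pr2 m.+1 n a b (fun i j => i <= j + M)%N <= pr2 m n.+1 a b (fun i j => i <= j + M)%N.
Proof.
have a1' : 0 <= 1 - a by rewrite subr_ge0.
have b1' : 0 <= 1 - b by rewrite subr_ge0.
apply: (@le_trans _ _ (pr2 m n a b (fun i j => i <= j + M)%N)).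
  rewrite {1}/pr2 /binE2 /= -/(binE2 m n a (1 - a) b (1 - b) (fun i j => (i <= j + M)%N%:R)).
  rewrite [leRHS](_ : _ = a * pr2 m n a b (fun i j => i <= j + M)%N +
    (1 - a) * pr2 m n a b (fun i j => i <= j + M)%N); last by ring.
  rewrite lerD2r ler_wpM2l //.
  apply: le_binE2 => // i j _ _; rewrite ler_nat.
  by case: (leqP i.+1 (j + M)) => // /ltnW ->.
apply: le_binE => // i _ /=.
set h := fun j => _; rewrite [leLHS](_ : _ = b * binE n b (1 - b) h +
  (1 - b) * binE n b (1 - b) h); last by ring.
rewrite lerD2r ler_wpM2l //.
apply: le_binE => // j _; rewrite ler_nat addSn.
by case: (leqP i (j + M)) => // /leqW ->.
Qed.

(* [r] further trials on each side bring a margin [M] back to [0], and [P] is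
   nonincreasing in the number of trials. *)
Lemma margin_tail_le (o : bool) n r M : (0 < n)%N ->
  pr2 (n - o) (n - ~~ o) a b (fun i j => i <= j + M)%N *
  pr2 r.+1 r a b (fun i j => i + M <= j)%N <= pr2 n n a b leq.
Proof.
case: n => // n _.
apply: (@le_trans _ _ (pr2 n n.+1 a b (fun i j => i <= j + M)%N *
    pr2 r.+1 r a b (fun i j => i + M <= j)%N)).
  apply: ler_wpM2r; first exact: pr2_ge0.
  case: o; rewrite /= ?subn0 subn1 //=; exact: pr2_swap_trial.
apply: le_trans (pr2_leq_mono b0 ba a1 (leq_addr r n.+1)).
rewrite {1}addSnnS; apply: pr2_addn => // i j i' j'; lia.
Qed.

Section Estimator.
Variables (n : nat) (o : bool).
Let W := wt o a b (n := n).

(** The common frame of the three regimes: e pays for a true labelling that is not valid, T k for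
    one competitor that differs at k vertices of each class, and x is the ratio of the geometric
    series that dominates the sum over k. *)
Lemma strong_estimator (valid : labelling n -> graph n -> bool) (T : nat -> R) (e x : R) :
  (forall t G, valid (neg_lab t) G = valid t G) ->
  (forall s, balanced s -> Ex (W s) (fun G => (~~ valid s G)%:R) <= e) ->
  (forall k, 0 <= T k) ->
  (forall s t k, balanced s -> balanced t -> #|diffset s t| = (2 * k)%N ->
     (0 < k)%N -> (2 * k <= n)%N ->
     \sum_G rbern (W s) G * rbern (W t) G * (valid s G && valid t G)%:R <= T k) ->
  0 <= x <= 1 / 2 ->
  (forall k, (0 < k)%N -> (2 * k <= n)%N -> ('C(n, k) ^ 2)%:R * T k <= x ^+ k) ->
  exists f : graph n -> labelling n, forall s, balanced s ->
    Ex (W s) (fun G => (~~ ((f G == s) || (f G == neg_lab s)))%:R) <= e + 2 * x.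
Proof.
move=> vneg ve T0 hT x01 hx.
have [f hf] := likelihood_estimator o a b valid.
exists f => s bs.
pose bad : rel (labelling n) := fun s t => ~~ ((t == s) || (t == neg_lab s)).
pose near : rel (labelling n) := fun s t => (0 < #|diffset s t| <= n)%N.
have := @union_bound R n o a b b0 ba a1 valid f bad near s (fun G t => hf G t) vneg bs
  (fun t _ => @near_or_neg n s t).
move=> /le_trans; apply; apply: lerD; first exact: ve.
apply: le_trans (sum_near bs T0 _) _ => [t k bt St k0 kn|]; first exact: hT.
apply: sum_geometric_le => // k k0 _; exact: hx.
Qed.

Lemma swap_rho_exp (s t : labelling n) k : #|diffset s t| = (2 * k)%N -> (2 * k <= n)%N ->
  affinity a b ^+ #|boundary (diffset s t)| = rho a b ^+ (2 * k * (n - k)).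
Proof.
move=> St kn; rewrite card_boundary -diffset_neg diffset_neg_card St /rho -exprM.
by congr (_ ^+ _); rewrite -mulnBr mulnCA.
Qed.

Lemma swap_affinity_le (s t : labelling n) k (c : graph n -> bool) :
  #|diffset s t| = (2 * k)%N -> (2 * k <= n)%N ->
  \sum_G rbern (W s) G * rbern (W t) G * (c G)%:R <= rho a b ^+ (2 * k * (n - k)).
Proof.
move=> St kn; rewrite -(swap_rho_exp St kn) -(sum_rbern o b0 ba a1).
by apply: ler_sum => G _; rewrite ler_piMr ?mulr_ge0 ?rbern_ge0 // lern1 leq_b1.
Qed.

(** Validity of both labellings gives each of the 2k vertices of the difference set an edge inside
    it, hence at least k inner edges. There are at most 2 k^2 inner pairs, of probability at most c;
    a Chernoff bound with z = 1 / (2 k c) turns the moment factor into e^k. *)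
Lemma swap_affinity_sparse (s t : labelling n) k c : #|diffset s t| = (2 * k)%N -> (0 < k)%N ->
  (2 * k <= n)%N -> 0 < c -> a <= c ->
  \sum_G rbern (W s) G * rbern (W t) G *
     (valid_margin o 0 s G && valid_margin o 0 t G)%:R <=
  rho a b ^+ (2 * k * (n - k)) * (2 * expR 1 * k%:R * c) ^+ k.
Proof.
move=> St k0 kn c0 ac.
have kR : 0 < k%:R :> R by rewrite ltr0n.
(* If 2 k c >= 1, the additional factor of the bound is at least 1 and the plain affinity suffices;
   otherwise z >= 1, as [affinity_inner] requires. *)
have [big|small] := leP 1 (2 * k%:R * c).
  apply: le_trans (swap_affinity_le _ St kn) _.
  apply: ler_peMr; [by rewrite exprn_ge0 ?rho_ge0|apply: exprn_ege1].
  apply: le_trans big _; rewrite ler_wpM2r ?(ltW c0) // ler_wpM2r //.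
  have := expR_ge1Dx (1 : R); lra.
pose z : R := (2 * k%:R * c)^-1.
have kc0 : 0 < 2 * k%:R * c by rewrite !mulr_gt0.
have z1 : 1 <= z by rewrite /z invf_ge1 // ltW.
have z0 : 0 < z by exact: lt_le_trans z1.
apply: (@le_trans _ _ (z^-1 ^+ k * \sum_G rbern (W s) G * rbern (W t) G *
    z ^+ #|G :&: inner (diffset s t)|)).
  rewrite mulr_sumr; apply: ler_sum => G _.
  rewrite [leRHS]mulrCA ler_wpM2l ?mulr_ge0 ?rbern_ge0 //.
  case: (boolP (_ && _)) => [/andP[vs vt]|_]; last first.
    by rewrite mulr_ge0 ?exprn_ge0 ?invr_ge0 // ltW.
  have := valid_margin_inner vs vt; rewrite St muln1 leq_pmul2l // => kI.
  by rewrite exprVn mulrC ler_pdivlMr ?exprn_gt0 // mul1r ler_weXn2l.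
apply: le_trans (ler_wpM2l _ (affinity_inner o b0 ba a1 s t z1)) _.
  by rewrite exprn_ge0 // invr_ge0 ltW.
rewrite (swap_rho_exp St kn) mulrCA ler_wpM2l ?exprn_ge0 ?rho_ge0 ?affinity_ge0 //.
have -> : (2 * expR 1 * k%:R * c) ^+ k = z^-1 ^+ k * expR k%:R.
  have -> : expR k%:R = expR 1 ^+ k :> R by rewrite -expRM_natl mulr1.
  by rewrite -exprMn /z invrK; congr (_ ^+ _); ring.
apply: ler_wpM2l; first by rewrite exprn_ge0 // invr_ge0 ltW.
have I2 : (#|inner (diffset s t)| <= 2 * k * k)%N.
  have := card_inner (diffset s t); rewrite St.
  have -> : (2 * k * (2 * k) = 2 * (2 * k * k))%N by lia.
  by rewrite leq_pmul2l.
have cz : c * z = (2 * k%:R)^-1.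
  by rewrite /z; field; rewrite !gt_eqF.
have az : 0 <= a * z by rewrite mulr_ge0 // ltW.
apply: (@le_trans _ _ (expR (c * z) ^+ (2 * k * k))).
  apply: (@le_trans _ _ ((1 + c * z) ^+ (2 * k * k))).
    apply: (@le_trans _ _ ((1 + a * z) ^+ (2 * k * k))).
      by rewrite ler_weXn2l // lerDl.
    by rewrite lerXn2r ?nnegrE ?addr_ge0 ?mulr_ge0 ?(ltW c0) ?(ltW z0) // lerD2l ler_wpM2r // ltW.
  by rewrite lerXn2r ?nnegrE ?expR_ge0 ?expR_ge1Dx // addr_ge0 // mulr_ge0 // ltW.
rewrite -expRM_natl ler_expR cz !natrM mulrAC mulfV ?mul1r //.
by rewrite mulf_neq0 // gt_eqF.
Qed.

End Estimator.
End StrongUpper.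

Section Regimes.
Variables (R : realType) (a b : R).
Hypotheses (b0 : 0 <= b) (ba : b <= a) (a1 : a <= 1).

Let a0 : 0 <= a. Proof. exact: le_trans ba. Qed.
Let b1 : b <= 1. Proof. exact: le_trans a1. Qed.
Let a01 : 0 <= a <= 1. Proof. by rewrite a0. Qed.
Let b01 : 0 <= b <= 1. Proof. by rewrite b0. Qed.

(** For x = a (1 - b) and y = b (1 - a) one has a - b = x - y, a product of sqrt x - sqrt y, whose
    square is 1 - rho, and sqrt x + sqrt y <= 2. *)
Lemma sqr_sub_le_rho : (a - b) ^+ 2 <= 4 * (1 - rho a b).
Proof.
rewrite -rho_sin //.
have x0 : 0 <= a * (1 - b) by rewrite mulr_ge0 // subr_ge0.
have y0 : 0 <= b * (1 - a) by rewrite mulr_ge0 // subr_ge0.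
have x1 : a * (1 - b) <= 1 by rewrite mulr_ile1 // ?subr_ge0 // lerBlDr lerDl.
have y1 : b * (1 - a) <= 1 by rewrite mulr_ile1 // ?subr_ge0 // lerBlDr lerDl.
have sx := sqr_sqrtr x0; have sy := sqr_sqrtr y0.
have -> : a - b = a * (1 - b) - b * (1 - a) by ring.
rewrite -{1}sx -{1}sy subr_sqr exprMn mulrC ler_wpM2r ?sqr_ge0 //.
have -> : (4 : R) = 2 ^+ 2 by ring.
rewrite lerXn2r ?nnegrE ?addr_ge0 ?sqrtr_ge0 //.
have sx1 := ler_wsqrtr x1; have sy1 := ler_wsqrtr y1; rewrite sqrtr1 in sx1 sy1; lra.
Qed.

(** From e^L = (e^(L/2))^2 >= (1 + L/2)^2 >= L^2 / 4, and 420 / 4 = 105. *)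
Lemma ln_large (z : nat) : 420 <= ln z%:R :> R -> 105 * ln z%:R <= z%:R :> R.
Proof.
set L := ln _ => L420.
have z0 : 0 < z%:R :> R.
  rewrite lt_neqAle ler0n andbT; apply/eqP => e.
  by move: L420; rewrite /L -e ln0 //; lra.
have <- : expR L = z%:R by rewrite lnK // posrE.
have -> : expR L = expR (L / 2) ^+ 2 by rewrite -expRM_natl; congr expR; field.
apply: (@le_trans _ _ ((1 + L / 2) ^+ 2)); first by nra.
by rewrite lerXn2r ?nnegrE ?expR_ge0 ?expR_ge1Dx //; lra.
Qed.

(* [rho^n >= 1 / (n z)] forces [1 / rho - 1] to be of order [ln n / n]. *)
Lemma rho_near_1 (n z : nat) : 420 <= ln z%:R :> R -> (z ^ 24 <= n)%N -> (n <= z ^ 25)%N ->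
  z%:R^-1 < n%:R * rho a b ^+ n ->
  0 < rho a b /\ n%:R * ((rho a b)^-1 - 1) <= 52 * ln z%:R.
Proof.
move=> L420 zn nz rn; have Lz := ln_large L420.
set Z : R := z%:R in L420 Lz rn *; set L := ln Z in L420 Lz *.
have Z0 : 0 < Z by lra.
have n0 : 0 < n%:R :> R.
  rewrite ltr0n; apply: leq_trans zn; rewrite expn_gt0; apply/orP; left.
  by rewrite -(ltr_nat R).
have n_gt0 : (0 < n)%N by rewrite -(ltr0n R).
have r0 : 0 < rho a b.
  rewrite lt_neqAle rho_ge0 andbT; apply/eqP => e; move: rn; rewrite -e expr0n.
  by rewrite gtn_eqF // mulr0 ltNge invr_ge0 ltW.
have rn_gt0 : 0 < rho a b ^+ n := exprn_gt0 n r0.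
split=> //.
have nL : ln n%:R <= 25 * L.
  have : ln n%:R <= ln (Z ^+ 25) by rewrite ler_ln ?posrE ?exprn_gt0 // -natrX ler_nat.
  by rewrite lnXn // mulr_natl.
have h : - (n%:R * ln (rho a b)) <= 26 * L.
  have : ln Z^-1 <= ln (n%:R * rho a b ^+ n).
    by rewrite ler_ln ?posrE ?(lt_trans _ rn) ?invr_gt0 // ltW.
  rewrite lnV ?posrE // lnM ?posrE // lnXn // -[ln (rho a b) *+ n]mulr_natl -/L; lra.
(* x bounds - ln rho: 25 L comes from n <= z^25 and one further L from the lower bound 1/z on n
   rho^n. *)
pose x : R := 26 * L / n%:R.
have zn' : Z <= n%:R.
  rewrite ler_nat; apply: leq_trans zn; rewrite -{1}(expn1 z) leq_pexp2l //.
  by rewrite -(ltr_nat R).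
have x0 : 0 <= x by rewrite divr_ge0 // mulr_ge0 //; lra.
have x2 : x <= 1 / 2 by rewrite ler_pdivrMr //; lra.
have rx : 1 - x <= rho a b.
  rewrite -(lnK r0); apply: le_trans (expR_ge1Dx _); rewrite lerD2l lerNl.
  by rewrite /x ler_pdivlMr // mulNr mulrC.
have : (rho a b)^-1 <= 1 + 2 * x.
  rewrite -[leLHS]mul1r ler_pdivrMr //.
  have : (1 + 2 * x) * (1 - x) <= (1 + 2 * x) * rho a b by rewrite ler_wpM2l //; lra.
  have := mulr_ge0 x0 (_ : 0 <= 1 - 2 * x); nra.
have nx : n%:R * x = 26 * L by rewrite /x; field; rewrite gt_eqF.
move=> hr; have := ler_wpM2l (ltW n0) (_ : (rho a b)^-1 - 1 <= 2 * x).
rewrite [n%:R * (2 * x)]mulrCA nx; move=> H; apply: le_trans (H _) _; lra.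
Qed.

End Regimes.

Section StrongUpperBound.
Variables (R : realType) (a b : R).
Hypotheses (b0 : 0 <= b) (ba : b <= a) (a1 : a <= 1).

Let a0 : 0 <= a. Proof. exact: le_trans ba. Qed.
Let a01 : 0 <= a <= 1. Proof. by rewrite a0. Qed.
Let b01 : 0 <= b <= 1. Proof. by rewrite b0 (le_trans ba). Qed.

Variables (n z : nat) (o : bool).
Let Z : R := z%:R.
Let L := ln Z.
(** The ratio of the series over k. It is exactly what the sparse regime yields, (e^4 Z^2 / k)(2 e k
    / Z^3), and an upper bound in the other two. *)
Let x : R := 2 * expR 4 * expR 1 / Z.
Let P := pr2 n n a b leq.
Let W := wt o a b (n := n).

Hypotheses (L420 : 420 <= L) (zn : (z ^ 24 <= n)%N) (nz : (n <= z ^ 25)%N).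

Let ZL : 105 * L <= Z. Proof. exact: ln_large. Qed.
Let Zbig : 100 <= Z. Proof. have := L420; have := ZL; lra. Qed.
Let Z0 : 0 < Z. Proof. have := Zbig; lra. Qed.
Let z_gt0 : (0 < z)%N. Proof. by rewrite -(ltr0n R). Qed.
Let n_gt0 : (0 < n)%N. Proof. by apply: leq_trans zn; rewrite expn_gt0 z_gt0. Qed.

Let x0 : 0 <= x. Proof. by rewrite !mulr_ge0 ?expR_ge0 // invr_ge0 ltW. Qed.

Let e2 : 2 <= expR 1 :> R. Proof. by have := expR_ge1Dx (1 : R); lra. Qed.

Let x01 : 0 <= x <= 1 / 2.
Proof.
rewrite x0 /x ler_pdivrMr //.
have e4 : 4 <= expR 2 :> R.
  have -> : expR 2 = expR 1 * expR 1 :> R by rewrite -expRD; congr expR; lra.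
  have := e2; nra.
have : expR 2 * expR 4 * expR 1 <= Z.
  rewrite -(@lnK _ Z) ?posrE // -!expRD ler_expR -/L; have := L420; lra.
have : 0 <= expR 4 * expR 1 :> R by rewrite mulr_ge0 ?expR_ge0.
move=> h; have := ler_wpM2r h e4; lra.
Qed.

Let Wfail (e : R) := exists f : graph n -> labelling n, forall s, balanced s ->
  Ex (W s) (fun G => (~~ ((f G == s) || (f G == neg_lab s)))%:R) <= e + 2 * x.

(** Here the union bound converges by itself, so every labelling counts as valid. *)
Let case_small_rho : n%:R * rho a b ^+ n <= Z^-1 -> Wfail 0.
Proof.
move=> rn.
apply: (@strong_estimator _ _ _ b0 ba a1 n o (fun _ _ => true)
  (fun k => rho a b ^+ (2 * k * (n - k)))) => //.
- by move=> s bs; rewrite [X in X <= _](_ : _ = 0) // -[RHS](Ex_cst (W s)).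
- by move=> k; rewrite exprn_ge0 ?rho_ge0.
- by move=> s t k bs bt St k0 kn; apply: (swap_affinity_le b0 ba a1 o (fun=> true)).
move=> k k0 kn.
have Zi0 : 0 < Z^-1 by rewrite invr_gt0.
have Zi1 : Z^-1 <= 1 by rewrite invf_le1 //; have := Zbig; lra.
apply: le_trans (swap_term_le (rho_ge0 a b) Zi0 (lexx _) _ rn k0 kn) _.
  by rewrite expr2 ler_piMr // ltW.
have kR : 0 < k%:R :> R by rewrite ltr0n.
rewrite lerXn2r ?nnegrE // ?divr_ge0 ?mulr_ge0 ?expR_ge0 ?(ltW Zi0) //.
rewrite ler_pdivrMr // /x mulrAC ler_wpM2r ?(ltW Zi0) //.
have : 1 <= 2 * expR 1 * k%:R :> R.
  have : 1 <= k%:R :> R by rewrite ler1n.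
  have := e2; nra.
move=> h; have := ler_wpM2l (expR_ge0 4) h; lra.
Qed.

(** Apply [pr2_leq_ge] with c = L - 1: then e^-c = e / Z, and e >= 2 makes up for the factor 1/2. *)
Let big_rho : n%:R * P <= 1 -> Z^-1 < n%:R * rho a b ^+ n -> n%:R * rho a b ^+ n <= Z.
Proof.
move=> nP rn; have [r0 nr] := rho_near_1 L420 zn nz rn.
have c0 : 0 < L - 1 by have := L420; lra.
have := pr2_leq_ge b0 ba a1 (n := n) r0 c0; rewrite -/P => H.
(* The origin of 420: the left side is at most 8 * 52 L = 416 L, and (L - 1)^2 >= (L - 2) L. *)
have : 8 * n%:R * ((rho a b)^-1 - 1) <= (L - 1) ^+ 2.
  rewrite -/Z -/L in nr; rewrite -mulrA; apply: (@le_trans _ _ (8 * (52 * L))); first by lra.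
  have : 0 <= L * (L - 420) by rewrite mulr_ge0 //; have := L420; lra.
  by have := L420; rewrite expr2; lra.
move=> /H {H}.
have n0 : 0 <= n%:R :> R by [].
move=> /(ler_wpM2l n0).
have -> : expR (- (L - 1)) = expR 1 / Z.
  by rewrite opprB expRD expRN lnK.
move=> h.
have : n%:R * (rho a b ^+ n * (expR 1 / Z) / 2) <= 1 by exact: le_trans nP.
have -> : n%:R * (rho a b ^+ n * (expR 1 / Z) / 2) = n%:R * rho a b ^+ n * expR 1 / (2 * Z).
  by field; rewrite gt_eqF.
rewrite ler_pdivrMr ?mulr_gt0 // mul1r => {}h.
have r1 : 0 <= n%:R * rho a b ^+ n := mulr_ge0 n0 (exprn_ge0 n (rho_ge0 a b)).
have := ler_wpM2l r1 e2; lra.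
Qed.

Let thZ k : n%:R * rho a b ^+ n <= Z -> (0 < k)%N -> (2 * k <= n)%N ->
  ('C(n, k) ^ 2)%:R * rho a b ^+ (2 * k * (n - k)) <= (expR 4 * Z ^+ 2 / k%:R) ^+ k.
Proof.
move=> rn k0 kn; apply: (swap_term_le (rho_ge0 a b) Z0 _ (lexx _) rn k0 kn).
by rewrite expr2 ler_peMl ?(ltW Z0) //; have := Zbig; lra.
Qed.

(** Margin 0 suffices. A single additional trial of X, failing with probability 1 - a >= 1/2,
    compares the margin event with P, and the inner edges gain Z^3 against the loss Z^2. *)
Let case_sparse : n%:R * rho a b ^+ n <= Z -> a <= (Z ^+ 3)^-1 -> Wfail (192 * (n%:R * P)).
Proof.
move=> rn az.
have Z3 : 0 < (Z ^+ 3)^-1 by rewrite invr_gt0 exprn_gt0.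
apply: (@strong_estimator _ _ _ b0 ba a1 n o (valid_margin o 0)
  (fun k => rho a b ^+ (2 * k * (n - k)) * (2 * expR 1 * k%:R * (Z ^+ 3)^-1) ^+ k)) => //.
- by move=> t G; rewrite valid_margin_neg.
- move=> s bs; apply: le_trans (Ex_invalid o b0 ba a1 0 bs) _.
  have := margin_tail_le b0 ba a1 o 0 0 n_gt0.
  set Q := pr2 (n - o) _ _ _ _.
  have -> : pr2 1 0 a b (fun i j => i + 0 <= j)%N = 1 - a.
    by rewrite /pr2 /binE2 /= mulr0 add0r mulr1.
  have Q0 : 0 <= Q by apply: pr2_ge0.
  have a2 : 1 / 2 <= 1 - a.
    have : (Z ^+ 3)^-1 <= 1 / 2.
      rewrite -[leLHS]mul1r ler_pdivrMr ?exprn_gt0 //.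
      have : 1 <= Z ^+ 2 by rewrite exprn_ege1 //; have := Zbig; lra.
      by rewrite exprS; have := Zbig; nra.
    lra.
  move=> h; rewrite natrM.
  have : Q <= 2 * P by have := ler_wpM2l Q0 a2; rewrite -/P in h; lra.
  move=> hQ; have := ler_wpM2l (ler0n R n) hQ.
  have : 0 <= n%:R * P by rewrite mulr_ge0 // pr2_ge0.
  lra.
- move=> k; apply: mulr_ge0; first by rewrite exprn_ge0 ?rho_ge0.
  by apply: exprn_ge0; rewrite !mulr_ge0 ?expR_ge0 // ltW.
- by move=> s t k bs bt St k0 kn; apply: swap_affinity_sparse.
move=> k k0 kn; rewrite mulrA.
have q0 : 0 <= 2 * expR 1 * k%:R * (Z ^+ 3)^-1.
  by rewrite !mulr_ge0 ?expR_ge0 // ltW.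
apply: le_trans (ler_wpM2r _ (thZ rn k0 kn)) _; first by rewrite exprn_ge0.
rewrite -exprMn /x.
rewrite (_ : expR 4 * Z ^+ 2 / k%:R * _ = 2 * expR 4 * expR 1 / Z) //.
have kR : 0 < k%:R :> R by rewrite ltr0n.
by field; rewrite !gt_eqF.
Qed.

(** The margin M = 2 z^3 excludes all k <= z^3, which beats the loss Z^2. In r = z^10 further trials
    r b is at least Z^7 / 2, more than 10 M^2, so fluctuations exceed M, while r (a - b) <= 2 / Z.
    The condition a + b <= 1 gives b <= 1/2; 192 is 2 * 96, from 2n vertices and the tail bound
    1/96. *)
Let case_dense : n%:R * rho a b ^+ n <= Z -> Z^-1 < n%:R * rho a b ^+ n ->
  (Z ^+ 3)^-1 < a -> a + b <= 1 -> Wfail (192 * (n%:R * P)).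
Proof.
move=> rn rn' az ab1; have [r0 nr] := rho_near_1 L420 zn nz rn'.
pose M := (2 * z ^ 3)%N.
have Zn m : (z ^ m)%N%:R = Z ^+ m :> R by rewrite natrX.
pose w := Z^-1.
have w0 : 0 < w by rewrite invr_gt0.
have Zw : Z * w = 1 by rewrite /w divff // gt_eqF.
have w1 : 100 * w <= 1 by rewrite -[leRHS]Zw ler_wpM2r ?(ltW w0) //; exact: Zbig.
(* (a - b)^2 <= 4 (1 - rho) <= 4 (1 / rho - 1) <= 4 Z / n <= 4 Z^-23, where 52 L <= Z and n >=
   Z^24. *)
have abw : a - b <= 2 * w ^+ 11.
  rewrite -ler_sqr ?nnegrE ?subr_ge0 ?mulr_ge0 ?exprn_ge0 ?(ltW w0) //.
  apply: le_trans (sqr_sub_le_rho b0 ba a1) _.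
  have n0 : 0 < n%:R :> R by rewrite ltr0n.
  have h1 : 1 - rho a b <= (rho a b)^-1 - 1.
    have := mulfV (lt0r_neq0 r0); have : 0 < (rho a b)^-1 by rewrite invr_gt0.
    have := sqr_ge0 (1 - rho a b); nra.
  have : n%:R * (1 - rho a b) <= Z.
    apply: le_trans (ler_wpM2l (ltW n0) h1) _; apply: le_trans nr _.
    rewrite -/Z -/L; have := ZL; have := L420; lra.
  have : Z ^+ 24 * (1 - rho a b) <= n%:R * (1 - rho a b).
    by rewrite ler_wpM2r ?subr_ge0 ?rho_le1 // -Zn ler_nat.
  move=> h2 h3; have {}h2 := le_trans h2 h3.
  have : w ^+ 24 * (Z ^+ 24 * (1 - rho a b)) <= w ^+ 24 * Z.
    by rewrite ler_wpM2l // exprn_ge0 // ltW.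
  rewrite mulrA -exprMn [w * Z]mulrC Zw expr1n mul1r.
  have -> : w ^+ 24 * Z = w ^+ 22 * w * (Z * w) by ring.
  rewrite Zw mulr1 => h4.
  have : w ^+ 22 * w <= w ^+ 22 * 1 by rewrite ler_wpM2l ?exprn_ge0 ?(ltW w0) //; lra.
  by rewrite exprMn -exprM; lra.
have azw : w ^+ 3 < a by rewrite /w exprVn.
have w11 : w ^+ 11 <= w ^+ 3 * w.
  by rewrite -exprSr ler_wiXn2l ?(ltW w0) //; lra.
have w30 : 0 < w ^+ 3 by rewrite exprn_gt0.
have bw : w ^+ 3 / 2 <= b.
  have : w ^+ 3 * w <= w ^+ 3 * (1 / 8) by rewrite ler_wpM2l ?(ltW w30) //; lra.
  lra.
have w13 : w ^+ 11 <= 1 / 8 by apply: (@le_trans _ _ (w ^+ 1)); [rewrite ler_wiXn2l ?(ltW w0) //; lra|rewrite expr1; lra].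
pose r := (z ^ 10)%N.
have wr : r%:R * w ^+ 3 = Z ^+ 7.
  by rewrite /r Zn (exprD Z 7 3) -mulrA -exprMn Zw expr1n mulr1.
have Z71 : Z <= Z ^+ 7 by rewrite -{1}(expr1 Z) ler_weXn2l //; have := Zbig; lra.
have rb : Z ^+ 7 / 2 <= r%:R * b.
  by have := ler_wpM2l (ler0n R r) bw; rewrite mulrA wr.
have b2 : b <= 1 / 2 
  by rewrite ler_pdivlMr // mulr_natr mulr2n (le_trans _ ab1) // lerD2r.
have tail : 1 / 96 <= pr2 r.+1 r a b (fun i j => i + M <= j)%N.
  apply: pr2_tail_ge => //; try lra.
  - have := ler_wpM2l (ler0n R r) abw.
    have -> : r%:R * (2 * w ^+ 11) = 2 * w.
      rewrite /r Zn (_ : _ * _ = 2 * w * (Z * w) ^+ 10); last by ring.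
      by rewrite Zw expr1n mulr1.
    by rewrite [r%:R * (2 * (a - b))]mulrCA => h; have := w1; lra.
  - have := Zbig; lra.
  - apply: le_trans rb; rewrite /M natrM Zn exprMn -exprM.
    have -> : Z ^+ 7 = Z * Z ^+ 6 by rewrite -exprS.
    have : 0 <= Z ^+ 6 by rewrite exprn_ge0 // ltW.
    have -> : (3 * 2 = 6)%N by [].
    by move=> h6; have := ler_wpM2r h6 Zbig; rewrite expr2; lra.
apply: (@strong_estimator _ _ _ b0 ba a1 n o (valid_margin o M)
  (fun k => if (2 * k <= M)%N then 0 else rho a b ^+ (2 * k * (n - k)))) => //.
- by move=> t G; rewrite valid_margin_neg.
- move=> s bs; apply: le_trans (Ex_invalid o b0 ba a1 M bs) _.
  have := margin_tail_le b0 ba a1 o r M n_gt0.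
  set Q := pr2 (n - o) _ _ _ _; rewrite -/P => h.
  have Q0 : 0 <= Q by apply: pr2_ge0.
  have : Q <= 96 * P by have := ler_wpM2l Q0 tail; lra.
  move=> hQ; have := ler_wpM2l (ler0n R n) hQ.
  rewrite natrM; lra.
- by move=> k; case: ifP => _ //; rewrite exprn_ge0 ?rho_ge0.
- move=> s t k bs bt St k0 kn; case: ifPn => kM.
    rewrite big1 // => G _; rewrite (_ : _ && _ = false) ?mulr0 //.
    apply/negP => /andP[vs vt]; have := valid_margin_card _ vs vt.
    by rewrite St muln_gt0 k0 => /(_ isT); rewrite ltnNge kM.
  exact: (swap_affinity_le b0 ba a1).
move=> k k0 kn; case: ifPn => kM; first by rewrite mulr0 exprn_ge0.
apply: le_trans (thZ rn k0 kn) _.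
have kR : 0 < k%:R :> R by rewrite ltr0n.
have kZ : Z ^+ 3 <= k%:R.
  by rewrite -Zn ler_nat; move: kM; rewrite -ltnNge /M ltn_pmul2l // => /ltnW.
rewrite lerXn2r ?nnegrE // ?divr_ge0 ?mulr_ge0 ?expR_ge0 ?exprn_ge0 ?(ltW Z0) //.
rewrite /x ler_pdivrMr // mulrAC ler_pdivlMr //.
have -> : expR 4 * Z ^+ 2 * Z = expR 4 * Z ^+ 3 by ring.
apply: (@le_trans _ _ (expR 4 * k%:R)); first by rewrite ler_wpM2l ?expR_ge0.
rewrite ler_wpM2r //; have := expR_ge0 (4 : R); have := e2; nra.
Qed.

Lemma strong_upper : a + b <= 1 -> n%:R * P <= 1 ->
  exists f : graph n -> labelling n, forall s, balanced s ->
  Ex (W s) (fun G => (~~ ((f G == s) || (f G == neg_lab s)))%:R) <=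
    192 * (n%:R * P) + 4 * expR 4 * expR 1 / Z.
Proof.
move=> ab1 nP.
have -> : 4 * expR 4 * expR 1 / Z = 2 * x by rewrite /x; field; rewrite gt_eqF.
have [rn|rn] := leP (n%:R * rho a b ^+ n) Z^-1.
  have [f hf] := case_small_rho rn; exists f => s bs.
  apply: le_trans (hf s bs) _; rewrite lerD2r mulr_ge0 // mulr_ge0 //.
  exact: pr2_ge0.
have rZ := big_rho nP rn.
by have [az|az] := leP a (Z ^+ 3)^-1; [exact: case_sparse|exact: case_dense].
Qed.

End StrongUpperBound.

(** * Weak consistency *)

Section WeakConsistency.
Variable R : realType.

(** With d the size of the difference set, the right side is min (d, 2n - d), the Hamming distance
    up to a global sign. *)
Lemma DeltaE n (s t : labelling n) : (0 < n)%N ->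
  n%:R * Delta s t = n%:R - `| n%:R - #|diffset s t|%:R | :> R.
Proof.
move=> n0; have nR : 0 < n%:R :> R by rewrite ltr0n.
rewrite /Delta.
have -> : \sum_(i : V n) sgprod (s i) (t i) = 2 * (n%:R - #|diffset s t|%:R) :> R.
  rewrite (eq_bigr (fun i => 1 - 2 * (i \in diffset s t)%:R)); last first.
    move=> i _; rewrite /sgprod inE; case: eqP => _ /=; lra.
  rewrite sumrB sumr_const card_ord -mulr_sumr -natr_sum.
  have -> : (\sum_i (i \in diffset s t) = #|diffset s t|)%N.
    by rewrite -sum1_card [RHS]big_mkcond /=; apply: eq_bigr => i _; case: (_ \in _).
  by rewrite natrM; ring.
rewrite normrM ger0_norm // natrM mulrBr mulr1; congr (_ - _).
by field; rewrite gt_eqF.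
Qed.

Lemma Delta_le1 n (s t : labelling n) : Delta s t <= 1 :> R.
Proof. by rewrite /Delta lerBlDr lerDl divr_ge0. Qed.

(** Comparing relations between two vertices makes the error insensitive to the global sign of
    either labelling. *)
Definition disagree n (s t : labelling n) (u w : V n) := (t u == t w) != (s u == s w).

(** The disagreeing pairs have exactly one end in the difference set. There are 2 d (2n - d) of
    them, and the larger of d and 2n - d is at most 2n. *)
Lemma sum_disagree n (s t : labelling n) : (0 < n)%N ->
  \sum_u \sum_w (disagree s t u w)%:R <= 4 * n%:R ^+ 2 * Delta s t :> R.
Proof.
move=> n0; have nR : 0 < n%:R :> R by rewrite ltr0n.
set D := diffset s t.
have -> : 4 * n%:R ^+ 2 * Delta s t = 4 * n%:R * (n%:R * Delta s t) :> R by ring.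
rewrite DeltaE // -/D.
have cD : (#|~: D| = 2 * n - #|D|)%N by rewrite /D -diffset_neg diffset_neg_card.
have dn : (#|D| <= 2 * n)%N by exact: diffset_card_le.
have -> : \sum_u \sum_w (disagree s t u w)%:R = 2 * #|D|%:R * (2 * n%:R - #|D|%:R) :> R.
  have S (B : {set V n}) : \sum_w (w \in B)%:R = #|B|%:R :> R.
    by rewrite -natr_sum -sum1_card [in RHS]big_mkcond /=; congr (_%:R); apply: eq_bigr => i _; case: (_ \in _).
  rewrite (eq_bigr (fun u => (u \in D)%:R * #|~: D|%:R + (u \in ~: D)%:R * #|D|%:R)); last first.
    move=> u _; rewrite -!S !mulr_sumr -big_split /=; apply: eq_bigr => w _.
    rewrite !inE /disagree -!natrM -natrD; congr (_%:R).
    by case: (s u); case: (s w); case: (t u); case: (t w).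
  rewrite big_split /= -!mulr_suml !S cD natrB // natrM; ring.
have d2 : #|D|%:R <= 2 * n%:R :> R by rewrite -natrM ler_nat.
have [dn'|dn'] := leP (n%:R : R) #|D|%:R.
  rewrite ler0_norm ?subr_le0 //; have := mulr_ge0 (_ : 0 <= 2 * n%:R - #|D|%:R) (_ : 0 <= 2 * n%:R - #|D|%:R).
  nra.
rewrite ger0_norm ?subr_ge0 ?(ltW dn') //; nra.
Qed.

Definition swap_lab n (u v : V n) (s : labelling n) : labelling n :=
  [ffun x => s (tperm u v x)].

Lemma swap_labK n (u v : V n) : involutive (swap_lab u v).
Proof. by move=> s; apply/ffunP => x; rewrite !ffunE tpermK. Qed.

Lemma swap_lab_balanced n (u v : V n) s : balanced (swap_lab u v s) = balanced s.
Proof.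
rewrite /balanced; congr (_ == _).
rewrite -(card_imset _ (@perm_inj _ (tperm u v))); apply: eq_card => x.
rewrite !inE; apply/imsetP/idP => [[y]|sx].
  by rewrite inE ffunE => sy ->.
by exists (tperm u v x); rewrite ?tpermK // inE ffunE tpermK.
Qed.

Lemma swap_lab_diffset n (u v : V n) (s : labelling n) : s u != s v ->
  #|diffset s (swap_lab u v s)| = 2%N.
Proof.
move=> uv; have uv' : u != v by apply: contraNneq uv => ->.
rewrite -[RHS](_ : #|[set u; v]| = 2%N); last by rewrite cards2 uv'.
apply: eq_card => x; rewrite !inE ffunE.
case: tpermP => [->|->|/eqP/negPf -> /eqP/negPf ->]; rewrite ?eqxx ?orbT //.
by rewrite eq_sym uv.
Qed.

Section Swap.
Variables (n : nat) (o : bool) (a b : R).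
Hypotheses (b0 : 0 <= b) (ba : b <= a) (a1 : a <= 1).
Let W := wt o a b (n := n).

Let rho01 : 0 <= rho a b <= 1.
Proof. by rewrite rho_ge0 rho_le1 // ?b0 ?(le_trans b0) //= (le_trans ba). Qed.

(* No test can tell a labelling from the one with [u] and [v] exchanged, and
   the two give opposite answers on the pair [(u, w)]. *)
Lemma swap_error (f : graph n -> labelling n) (u v w : V n) (s : labelling n) :
  w != u -> w != v -> s u != s v ->
  rho a b ^+ (4 * n) / 2 <=
  Ex (W s) (fun G => (disagree s (f G) u w)%:R) +
  Ex (W (swap_lab u v s)) (fun G => (disagree (swap_lab u v s) (f G) u w)%:R).
Proof.
move=> wu wv uv; set s' := swap_lab u v s.
have w01 t e := wt01 o b0 ba a1 t e (n := n).
have opp G : disagree s' (f G) u w = ~~ disagree s (f G) u w.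
  rewrite /disagree /s' !ffunE tpermL tpermD // 1?eq_sym //.
  by move: uv; case: (s u); case: (s v); case: (s w); case: (f G u); case: (f G w).
have := @affinity_min R _ (W s) (W s') (fun G => disagree s (f G) u w) (w01 s) (w01 s').
rewrite (sum_rbern o b0 ba a1) card_boundary -diffset_neg diffset_neg_card swap_lab_diffset //.
have -> : \sum_G (if disagree s (f G) u w then bern (W s) G else bern (W s') G) =
    Ex (W s) (fun G => (disagree s (f G) u w)%:R) +
    Ex (W s') (fun G => (disagree s' (f G) u w)%:R).
  rewrite /Ex -big_split /=; apply: eq_bigr => G _; rewrite opp.
  by case: (disagree s _ _ _); rewrite ?mulr1 ?mulr0 ?addr0 ?add0r.
move=> h; rewrite ler_pdivrMr // mulrC; apply: le_trans h.
rewrite -exprM [(2 * _ * 2)%N]mulnC (exprM (affinity a b)) -/(rho a b).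
by have /andP[r0 r1] := rho01; apply: ler_wiXn2l => //; lia.
Qed.

(** Swapping u and v is an involution of the index set, so summing [swap_error] counts every error
    twice. *)
Lemma swap_error_sum (f : graph n -> labelling n) (u v w : V n) :
  w != u -> w != v ->
  \sum_(s | balanced s && (s u != s v)) rho a b ^+ (4 * n) / 4 <=
  \sum_(s | balanced s && (s u != s v)) Ex (W s) (fun G => (disagree s (f G) u w)%:R).
Proof.
move=> wu wv; set S := \sum_(s | _) Ex _ _.
have SE : S = \sum_(s | balanced s && (s u != s v))
   Ex (W (swap_lab u v s)) (fun G => (disagree (swap_lab u v s) (f G) u w)%:R).
  rewrite /S (reindex_inj (inv_inj (@swap_labK n u v))) /=; apply: eq_bigl => s.
  by rewrite swap_lab_balanced !ffunE tpermL tpermR eq_sym.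
have SS : S + S = \sum_(s | balanced s && (s u != s v))
   (Ex (W s) (fun G => (disagree s (f G) u w)%:R) +
    Ex (W (swap_lab u v s)) (fun G => (disagree (swap_lab u v s) (f G) u w)%:R)).
  by rewrite big_split /= -SE.
have : \sum_(s | balanced s && (s u != s v)) rho a b ^+ (4 * n) / 2 <= S + S.
  rewrite SS; apply: ler_sum => s /andP[_ uv]; exact: swap_error.
have -> : \sum_(s | balanced s && (s u != s v)) rho a b ^+ (4 * n) / 2 =
  2 * \sum_(s : labelling n | balanced s && (s u != s v)) rho a b ^+ (4 * n) / 4.
  by rewrite mulr_sumr; apply: eq_bigr => s _; field.
lra.
Qed.

(** Sum [swap_error_sum] over triples (u, v, w). For each balanced s, 2 n^2 ordered pairs (u, v)
    have opposite labels and leave at least n choices of w, as 1 < n. Conversely each (u, w) occurs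
    with at most n vertices v, and the disagreements of the pairs (u, w) are bounded by Delta. *)
Lemma weak_lower (f : graph n -> labelling n) (eps : R) : (1 < n)%N -> 0 <= eps ->
  rho a b ^+ (4 * n) <=
  8 * (eps + (balanced_count R n)^-1 * \sum_(s : labelling n | balanced s)
     Ex (W s) (fun G => (eps < Delta s (f G))%R%:R)).
Proof.
move=> n1 eps0; have n0 : (0 < n)%N by lia.
have nR : 0 < n%:R :> R by rewrite ltr0n.
have n2R : 2 <= n%:R :> R by rewrite (ler_nat _ 2).
set N := balanced_count R n; have N0 : 0 < N by exact: balanced_count_gt0.
have Ncard c : \sum_(s : labelling n | balanced s) c = N * c.
  rewrite sumr_const -mulr_natl; congr (_%:R * _).
  by apply: eq_card => t; rewrite !inE.
set E := \sum_(s | _) _; set r := rho a b ^+ (4 * n).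
have r0 : 0 <= r by rewrite exprn_ge0 // rho_ge0.
pose T := \sum_u \sum_v \sum_(w : V n | (w != u) && (w != v))
  \sum_(s | balanced s && (s u != s v)) Ex (W s) (fun G => (disagree s (f G) u w)%:R).
have w01 t e := wt01 o b0 ba a1 t e (n := n).
have low : 2 * n%:R ^+ 3 * N * (r / 4) <= T.
  apply: (@le_trans _ _ (\sum_u \sum_v \sum_(w : V n | (w != u) && (w != v))
      \sum_(s : labelling n | balanced s && (s u != s v)) r / 4)); last first.
    apply: ler_sum => u _; apply: ler_sum => v _; apply: ler_sum => w /andP[wu wv].
    exact: swap_error_sum.
  apply: (@le_trans _ _ (\sum_(u : V n) \sum_(v : V n) n%:R *
      \sum_(s : labelling n | balanced s && (s u != s v)) r / 4)); last first.
    apply: ler_sum => u _; apply: ler_sum => v _.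
    set c := (X in n%:R * X).
    have c0 : 0 <= c by apply: sumr_ge0 => s _; rewrite divr_ge0.
    rewrite sumr_const -[leRHS]mulr_natl; apply: ler_wpM2r => //.
    rewrite ler_nat.
    have := cardC [pred w : V n | (w != u) && (w != v)]; rewrite card_ord.
    have : (#|[predC [pred w : V n | (w != u) && (w != v)]]| <= 2)%N.
      apply: (@leq_trans #|[set u; v]|); last by rewrite cards2; case: (_ != _).
      by apply: subset_leq_card; apply/fintype.subsetP => w; rewrite !inE negb_and !negbK.
    have -> : #|[pred w : V n | (w != u) && (w != v)]| = #|(fun w : V n => (w != u) && (w != v))| by [].
    by move: #|_| #|_| => x y; lia.
  rewrite (eq_bigr (fun u => n%:R * \sum_v \sum_(s : labelling n | balanced s && (s u != s v)) r / 4)); last first.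
    by move=> u _; rewrite mulr_sumr.
  rewrite -mulr_sumr.
  have -> : \sum_(u : V n) \sum_(v : V n) \sum_(s : labelling n | balanced s && (s u != s v)) r / 4
     = \sum_(s : labelling n | balanced s) \sum_(u : V n) \sum_(v : V n | s u != s v) r / 4.
    under eq_bigr => u _ do under eq_bigr => v _ do rewrite big_mkcondr.
    under eq_bigr => u _ do rewrite exchange_big /=.
    rewrite exchange_big /=; apply: eq_bigr => s _; apply: eq_bigr => u _.
    by rewrite [RHS]big_mkcond.
  rewrite (eq_bigr (fun=> (2 * n)%:R * (n%:R * (r / 4)))) => [|s bs].
    by rewrite Ncard natrM; have -> : n%:R * (N * (2 * n%:R * (n%:R * (r / 4)))) = 2 * n%:R ^+ 3 * N * (r / 4) by ring.
  rewrite (eq_bigr (fun=> n%:R * (r / 4))) => [|u _].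
    by rewrite sumr_const card_ord [RHS]mulr_natl.
  rewrite sumr_const -[LHS]mulr_natl; congr (_%:R * _).
  rewrite -[RHS](card_class (~~ s u) bs); apply: eq_card => v; rewrite !inE.
  by rewrite unfold_in; case: (s u); case: (s v).
have up : T <= 4 * n%:R ^+ 3 * (N * eps + E).
  have -> : T = \sum_(s : labelling n | balanced s)
     \sum_u \sum_(v : V n | s u != s v) \sum_(w : V n | (w != u) && (w != v))
        Ex (W s) (fun G => (disagree s (f G) u w)%:R).
    rewrite /T.
    under eq_bigr => u _ do under eq_bigr => v _ do rewrite exchange_big /= big_mkcondr.
    under eq_bigr => u _ do rewrite exchange_big /=.
    rewrite exchange_big /=; apply: eq_bigr => s _; apply: eq_bigr => u _.
    by rewrite [RHS]big_mkcond.
  rewrite mulrDr mulrCA -Ncard /E mulr_sumr -big_split /=; apply: ler_sum => s bs.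
  apply: (@le_trans _ _ (\sum_(u : V n) n%:R * \sum_w Ex (W s) (fun G => (disagree s (f G) u w)%:R))).
    apply: ler_sum => u _.
    apply: (@le_trans _ _ (\sum_(v : V n | s u != s v) \sum_w Ex (W s) (fun G => (disagree s (f G) u w)%:R))).
      apply: ler_sum => v _; rewrite [leRHS](bigID (fun w => (w != u) && (w != v))) /= lerDl.
      by apply: sumr_ge0 => w _; apply: Ex_ge0 => // e; exact: w01.
    rewrite sumr_const -[leLHS]mulr_natl.
    have -> // : #|(fun v : V n => s u != s v)| = n.
    rewrite -[RHS](card_class (~~ s u) bs); apply: eq_card => v; rewrite !inE.
    by rewrite unfold_in; case: (s u); case: (s v).
  rewrite -mulr_sumr.
  have -> : \sum_u \sum_w Ex (W s) (fun G => (disagree s (f G) u w)%:R) =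
     Ex (W s) (fun G => \sum_u \sum_w (disagree s (f G) u w)%:R).
    by rewrite Ex_sum; apply: eq_bigr => u _; rewrite Ex_sum.
  have -> : 4 * n%:R ^+ 3 * eps + 4 * n%:R ^+ 3 * Ex (W s) (fun G => (eps < Delta s (f G))%R%:R) =
    n%:R * (4 * n%:R ^+ 2 * (eps + Ex (W s) (fun G => (eps < Delta s (f G))%R%:R))) by ring.
  rewrite ler_wpM2l // -[X in _ * (X + _)](Ex_cst (W s)) -ExD -ExZ.
  apply: le_Ex => [e|G]; first exact: w01.
  apply: le_trans (sum_disagree _ _ n0) _; rewrite ler_wpM2l ?mulr_ge0 ?exprn_ge0 //.
  case: ltP => [_|h]; last by rewrite addr0.
  by apply: le_trans (Delta_le1 _ _) _; rewrite lerDr.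
have n3 : 0 < n%:R ^+ 3 :> R by rewrite exprn_gt0.
have := le_trans low up.
have -> : 2 * n%:R ^+ 3 * N * (r / 4) = (4 * n%:R ^+ 3) * (N * (r / 8)) by field.
rewrite ler_pM2l ?mulr_gt0 // => h.
have : r / 8 <= eps + N^-1 * E.
  have -> : eps + N^-1 * E = N^-1 * (N * eps + E) by field; rewrite gt_eqF.
  by rewrite -[leLHS](mulKf (lt0r_neq0 N0)) ler_wpM2l // invr_ge0 ltW.
lra.
Qed.

End Swap.
End WeakConsistency.

Section WeakUpper.
Variables (R : realType) (a b : R).
Hypotheses (b0 : 0 <= b) (ba : b <= a) (a1 : a <= 1).

Let a0 : 0 <= a. Proof. exact: le_trans ba. Qed.
Let a01 : 0 <= a <= 1. Proof. by rewrite a0. Qed.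
Let b01 : 0 <= b <= 1. Proof. by rewrite b0 (le_trans ba). Qed.

(** The affinity exponent |S| (2n - |S|) is at least n |S|, and |S| > eps n with K eps >= 1 makes
    every competitor cost at most 8^-n; 64 is 8^2, as rho is the squared affinity. There are at most
    4^n labellings. *)
Lemma weak_upper n o (f : graph n -> labelling n) (eps : R) K :
  (forall G t, balanced t -> true ->
    [/\ balanced (f G), true & bern (wt o a b t) G <= bern (wt o a b (f G)) G]) ->
  (0 < n)%N -> 1 <= K%:R * eps -> rho a b ^+ n <= (64^-1) ^+ K ->
  forall s, balanced s ->
  Ex (wt o a b s) (fun G => (eps < Delta s (f G))%R%:R) <= (1 / 2) ^+ n.
Proof.
move=> hf n0 Keps rn s bs.
have nR : 0 < n%:R :> R by rewrite ltr0n.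
pose bad : rel (labelling n) := fun s t => eps < Delta s t.
pose near : rel (labelling n) := fun s t =>
  (eps * n%:R < #|diffset s t|%:R) && (#|diffset s t| <= n)%N.
have hbad t : balanced t -> bad s t -> near s t || near s (neg_lab t).
  move=> bt; rewrite /bad /near diffset_neg_card.
  rewrite -(ltr_pM2l nR) DeltaE // mulrC.
  have d2 := diffset_card_le s t.
  case: (leqP #|diffset s t| n) => dn.
    by rewrite ger0_norm ?subr_ge0 ?ler_nat // subKr => ->.
  rewrite ler0_norm ?subr_le0 ?ler_nat ?(ltnW dn) // natrB // natrM => h.
  have -> : (2 * n - #|diffset s t| <= n)%N by move: dn; clear; lia.
  by rewrite andbT andbF /=; lra.
have := @union_bound R n o a b b0 ba a1 (fun _ _ => true) f bad near s
  (fun G t => hf G t) (fun _ _ => erefl) bs hbad.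
move=> /le_trans; apply.
rewrite [X in X + _](_ : _ = 0) ?add0r; last by rewrite -[RHS](Ex_cst (wt o a b s)).
have aff0 := affinity_ge0 a b.
have aff1 : affinity a b <= 1.
  by rewrite -(@expr_le1 _ 2) //; exact: rho_le1.
have affn : affinity a b ^+ n <= (8^-1) ^+ K.
  rewrite -ler_sqr ?nnegrE ?exprn_ge0 // -!exprM mulnC [(K * 2)%N]mulnC.
  rewrite (exprM (affinity a b)) (exprM 8^-1).
  by rewrite (_ : 8^-1 ^+ 2 = 64^-1 :> R) //; field.
have term t : near s t ->
    \sum_G rbern (wt o a b s) G * rbern (wt o a b t) G * (true && true)%:R <= (8^-1) ^+ n.
  move=> /andP[epsd dn]; under eq_bigr do rewrite mulr1.
  rewrite (sum_rbern o b0 ba a1) card_boundary -diffset_neg diffset_neg_card.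
  set d := #|_| in epsd dn *.
  apply: (@le_trans _ _ (affinity a b ^+ (n * d))).
    by rewrite ler_wiXn2l // mulnC leq_mul2l; apply/orP; right; move: dn; clear; lia.
  rewrite exprM; apply: (@le_trans _ _ (((8^-1) ^+ K) ^+ d)).
    by rewrite lerXn2r ?nnegrE ?exprn_ge0.
  have h8 : 0 <= 8^-1 :> R by rewrite invr_ge0.
  have h8' : 8^-1 <= 1 :> R by rewrite invf_le1 // ler1n.
  rewrite -exprM ler_wiXn2l //.
  rewrite -(ler_nat R) natrM.
  have := ler_wpM2l (ler0n R K) (ltW epsd); have := ler_wpM2r (ltW nR) Keps; lra.
apply: (@le_trans _ _ (\sum_(t : labelling n | balanced t && near s t) (8^-1) ^+ n)).
  by apply: ler_sum => t /andP[_ nt]; exact: term.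
rewrite sumr_const -[leLHS]mulr_natl.
apply: (@le_trans _ _ ((4 ^ n)%N%:R * 8^-1 ^+ n)).
  rewrite ler_wpM2r ?exprn_ge0 // ler_nat.
  apply: leq_trans (max_card _) _.
  by rewrite card_ffun card_bool card_ord expnM.
rewrite natrX -exprMn (_ : 4 * 8^-1 = 1 / 2 :> R) //; by field.
Qed.

(** If rho^n >= d, Bernoulli's inequality gives n (1 / rho - 1) <= 1/d, so [pr2_leq_ge] applies with
    c = 8/d + 1 and bounds P from below. *)
Lemma rho_pow_lt n (d : R) : (0 < n)%N -> 0 < d -> d <= 1 ->
  pr2 n n a b leq < d * expR (- (8 / d + 1)) / 2 -> rho a b ^+ n < d.
Proof.
move=> n0 d0 d1 hP; rewrite ltNge; apply/negP => hr.
have r0 : 0 < rho a b.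
  rewrite lt_neqAle rho_ge0 andbT; apply/eqP => e.
  by move: hr; rewrite -e expr0n gtn_eqF // leNgt d0.
have r1 : rho a b <= 1 by exact: rho_le1.
set x : R := (rho a b)^-1 - 1.
have x0 : 0 <= x by rewrite subr_ge0 invf_ge1.
have bern m : 1 + m%:R * x <= (1 + x) ^+ m.
  elim: m => [|m IH]; first by rewrite mul0r addr0.
  rewrite exprS; apply: (@le_trans _ _ ((1 + x) * (1 + m%:R * x))).
    have : 0 <= m%:R * x ^+ 2 by rewrite mulr_ge0 // exprn_ge0.
    by rewrite -natr1 expr2; lra.
  by rewrite ler_wpM2l // addr_ge0.
have nx : n%:R * x <= d^-1.
  have : (1 + x) ^+ n <= d^-1.
    by rewrite /x subrKC exprVn lef_pV2 ?posrE // exprn_gt0.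
  have := bern n; lra.
have di : 1 <= d^-1 by rewrite invf_ge1.
have c0 : 0 < 8 / d + 1 by lra.
have hc : 8 * n%:R * x <= (8 / d + 1) ^+ 2.
  by rewrite -mulrA; have : 0 <= (8 / d) ^+ 2 by [rewrite sqr_ge0]; rewrite !expr2; lra.
have := pr2_leq_ge b0 ba a1 r0 c0 hc.
have : d * expR (- (8 / d + 1)) <= rho a b ^+ n * expR (- (8 / d + 1)).
  by rewrite ler_wpM2r ?expR_ge0.
lra.
Qed.

End WeakUpper.

Section Ambiguity.
Variables (R : realType) (T : finType).

(** As H and C have equal size, exchanging their weights multiplies the likelihood by a power of the
    odds ratio of a to b, with exponent |G :&: C| - |G :&: H|. *)
Lemma bern_exchange (w w' : T -> R) (H C G : {set T}) (a b : R) :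
  0 <= b -> b <= a -> a <= 1 -> (forall e, 0 <= w e <= 1) ->
  [disjoint H & C] -> #|H| = #|C| ->
  {in H, forall e, w e = a /\ w' e = b} -> {in C, forall e, w e = b /\ w' e = a} ->
  (forall e, e \notin H :|: C -> w e = w' e) ->
  (#|G :&: H| <= #|G :&: C|)%N -> bern w G <= bern w' G.
Proof.
move=> b0 ba a1 w01 dHC cHC wH wC wE GHC.
have split (v : T -> R) x y : {in H, forall e, v e = x} -> {in C, forall e, v e = y} ->
   bern v G = x ^+ #|G :&: H| * (1 - x) ^+ #|H :\: G| *
     (y ^+ #|G :&: C| * (1 - y) ^+ #|C :\: G|) *
     \prod_(e | e \notin H :|: C) (if e \in G then v e else 1 - v e).
  move=> vH vC; rewrite /bern (bigID (fun e => e \in H :|: C)) /=; congr (_ * _).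
  have part (B : {set T}) c : {in B, forall e, v e = c} ->
     \prod_(e in B) (if e \in G then v e else 1 - v e) = c ^+ #|G :&: B| * (1 - c) ^+ #|B :\: G|.
    move=> vB; rewrite (bigID (fun e => e \in G)) /=; congr (_ * _).
      rewrite -prodr_const; apply: eq_big => [e|e /andP[eB ->]]; last exact: vB.
      by rewrite !inE andbC.
    rewrite -prodr_const; apply: eq_big => [e|e /andP[eB /negPf ->]]; last by rewrite vB.
    by rewrite !inE andbC.
  rewrite (eq_bigl (fun e => e \in [predU H & C])) => [|e]; last by rewrite !inE.
  rewrite bigU //= (part H x) // (part C y) //.
have a0 : 0 <= a := le_trans b0 ba.
have b1 : b <= 1 := le_trans ba a1.
rewrite (split w a b) => [|e /wH[]//|e /wC[]//].
rewrite (split w' b a) => [|e /wH[]//|e /wC[]//].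
have -> : \prod_(e | e \notin H :|: C) (if e \in G then w' e else 1 - w' e) =
   \prod_(e | e \notin H :|: C) (if e \in G then w e else 1 - w e).
  by apply: eq_bigr => e /wE ->.
apply: ler_wpM2r.
  by apply: prodr_ge0 => e _; have /andP[? ?] := w01 e; case: ifP; rewrite ?subr_ge0.
have e1 := cardsID G H; have e2 := cardsID G C.
rewrite finset.setIC in e1; rewrite finset.setIC in e2.
move: GHC e1 e2; rewrite -cHC.
move: #|G :&: H| #|G :&: C| #|H :\: G| #|C :\: G| #|H| => h c h' c' m hc e1 e2.
have -> : c = (h + (c - h))%N by rewrite subnKC.
have -> : h' = (c' + (c - h))%N by move: hc e1 e2; clear; lia.
move: (c - h)%N => d; rewrite !exprD.
have -> : a ^+ h * ((1 - a) ^+ c' * (1 - a) ^+ d) * (b ^+ h * b ^+ d * (1 - b) ^+ c') =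
  a ^+ h * (1 - a) ^+ c' * b ^+ h * (1 - b) ^+ c' * ((1 - a) ^+ d * b ^+ d) by ring.
have -> : b ^+ h * ((1 - b) ^+ c' * (1 - b) ^+ d) * (a ^+ h * a ^+ d * (1 - a) ^+ c') =
  a ^+ h * (1 - a) ^+ c' * b ^+ h * (1 - b) ^+ c' * ((1 - b) ^+ d * a ^+ d) by ring.
have a1' : 0 <= 1 - a by rewrite subr_ge0.
have b1' : 0 <= 1 - b by rewrite subr_ge0.
apply: ler_wpM2l; first by rewrite !mulr_ge0 ?exprn_ge0.
by rewrite ler_pM ?exprn_ge0 // lerXn2r ?nnegrE // lerB.
Qed.

End Ambiguity.

(** * Necessity for strong consistency *)

Section SwapEvents.
Variables (R : realType) (n : nat) (o : bool) (a b : R).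
Hypotheses (b0 : 0 <= b) (ba : b <= a) (a1 : a <= 1).
Let W := wt o a b (n := n).
Implicit Types (s t : labelling n) (G : graph n) (u v x y : V n).

Let a0 : 0 <= a. Proof. exact: le_trans ba. Qed.
Let a01 : 0 <= a <= 1. Proof. by rewrite a0. Qed.
Let b01 : 0 <= b <= 1. Proof. by rewrite b0 (le_trans ba). Qed.

(** The other vertex v is left out because the pair {u, v} has opposite labels before and after the
    swap. This also makes the conditions at u and at v depend on disjoint sets of pairs. *)
Definition swap_ok s u v G :=
  (deg G u (hotv o s u :\ v) <= deg G u (coldv o s u :\ v))%N.

(** Removing v from the opposite class matches the absence of u from its own, so both sides have n -
    1 vertices and P(n - 1) appears. *)
Lemma card_swap_ok s u v : balanced s -> s u != s v ->
  #|hotv o s u :\ v| = n.-1 /\ #|coldv o s u :\ v| = n.-1.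
Proof.
move=> bs uv.
have vu : v != u by apply: contraNneq uv => ->.
have [h c] := card_hotv_cold o u bs.
have h' := cardsD1 v (hotv o s u); have c' := cardsD1 v (coldv o s u).
rewrite h in h'; rewrite c in c'; move: h' c'; rewrite !inE vu (negPf uv).
move: #|hotv o s u :\ v| #|coldv o s u :\ v| => p q.
by case: o => /=; clear; lia.
Qed.

(** The swap exchanges a and b on the pairs joining u or v to a third vertex and changes no other
    weight; adding the two degree conditions gives the hypothesis of [bern_exchange]. *)
Lemma swap_likelihood s u v G : balanced s -> s u != s v ->
  swap_ok s u v G -> swap_ok s v u G -> bern (W s) G <= bern (W (swap_lab u v s)) G.
Proof.
move=> bs uv Euv Evu; have vu : s v != s u by rewrite eq_sym.
have nuv : u != v by apply: contraNneq uv => ->.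
have nvu : v != u by rewrite eq_sym.
set t := swap_lab u v s.
have [hu cu] := card_swap_ok bs uv; have [hv cv] := card_swap_ok bs vu.
have nh x y : x \notin hotv o s x :\ y by rewrite !inE eqxx andbF.
have nc x y : x \notin coldv o s x :\ y by rewrite !inE eqxx andbF.
have dd (A B C D : {set V n}) : A = B :\ v -> [disjoint star u A & star v C].
  by move=> ->; apply: star_disjoint2 => //; rewrite !inE eqxx.
have cardU (A B : {set V n}) G' : [disjoint star u A & star v B] ->
    #|G' :&: (star u A :|: star v B)| = (deg G' u A + deg G' v B)%N.
  move=> d; rewrite finset.setIUr cardsU /deg.
  have -> : (G' :&: star u A) :&: (G' :&: star v B) = finset.set0.
    apply/eqP; rewrite setI_eq0; apply: disjointWl (subsetIr _ _) _.
    exact: disjointWr (subsetIr _ _) d.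
  by rewrite cards0 subn0.
have hc x y : [disjoint star x (hotv o s x :\ y) & star x (coldv o s x :\ y)].
  apply: star_disjoint (nh _ _); apply: disjointWl (subD1set _ _) _.
  apply: disjointWr (subD1set _ _) _; exact: hot_cold_disjoint.
have dHH : [disjoint star u (hotv o s u :\ v) & star v (hotv o s v :\ u)] by exact: dd.
have dCC : [disjoint star u (coldv o s u :\ v) & star v (coldv o s v :\ u)] by exact: dd.
have dHC : [disjoint star u (hotv o s u :\ v) & star v (coldv o s v :\ u)] by exact: dd.
have dCH : [disjoint star u (coldv o s u :\ v) & star v (hotv o s v :\ u)] by exact: dd.
have tE x y : y != u -> y != v -> (x == u) || (x == v) -> (t x == t y) = ~~ (s x == s y).
  rewrite ![y == _]eq_sym => yu yv; rewrite /t !ffunE [tperm u v y]tpermD //.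
  case/orP => /eqP ->; rewrite ?tpermL ?tpermR;
    by move: uv; case: (s u); case: (s v); case: (s y).
apply: (@bern_exchange _ _ _ _ (star u (hotv o s u :\ v) :|: star v (hotv o s v :\ u))
  (star u (coldv o s u :\ v) :|: star v (coldv o s v :\ u)) _ a b b0 ba a1).
- by move=> e; exact: wt01.
- rewrite -setI_eq0 finset.setIUl !finset.setIUr; apply/eqP.
  have z (A B : graph n) : [disjoint A & B] -> A :&: B = finset.set0.
    by rewrite -setI_eq0 => /eqP.
  rewrite (z _ _ (hc u v)) (z _ _ (hc v u)) (z _ _ dHC).
  by rewrite [_ :&: star u _]finset.setIC (z _ _ dCH) !finset.setU0.
- rewrite !cardsU; move: dHH dCC; rewrite -!setI_eq0 => /eqP -> /eqP ->.
  by rewrite cards0 !subn0 !card_star // hu hv cu cv.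
- move=> e; rewrite inE => /orP[] /imsetP[y]; rewrite !inE => /and3P[yn yx h] ->.
  + split; first by apply: wt_hot; rewrite !inE yx.
    rewrite /W /wt ed_pairs; last by rewrite eq_sym.
    rewrite (ed_sym t) tE ?eqxx //.
    by move: h; case: (s u == s y); case: o.
  + split; first by apply: wt_hot; rewrite !inE yx.
    rewrite /W /wt ed_pairs; last by rewrite eq_sym.
    rewrite (ed_sym t) tE ?eqxx ?orbT //.
    by move: h; case: (s v == s y); case: o.
- move=> e; rewrite inE => /orP[] /imsetP[y]; rewrite !inE => /and3P[yn yx h] ->.
  + split; first by apply: wt_cold; rewrite !inE yx.
    rewrite /W /wt ed_pairs; last by rewrite eq_sym.
    rewrite (ed_sym t) tE ?eqxx //.
    by move: h; case: (s u == s y); case: o.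
  + split; first by apply: wt_cold; rewrite !inE yx.
    rewrite /W /wt ed_pairs; last by rewrite eq_sym.
    rewrite (ed_sym t) tE ?eqxx ?orbT //.
    by move: h; case: (s v == s y); case: o.
- move=> e eHC; rewrite /W; symmetry; apply: (@wt_off_boundary R n o a b s t e); apply: contra eHC.
  have D x : (x \in diffset s t) = (x == u) || (x == v).
    rewrite !inE /t ffunE; case: tpermP => [->|->|/eqP/negPf -> /eqP/negPf ->];
      by rewrite ?eqxx ?orbT // eq_sym.
  rewrite inE => /andP[eP]; rewrite !D (pairs_edP eP).
  have key x y : (x == u) || (x == v) -> ~~ ((y == u) || (y == v)) ->
     ed x y \in (star u (hotv o s u :\ v) :|: star v (hotv o s v :\ u))
       :|: (star u (coldv o s u :\ v) :|: star v (coldv o s v :\ u)).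
    rewrite negb_or => /orP[] /eqP -> /andP[yu yv]; rewrite 3!finset.in_setU.
      have [h|h] := boolP ((s u == s y) == o).
        by rewrite (imset_f (ed u)) // !inE yu yv h.
      by rewrite [_ \in star u (coldv _ _ _ :\ _)](imset_f (ed u)) ?orbT // !inE yu yv h.
    have [h|h] := boolP ((s v == s y) == o).
      by rewrite [_ \in star v (hotv _ _ _ :\ _)](imset_f (ed v)) ?orbT // !inE yu yv h.
    by rewrite [_ \in star v (coldv _ _ _ :\ _)](imset_f (ed v)) ?orbT // !inE yu yv h.
  rewrite -(pairs_edP eP).
  case e1 : ((e.1 == u) || (e.1 == v)); case e2 : ((e.2 == u) || (e.2 == v)) => // _.
    by rewrite (pairs_edP eP) key // e2.
  by rewrite (pairs_edP eP) edC key // e1.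
by rewrite !cardU // leq_add.
Qed.

Definition ambiguous s G := [exists t, [&& balanced t, t != s, t != neg_lab s &
  (bern (W s) G <= bern (W t) G)%R]].

(** Fix G and let A be the answer. Ambiguous labellings other than A and its negative are errors
    already. If A or its negative is ambiguous, a competitor at least as likely is an error too, so
    the likelihood of A is at most the error mass. It counts twice, for the two signs, which makes 1
    + 2 = 3. *)
Lemma ambiguous_mass (f : graph n -> labelling n) : (0 < n)%N ->
  \sum_(s | balanced s) Ex (W s) (fun G => (ambiguous s G)%:R) <=
  3 * \sum_(s | balanced s)
    Ex (W s) (fun G => (~~ ((f G == s) || (f G == neg_lab s)))%:R).
Proof.
move=> n0; rewrite /Ex exchange_big [X in 3 * X]exchange_big /= mulr_sumr.
apply: ler_sum => G _; set A := f G.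
have B0 s : 0 <= bern (W s) G by apply: bern_ge0 => e; exact: wt01.
set X := \sum_(s | balanced s) bern (W s) G * (~~ ((A == s) || (A == neg_lab s)))%:R.
have fix2 s : (A == s) || (A == neg_lab s) = (s \in [set A; neg_lab A]).
  by rewrite !inE eq_sym; congr (_ || _); rewrite -(inv_eq (@neg_labK n)) eq_sym.
have X0 : 0 <= X by apply: sumr_ge0 => s _; rewrite mulr_ge0.
rewrite [leLHS](bigID (fun s => s \in [set A; neg_lab A])) /=.
have -> : 3 * X = 2 * X + X by ring.
apply: lerD; last first.
  rewrite /X [leRHS](bigID (fun s => s \in [set A; neg_lab A])) /= -[leLHS]add0r lerD //.
    by apply: sumr_ge0 => s _; rewrite mulr_ge0.
  apply: ler_sum => s /andP[_ h]; by rewrite fix2 h mulr1 ler_piMr // lern1 leq_b1.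
have [[s /andP[bs /andP[sA amb]]]|none] :=
    pickP (fun s => balanced s && ((s \in [set A; neg_lab A]) && ambiguous s G)); last first.
  rewrite big1 ?mulr_ge0 // => s /andP[bs sA]; have := none s; rewrite bs sA /= => ->.
  by rewrite mulr0.
have WA s' : s' \in [set A; neg_lab A] -> bern (W s') G = bern (W A) G.
  by rewrite !inE => /orP[] /eqP -> //; rewrite /W wt_neg.
have AX : bern (W A) G <= X.
  have /existsP[t /and4P[bt ts tns le]] := amb.
  rewrite -(WA _ sA); apply: le_trans le _; rewrite /X (bigD1 t) //= fix2.
  have -> : t \notin [set A; neg_lab A].
    move: sA; rewrite !inE => /orP[] /eqP e; move: ts tns; rewrite e ?neg_labK.
      by move=> /negPf -> /negPf ->.
    by move=> /negPf -> /negPf ->.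
  by rewrite mulr1 lerDl sumr_ge0 // => i _; rewrite mulr_ge0.
apply: (@le_trans _ _ (\sum_(i in [set A; neg_lab A]) bern (W A) G)).
  rewrite [leRHS]big_mkcond [leLHS]big_mkcond; apply: ler_sum => i _.
  case: (boolP (i \in _)) => iA; rewrite ?andbF //= andbT.
  by case: ifP => // _; rewrite -(WA _ iA) ler_piMr // lern1 leq_b1.
rewrite sumr_const -[leLHS]mulr_natl; apply: ler_pM => //; rewrite ler_nat.
by rewrite cards2; case: (_ != _).
Qed.

End SwapEvents.

(** * Correlations of swap events *)

Section Moments.
Variables (R : realType) (n : nat) (o : bool) (a b : R).
Hypotheses (b0 : 0 <= b) (ba : b <= a) (a34 : a <= 3 / 4) (b12 : b <= 1 / 2).
Let W := wt o a b (n := n).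
Implicit Types (s t : labelling n) (G : graph n) (u v x y c : V n) (B C Q : {set V n}).

Let a1 : a <= 1. Proof. by rewrite (le_trans a34) //; lra. Qed.
Let a0 : 0 <= a. Proof. exact: le_trans ba. Qed.
Let a01 : 0 <= a <= 1. Proof. by rewrite a0. Qed.
Let b01 : 0 <= b <= 1. Proof. by rewrite b0 (le_trans ba). Qed.
Let w01 s e : 0 <= W s e <= 1. Proof. exact: wt01. Qed.

(** A shared cold edge has probability b and relaxes X <= Y to X <= Y + 1. These bounds say that the
    relaxation costs only constants, for one of the comparisons or for both. *)
Lemma pr2_shift_bounds m (I := pr2 m m a b leq) (J := pr2 m m a b (fun i j => i == j.+1)) :
  b * J <= 2 * I /\ b * J ^+ 2 <= 3 * I ^+ 2.
Proof.
have I0 : 0 <= I by exact: pr2_ge0.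
have J0 : 0 <= J by exact: pr2_ge0.
have h := pr2_shift_sqr b0 ba a1 m.
set K := pr2 m m a b (fun i j => i == j) in h.
have K0 : 0 <= K by exact: pr2_ge0.
have KI : K <= I by apply: le_pr2 => // i j _ _ /eqP ->.
have K2 : K ^+ 2 <= I ^+ 2 by rewrite lerXn2r ?nnegrE.
have hJ : b * J ^+ 2 <= 3 * I ^+ 2.
  have h1 : b * (1 / 4) * J ^+ 2 <= b * (1 - a) * J ^+ 2.
    by rewrite ler_wpM2r ?sqr_ge0 // ler_wpM2l //; have := a34; lra.
  have h2 : a * (1 - b) * K ^+ 2 <= 3 / 4 * I ^+ 2.
    apply: (@le_trans _ _ (3 / 4 * K ^+ 2)); last by rewrite ler_wpM2l.
    rewrite ler_wpM2r ?sqr_ge0 // (le_trans _ a34) // ler_piMr //; have := b0; lra.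
  rewrite -/J in h; lra.
split=> //.
rewrite -ler_sqr ?nnegrE ?mulr_ge0 // exprMn.
have : b * (b * J ^+ 2) <= 1 * (b * J ^+ 2).
  by rewrite ler_wpM2r ?mulr_ge0 ?sqr_ge0 //; have := b12; lra.
have := sqr_ge0 I; rewrite exprMn [b ^+ 2]expr2; lra.
Qed.

Definition shared_ok x B C (z : V n * V n) G : bool :=
  (deg G x B <= deg G x C + (z \in G))%N.

Lemma depends_on_shared x B C z Q : B \subset ~: Q -> C \subset ~: Q ->
  depends_on (star x (~: Q) :|: [set z]) (fun G => (shared_ok x B C z G)%:R : R).
Proof.
move=> BQ CQ G; rewrite /shared_ok.
have d (X : {set V n}) : X \subset ~: Q -> deg (G :&: (star x (~: Q) :|: [set z])) x X = deg G x X.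
  move=> XQ; rewrite /deg; congr #|pred_of_set _|; rewrite -finset.setIA; congr (_ :&: _).
  by apply/finset.setIidPr; apply: fintype.subset_trans (starS x XQ) (finset.subsetUl _ _).
by rewrite !d // !inE eqxx orbT andbT.
Qed.

Lemma depends_on_deg2 x B C Q (E : nat -> nat -> bool) : B \subset ~: Q -> C \subset ~: Q ->
  depends_on (star x (~: Q)) (fun G => (E (deg G x B) (deg G x C))%:R : R).
Proof.
move=> BQ CQ G.
have d (X : {set V n}) : X \subset ~: Q -> deg (G :&: star x (~: Q)) x X = deg G x X.
  move=> XQ; rewrite /deg; congr #|pred_of_set _|; rewrite -finset.setIA; congr (_ :&: _).
  by apply/finset.setIidPr; apply: (starS x XQ).
by rewrite !d.
Qed.

Lemma star_out_disjoint x y Q : x \in Q -> x != y ->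
  [disjoint star x (~: Q) & star y (~: Q)].
Proof. by move=> xQ xy; apply: star_disjoint2 => //; rewrite !inE xQ orbT. Qed.

Lemma ed_notin_star x y v Q : x \in Q -> y \in Q -> ed x y \notin star v (~: Q).
Proof.
move=> xQ yQ; apply/imsetP => -[w]; rewrite inE => wQ /ed_eq [[_ e]|[e _]];
  by rewrite -e ?xQ ?yQ in wQ.
Qed.

(** Expanding over the presence of the shared pair leaves independent factors. With I = P(m) and J =
    Pr(X = Y + 1) the expectation is I^2 + 2 b I J + b J^2, at most (1 + 4 + 3) I^2. *)
Lemma shared_pair_le s Q x1 x2 B1 C1 B2 C2 m : x1 \in Q -> x2 \in Q -> x1 != x2 ->
  x2 \in coldv o s x1 ->
  B1 \subset hotv o s x1 :\: Q -> C1 \subset coldv o s x1 :\: Q ->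
  B2 \subset hotv o s x2 :\: Q -> C2 \subset coldv o s x2 :\: Q ->
  #|B1| = m -> #|C1| = m -> #|B2| = m -> #|C2| = m ->
  Ex (W s) (fun G => (shared_ok x1 B1 C1 (ed x1 x2) G)%:R *
                     (shared_ok x2 B2 C2 (ed x1 x2) G)%:R) <=
  8 * pr2 m m a b leq ^+ 2.
Proof.
move=> Q1 Q2 x12 cold hB1 hC1 hB2 hC2 cB1 cC1 cB2 cC2.
have sQ (X Y : {set V n}) : X \subset Y :\: Q -> X \subset ~: Q /\ X \subset Y.
  by rewrite finset.subsetD -finset.disjoints_subset => /andP[].
have [B1h B1Q] : B1 \subset hotv o s x1 /\ B1 \subset ~: Q by have [] := sQ _ _ hB1.
have [C1h C1Q] : C1 \subset coldv o s x1 /\ C1 \subset ~: Q by have [] := sQ _ _ hC1.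
have [B2h B2Q] : B2 \subset hotv o s x2 /\ B2 \subset ~: Q by have [] := sQ _ _ hB2.
have [C2h C2Q] : C2 \subset coldv o s x2 /\ C2 \subset ~: Q by have [] := sQ _ _ hC2.
set z := ed x1 x2; pose zG G : R := (z \in G)%:R.
pose I1 G : R := (deg G x1 B1 <= deg G x1 C1)%N%:R.
pose I2 G : R := (deg G x2 B2 <= deg G x2 C2)%N%:R.
pose J1 G : R := (deg G x1 B1 == (deg G x1 C1).+1)%:R.
pose J2 G : R := (deg G x2 B2 == (deg G x2 C2).+1)%:R.
have E G : (shared_ok x1 B1 C1 z G)%:R * (shared_ok x2 B2 C2 z G)%:R =
   I1 G * I2 G + (zG G * (I1 G * J2 G) + (zG G * (J1 G * I2 G) + zG G * (J1 G * J2 G))).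
  have add (k l : nat) : ((k <= l + 1)%N%:R : R) = (k <= l)%N%:R + (k == l.+1)%:R.
    by rewrite -natrD; congr (_%:R); clear; lia.
  rewrite /shared_ok /zG; case: (z \in G); rewrite /= ?addn0.
    by rewrite !add -/(I1 G) -/(I2 G) -/(J1 G) -/(J2 G); ring.
  by rewrite -/(I1 G) -/(I2 G); ring.
have dI1 : depends_on (star x1 (~: Q)) I1 by exact: (depends_on_deg2 _ leq).
have dI2 : depends_on (star x2 (~: Q)) I2 by exact: (depends_on_deg2 _ leq).
have dJ1 : depends_on (star x1 (~: Q)) J1.
  exact: (depends_on_deg2 _ (fun i j => i == j.+1)).
have dJ2 : depends_on (star x2 (~: Q)) J2.
  exact: (depends_on_deg2 _ (fun i j => i == j.+1)).
have d12 := star_out_disjoint Q1 x12.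
have dz : depends_on [set z] zG by move=> G; rewrite /zG !inE eqxx andbT.
have dzs : [disjoint [set z] & star x1 (~: Q) :|: star x2 (~: Q)].
  by rewrite disjoints1 inE negb_or !ed_notin_star.
have wz : W s z = b by exact: wt_cold.
have Ez : Ex (W s) zG = b by rewrite Ex_mem.
have dM F H : depends_on (star x1 (~: Q)) F -> depends_on (star x2 (~: Q)) H ->
    depends_on (star x1 (~: Q) :|: star x2 (~: Q)) (fun G => F G * H G : R).
  move=> dF dH; apply: depends_onM; [apply: depends_onS dF|apply: depends_onS dH].
    exact: finset.subsetUl.
  exact: finset.subsetUr.
have zM F H : depends_on (star x1 (~: Q)) F -> depends_on (star x2 (~: Q)) H ->
    Ex (W s) (fun G => zG G * (F G * H G)) = b * (Ex (W s) F * Ex (W s) H).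
  by move=> dF dH; rewrite (Ex_indep _ dzs dz (dM _ _ dF dH)) Ez (Ex_indep _ d12 dF dH).
have [h1 h2] := pr2_shift_bounds m.
set I := pr2 m m a b leq in h1 h2 *; set J := pr2 m m a b _ in h1 h2 *.
have I0 : 0 <= I by exact: pr2_ge0.
have J0 : 0 <= J by exact: pr2_ge0.
have EI1 : Ex (W s) I1 = I.
  by rewrite /I1 (Ex_deg2 _ _ (fun i j => (i <= j)%N%:R)) // cB1 cC1.
have EI2 : Ex (W s) I2 = I.
  by rewrite /I2 (Ex_deg2 _ _ (fun i j => (i <= j)%N%:R)) // cB2 cC2.
have EJ1 : Ex (W s) J1 = J.
  by rewrite /J1 (Ex_deg2 _ _ (fun i j => (i == j.+1)%:R)) // cB1 cC1.
have EJ2 : Ex (W s) J2 = J.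
  by rewrite /J2 (Ex_deg2 _ _ (fun i j => (i == j.+1)%:R)) // cB2 cC2.
rewrite (eq_Ex _ E) !ExD (Ex_indep _ d12 dI1 dI2) !zM // EI1 EI2 EJ1 EJ2.
have := ler_wpM2r I0 h1; rewrite !expr2 in h2 *; lra.
Qed.

Lemma depends_on_shared_pair Q x1 x2 B1 C1 B2 C2 z :
  B1 \subset ~: Q -> C1 \subset ~: Q -> B2 \subset ~: Q -> C2 \subset ~: Q ->
  depends_on (star x1 (~: Q) :|: star x2 (~: Q) :|: [set z])
   (fun G => (shared_ok x1 B1 C1 z G)%:R * (shared_ok x2 B2 C2 z G)%:R : R).
Proof.
move=> h1 h2 h3 h4; apply: depends_onM.
  apply: depends_onS (depends_on_shared x1 z h1 h2).
  by apply: finset.setSU; exact: finset.subsetUl.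
apply: depends_onS (depends_on_shared x2 z h3 h4).
by apply: finset.setSU; exact: finset.subsetUr.
Qed.

(** Dropping hot edges towards Q only weakens the comparison, and among the cold vertices in Q at
    most c remains besides y, which [swap_ok] leaves out anyway. *)
Lemma swap_ok_shared s Q x y c G : x \in Q -> y \in Q ->
  (forall w, w \in Q -> w \in coldv o s x -> w != y -> w = c) ->
  swap_ok o s x y G ->
  shared_ok x (hotv o s x :\: Q) (coldv o s x :\: Q) (ed x c) G.
Proof.
move=> xQ yQ hc; rewrite /swap_ok /shared_ok => h.
apply: (@leq_trans (deg G x (hotv o s x :\ y))).
  apply: degS; apply/fintype.subsetP => w; rewrite !inE => /andP[wQ ->].
  by rewrite andbT; apply: contraNneq wQ => ->.
apply: leq_trans h _.
apply: (@leq_trans (deg G x ((coldv o s x :\: Q) :|: [set c]))).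
  apply: degS; apply/fintype.subsetP => w; rewrite finset.in_setD1 => /andP[wy wc].
  rewrite finset.in_setU finset.in_setD wc andbT finset.in_set1.
  by case: (boolP (w \in Q)) => //= wQ; rewrite (hc w).
rewrite /deg /star imsetU imset_set1 finset.setIUr cardsU.
apply: leq_trans (leq_subr _ _) _; rewrite leq_add2l.
have [h1|h1] := boolP (ed x c \in G).
  by apply: leq_trans (subset_leq_card (subsetIr _ _)) _; rewrite cards1.
rewrite (_ : _ :&: _ = finset.set0) ?cards0 //; apply/setP => e; rewrite !inE.
by apply/negP => /andP[eG /eqP e1]; rewrite -e1 eG in h1.
Qed.

Lemma Ex_swap_ok s u v : balanced s -> s u != s v ->
  Ex (W s) (fun G => (swap_ok o s u v G)%:R) = pr2 n.-1 n.-1 a b leq.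
Proof.
move=> bs uv; have [h c] := card_swap_ok o bs uv.
by rewrite /swap_ok (Ex_deg2 _ _ (fun i j => (i <= j)%N%:R)) ?subD1set // h c.
Qed.

Definition swap_pair s u v G : bool := swap_ok o s u v G && swap_ok o s v u G.

Lemma depends_on_swap_ok s x y :
  depends_on (star x (~: [set y])) (fun G => (swap_ok o s x y G)%:R : R).
Proof.
by apply: (depends_on_deg2 _ leq); apply/fintype.subsetP => w; rewrite !inE => /andP[].
Qed.

Lemma Ex_swap_pair s u v : balanced s -> s u != s v ->
  Ex (W s) (fun G => (swap_pair s u v G)%:R) = pr2 n.-1 n.-1 a b leq ^+ 2.
Proof.
move=> bs uv; have vu : s v != s u by rewrite eq_sym.
have nuv : u != v by apply: contraNneq uv => ->.
rewrite (eq_Ex _ (H := fun G => (swap_ok o s u v G)%:R * (swap_ok o s v u G)%:R)); last first.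
  by move=> G; rewrite -natrM mulnb.
rewrite (Ex_indep _ _ (@depends_on_swap_ok s u v) (@depends_on_swap_ok s v u)).
  by rewrite !Ex_swap_ok // expr2.
by apply: star_disjoint2 => //; rewrite !inE eqxx.
Qed.

Section FourVertices.
Variables (s : labelling n) (u v u' v' : V n).
Hypotheses (bs : balanced s) (uu : u != u') (vv : v != v').
Hypotheses (su : s u' = s u) (uv : s u != s v) (sv : s v' = s v).
Let Q := [set u; v; u'; v'].

Let uQ : u \in Q. Proof. by rewrite !inE eqxx. Qed.
Let vQ : v \in Q. Proof. by rewrite !inE eqxx ?orbT. Qed.
Let u'Q : u' \in Q. Proof. by rewrite !inE eqxx ?orbT. Qed.
Let v'Q : v' \in Q. Proof. by rewrite !inE eqxx ?orbT. Qed.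
Let nuv : u != v. Proof. by apply: contraNneq uv => ->. Qed.
Let nuv' : u != v'. Proof. by apply: contraNneq uv => ->; rewrite sv. Qed.
Let nu'v : u' != v. Proof. by have h := uv; rewrite -su in h; apply: contraNneq h => ->. Qed.
Let nu'v' : u' != v'. Proof. by move: uv; rewrite -su -sv => h; apply: contraNneq h => ->. Qed.

Lemma card_outside_four x : x \in Q ->
  #|hotv o s x :\: Q| = (n - 2)%N /\ #|coldv o s x :\: Q| = (n - 2)%N.
Proof.
move=> xQ.
have cls (d : bool) : #|[set y | s y == d] :\: Q| = (n - 2)%N.
  have := cardsID Q [set y | s y == d]; rewrite card_class //.
  suff -> : #|[set y | s y == d] :&: Q| = 2%N.
    have aux (k m : nat) : (2 + k)%N = m -> k = (m - 2)%N by move=> <-; rewrite addKn.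
    exact: aux.
  have [e|e] := eqVneq d (s u).
    have -> : [set y | s y == d] :&: Q = [set u; u'].
      apply/setP => y; rewrite !inE e.
      have [->|_] := eqVneq y u; first by rewrite eqxx.
      have [->|_] := eqVneq y v; first by rewrite eq_sym (negPf uv) eq_sym (negPf nu'v).
      have [->|_] := eqVneq y u'; first by rewrite su eqxx.
      by have [->|_] := eqVneq y v'; [rewrite sv eq_sym (negPf uv)|rewrite andbF].
    by rewrite cards2 uu.
  have {}e : d = s v by move: uv e; case: d; case: (s u); case: (s v).
  have -> : [set y | s y == d] :&: Q = [set v; v'].
    apply/setP => y; rewrite !inE e.
    have [->|_] := eqVneq y u; first by rewrite (negPf uv) (negPf nuv) (negPf nuv').
    have [->|_] := eqVneq y v; first by rewrite eqxx.
    have [->|_] := eqVneq y u'; first by rewrite su (negPf uv) (negPf nu'v').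
    by have [->|_] := eqVneq y v'; [rewrite sv eqxx|rewrite andbF].
  by rewrite cards2 vv.
split.
  rewrite -(cls (s x == o)); congr #|pred_of_set _|; apply/setP => y; rewrite !inE.
  have [->|yx] := eqVneq y x; first by move: xQ; rewrite !inE => ->.
  by case: (s x); case: (s y); case: o.
rewrite -(cls (s x != o)); congr #|pred_of_set _|; apply/setP => y; rewrite !inE.
have [->|yx] := eqVneq y x; first by move: xQ; rewrite !inE => ->.
by case: (s x); case: (s y); case: o.
Qed.

Let sh x z G := shared_ok x (hotv o s x :\: Q) (coldv o s x :\: Q) z G.

Let subQ (X : {set V n}) : X :\: Q \subset ~: Q.
Proof. by apply/fintype.subsetP => y; rewrite inE => /andP[h _]; rewrite inE. Qed.

Let pair_le x1 x2 : x1 \in Q -> x2 \in Q -> x1 != x2 -> x2 \in coldv o s x1 ->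
  Ex (W s) (fun G => (sh x1 (ed x1 x2) G)%:R * (sh x2 (ed x1 x2) G)%:R) <=
  8 * pr2 (n - 2) (n - 2) a b leq ^+ 2.
Proof.
move=> h1 h2 h12 hc; have [? ?] := card_outside_four h1; have [? ?] := card_outside_four h2.
exact: (@shared_pair_le s Q).
Qed.

Let pair_disjoint x1 x2 x3 x4 : x1 \in Q -> x2 \in Q -> x3 \in Q -> x4 \in Q ->
  x1 != x3 -> x1 != x4 -> x2 != x3 -> x2 != x4 ->
  [disjoint star x1 (~: Q) :|: star x2 (~: Q) :|: [set ed x1 x2] &
            star x3 (~: Q) :|: star x4 (~: Q) :|: [set ed x3 x4]].
Proof.
move=> h1 h2 h3 h4 h13 h14 h23 h24.
have d (X Y : graph n) : [disjoint X & Y] -> X :&: Y = finset.set0 :> graph n.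
  by rewrite -setI_eq0 => /eqP.
have z1 x y w : x \in Q -> y \in Q -> [disjoint star w (~: Q) & [set ed x y]].
  by move=> hx hy; rewrite disjoint_sym disjoints1 ed_notin_star.
have z2 x y w : x \in Q -> y \in Q -> [disjoint [set ed x y] & star w (~: Q)].
  by move=> hx hy; rewrite disjoints1 ed_notin_star.
have zz : [disjoint [set ed x1 x2] & [set ed x3 x4]].
  rewrite disjoints1 inE; apply/eqP => /ed_eq [[e _]|[e _]].
    by rewrite e eqxx in h13.
  by rewrite e eqxx in h14.
rewrite -setI_eq0 !finset.setIUl !finset.setIUr.
by rewrite !d ?finset.setU0 ?eqxx ?z1 ?z2 ?zz ?star_out_disjoint.
Qed.

Let product_le x1 x2 x3 x4 : x1 \in Q -> x2 \in Q -> x3 \in Q -> x4 \in Q ->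
  x1 != x2 -> x3 != x4 -> x1 != x3 -> x1 != x4 -> x2 != x3 -> x2 != x4 ->
  x2 \in coldv o s x1 -> x4 \in coldv o s x3 ->
  Ex (W s) (fun G => ((sh x1 (ed x1 x2) G)%:R * (sh x2 (ed x1 x2) G)%:R) *
                     ((sh x3 (ed x3 x4) G)%:R * (sh x4 (ed x3 x4) G)%:R)) <=
  (8 * pr2 (n - 2) (n - 2) a b leq ^+ 2) ^+ 2.
Proof.
move=> h1 h2 h3 h4 h12 h34 h13 h14 h23 h24 c12 c34.
rewrite (Ex_indep _ (pair_disjoint h1 h2 h3 h4 h13 h14 h23 h24)); last 2 first.
- exact: depends_on_shared_pair.
- exact: depends_on_shared_pair.
rewrite expr2; apply: ler_pM; rewrite ?pair_le //;
  by apply: Ex_ge0 => // G; rewrite mulr_ge0.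
Qed.

(** The four vertices split into two couples, each sharing one cold pair: (u, v') and (v, u') if
    opposite labels are cold, (u, u') and (v, v') if equal labels are. The two couples involve
    disjoint sets of pairs, so [shared_pair_le] is used twice. *)
Lemma swap_pair_four :
  Ex (W s) (fun G => (swap_pair s u v G)%:R * (swap_pair s u' v' G)%:R) <=
  (8 * pr2 (n - 2) (n - 2) a b leq ^+ 2) ^+ 2.
Proof.
have inQ w : w \in Q -> [\/ w = u, w = v, w = u' | w = v'].
  rewrite !inE -!orbA => /or4P[] /eqP ->; [exact: Or41|exact: Or42|exact: Or43|exact: Or44].
have svu := uv; rewrite eq_sym in svu.
have mono x1 x2 x3 x4 : 
    (forall G, swap_pair s u v G -> swap_pair s u' v' G ->
      [/\ sh x1 (ed x1 x2) G, sh x2 (ed x1 x2) G, sh x3 (ed x3 x4) G & sh x4 (ed x3 x4) G]) ->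
    Ex (W s) (fun G => (swap_pair s u v G)%:R * (swap_pair s u' v' G)%:R) <=
    Ex (W s) (fun G => ((sh x1 (ed x1 x2) G)%:R * (sh x2 (ed x1 x2) G)%:R) *
                     ((sh x3 (ed x3 x4) G)%:R * (sh x4 (ed x3 x4) G)%:R)).
  move=> h; apply: le_Ex => // G.
  case E1 : (swap_pair s u v G); last by rewrite mul0r !mulr_ge0.
  case E2 : (swap_pair s u' v' G); last by rewrite mulr0 !mulr_ge0.
  by have [-> -> -> ->] := h G E1 E2; rewrite !mulr1.
have [ot|of_] := boolP o.
  apply: (le_trans (mono u v' v u' _)); last first.
    apply: product_le => //; try by rewrite eq_sym.
      by rewrite inE eq_sym nuv' sv (negPf uv) ot.
    by rewrite inE nu'v su (negPf svu) ot.
  move=> G /andP[Euv Evu] /andP[Eu'v' Ev'u']; split.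
  - apply: (swap_ok_shared uQ vQ _ Euv) => w /inQ[] ->; rewrite !inE ?eqxx //=.
      by rewrite su eqxx ot andbF.
  - rewrite edC; apply: (swap_ok_shared v'Q u'Q _ Ev'u') => w /inQ[] ->; rewrite !inE ?eqxx //=.
      by rewrite sv eqxx ot andbF.
  - apply: (swap_ok_shared vQ uQ _ Evu) => w /inQ[] ->; rewrite !inE ?eqxx //=.
      by rewrite sv eqxx ot andbF.
  - rewrite edC; apply: (swap_ok_shared u'Q v'Q _ Eu'v') => w /inQ[] ->; rewrite !inE ?eqxx //=.
      by rewrite su eqxx ot andbF.
apply: (le_trans (mono u u' v v' _)); last first.
  apply: product_le => //; try by rewrite eq_sym.
    by rewrite inE eq_sym uu su eqxx (negPf of_).
  by rewrite inE eq_sym vv sv eqxx (negPf of_).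
move=> G /andP[Euv Evu] /andP[Eu'v' Ev'u']; split.
- apply: (swap_ok_shared uQ vQ _ Euv) => w /inQ[] ->; rewrite !inE ?eqxx //=.
    by rewrite sv (negPf uv) (negPf of_) andbF.
- rewrite edC; apply: (swap_ok_shared u'Q v'Q _ Eu'v') => w /inQ[] ->; rewrite !inE ?eqxx //=.
    by rewrite su (negPf uv) (negPf of_) andbF.
- apply: (swap_ok_shared vQ uQ _ Evu) => w /inQ[] ->; rewrite !inE ?eqxx //=.
    by rewrite su (negPf svu) (negPf of_) andbF.
- rewrite edC; apply: (swap_ok_shared v'Q u'Q _ Ev'u') => w /inQ[] ->; rewrite !inE ?eqxx //=.
    by rewrite sv (negPf svu) (negPf of_) andbF.
Qed.

(** The comparison at u is kept for one swap only; those at v and v' share the cold pair {v, v'}.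
    The vertex u' merely completes Q to two vertices of each class. *)
Lemma swap_pair_three_cold : ~~ o ->
  Ex (W s) (fun G => (swap_pair s u v G)%:R * (swap_pair s u v' G)%:R) <=
  pr2 n.-1 n.-1 a b leq * (8 * pr2 (n - 2) (n - 2) a b leq ^+ 2).
Proof.
move=> of_.
have inQ w : w \in Q -> [\/ w = u, w = v, w = u' | w = v'].
  rewrite !inE -!orbA => /or4P[] /eqP ->; [exact: Or41|exact: Or42|exact: Or43|exact: Or44].
have svu := uv; rewrite eq_sym in svu.
apply: (@le_trans _ _ (Ex (W s) (fun G => (swap_ok o s u v G)%:R *
   ((sh v (ed v v') G)%:R * (sh v' (ed v v') G)%:R)))).
  apply: le_Ex => // G.
  case E1 : (swap_pair s u v G); last by rewrite mul0r !mulr_ge0.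
  case E2 : (swap_pair s u v' G); last by rewrite mulr0 !mulr_ge0.
  have /andP[-> Evu] := E1; have /andP[_ Ev'u] := E2.
  have -> : sh v (ed v v') G.
    apply: (swap_ok_shared vQ uQ _ Evu) => w /inQ[] ->; rewrite !inE ?eqxx //=.
    by rewrite su (negPf svu) (negPf of_) andbF.
  have -> : sh v' (ed v v') G.
    rewrite edC; apply: (swap_ok_shared v'Q uQ _ Ev'u) => w /inQ[] ->; rewrite !inE ?eqxx //=.
    by rewrite su sv (negPf svu) (negPf of_) andbF.
  by rewrite !mulr1.
have dis : [disjoint star u (~: [set v]) &
    star v (~: Q) :|: star v' (~: Q) :|: [set ed v v']].
  have d (X Y : graph n) : [disjoint X & Y] -> X :&: Y = finset.set0.
    by rewrite -setI_eq0 => /eqP.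
  have e : [disjoint star u (~: [set v]) & [set ed v v']].
    rewrite disjoint_sym disjoints1; apply/imsetP => -[w _ /ed_eq [[e _]|[_ e]]].
      by move: nuv; rewrite e eqxx.
    by move: nuv'; rewrite e eqxx.
  have h w : u != w -> [disjoint star u (~: [set v]) & star w (~: Q)].
    by move=> uw; apply: star_disjoint2 => //; rewrite [u \in ~: Q]inE uQ orbT.
  by rewrite -setI_eq0 !finset.setIUr !d ?finset.setU0 ?eqxx ?h ?e.
rewrite (Ex_indep _ dis); last 2 first.
- exact: depends_on_swap_ok.
- exact: depends_on_shared_pair.
rewrite Ex_swap_ok // ler_wpM2l ?pr2_ge0 // pair_le //.
by rewrite inE eq_sym vv sv eqxx (negPf of_).
Qed.

End FourVertices.

(** Here v and v' are hot for each other, and dropping a hot pair only weakens a comparison, so no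
    edge has to be shared. The hot side loses v' in addition, whence n - 2 against n - 1. *)
Lemma swap_pair_three_hot s u v v' : balanced s -> o -> v != v' -> s u != s v -> s v' = s v ->
  Ex (W s) (fun G => (swap_pair s u v G)%:R * (swap_pair s u v' G)%:R) <=
  pr2 n.-1 n.-1 a b leq * pr2 (n - 2) n.-1 a b leq ^+ 2.
Proof.
move=> bs ot vv uv sv; set Q := [set u; v; v'].
have uQ : u \in Q by rewrite !inE eqxx.
have vQ : v \in Q by rewrite !inE eqxx ?orbT.
have v'Q : v' \in Q by rewrite !inE eqxx ?orbT.
have nuv : u != v by apply: contraNneq uv => ->.
have nuv' : u != v' by apply: contraNneq uv => ->; rewrite sv.
have svu := uv; rewrite eq_sym in svu.
have inQ w : w \in Q -> [\/ w = u, w = v | w = v'].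
  rewrite !inE -!orbA => /or3P[] /eqP ->; [exact: Or31|exact: Or32|exact: Or33].
pose ok x G := (deg G x (hotv o s x :\: Q) <= deg G x (coldv o s x :\: Q))%N.
have reduce x : x \in Q -> s x = s v -> forall G, swap_ok o s x u G -> ok x G.
  move=> xQ sx G h; apply: (@leq_trans (deg G x (hotv o s x :\ u))).
    apply: degS; apply/fintype.subsetP => w; rewrite finset.in_setD1 finset.in_setD => /andP[wQ ->].
    by rewrite andbT; apply: contraNneq wQ => ->.
  apply: leq_trans h _; apply: degS; apply/fintype.subsetP => w.
  rewrite finset.in_setD1 finset.in_setD => /andP[wu wc]; rewrite wc andbT.
  apply/negP => /inQ[e|e|e]; first by rewrite e eqxx in wu.
    by move: wc; rewrite inE e sx eqxx ot andbF.
  by move: wc; rewrite inE e sx sv eqxx ot andbF.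
apply: (@le_trans _ _ (Ex (W s) (fun G => (swap_ok o s u v G)%:R *
   ((ok v G)%:R * (ok v' G)%:R)))).
  apply: le_Ex => // G.
  case E1 : (swap_pair s u v G); last by rewrite mul0r !mulr_ge0.
  case E2 : (swap_pair s u v' G); last by rewrite mulr0 !mulr_ge0.
  have /andP[-> Evu] := E1; have /andP[_ Ev'u] := E2.
  by rewrite (reduce v) // (reduce v') // !mulr1.
have sub X : X :\: Q \subset ~: Q.
  by apply/fintype.subsetP => w; rewrite inE => /andP[h _]; rewrite inE.
have dok x : depends_on (star x (~: Q)) (fun G => (ok x G)%:R : R).
  by apply: (depends_on_deg2 _ leq).
have d12 := star_out_disjoint vQ vv.
have h w : u != w -> [disjoint star u (~: [set v]) & star w (~: Q)].
  by move=> uw; apply: star_disjoint2 => //; rewrite [u \in ~: Q]inE uQ orbT.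
have dis : [disjoint star u (~: [set v]) & star v (~: Q) :|: star v' (~: Q)].
  have d (X Y : graph n) : [disjoint X & Y] -> X :&: Y = finset.set0.
    by rewrite -setI_eq0 => /eqP.
  by rewrite -setI_eq0 !finset.setIUr !d ?finset.setU0 ?eqxx ?h.
have dM : depends_on (star v (~: Q) :|: star v' (~: Q)) (fun G => (ok v G)%:R * (ok v' G)%:R : R).
  apply: depends_onM; [apply: depends_onS (dok v)|apply: depends_onS (dok v')].
    exact: finset.subsetUl.
  exact: finset.subsetUr.
rewrite (Ex_indep _ dis (@depends_on_swap_ok s u v) dM) (Ex_indep _ d12 (dok v) (dok v')).
rewrite Ex_swap_ok // expr2.
have card x : x \in Q -> s x = s v -> #|hotv o s x :\: Q| = (n - 2)%N /\ #|coldv o s x :\: Q| = n.-1.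
  move=> xQ sx.
  have aux (k m : nat) : (2 + k)%N = m -> k = (m - 2)%N by move=> <-; rewrite addKn.
  have aux1 (k m : nat) : (1 + k)%N = m -> k = m.-1 by move=> <-.
  split.
    apply: aux; rewrite -[RHS](card_class (s v) bs) -[RHS](cardsID Q); congr (_ + _)%N.
      rewrite (_ : _ :&: Q = [set v; v']) ?cards2 ?vv //.
      apply/setP => y; rewrite !inE.
      have [->|_] := eqVneq y u; first by rewrite (negPf uv) (negPf nuv) (negPf nuv').
      have [->|_] := eqVneq y v; first by rewrite eqxx.
      by have [->|_] := eqVneq y v'; [rewrite sv eqxx|rewrite andbF].
    apply: eq_card => y; rewrite !inE sx.
    have [->|yx] := eqVneq y x; first by move: xQ; rewrite !inE => ->.
    by rewrite ot; case: (s v); case: (s y).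
  apply: aux1; rewrite -[RHS](card_class (s u) bs) -[RHS](cardsID Q); congr (_ + _)%N.
    rewrite (_ : _ :&: Q = [set u]) ?cards1 //.
    apply/setP => y; rewrite !inE.
    have [->|_] := eqVneq y u; first by rewrite eqxx.
    have [->|_] := eqVneq y v; first by rewrite (negPf svu).
    by have [->|_] := eqVneq y v'; [rewrite sv (negPf svu)|rewrite andbF].
  apply: eq_card => y; rewrite !inE sx.
  have [->|yx] := eqVneq y x; first by move: xQ; rewrite !inE => ->.
  by move: uv; rewrite ot; case: (s u); case: (s v); case: (s y).
have Eok x : x \in Q -> s x = s v -> Ex (W s) (fun G => (ok x G)%:R) = pr2 (n - 2) n.-1 a b leq.
  move=> xQ sx; have [c1 c2] := card x xQ sx.
  by rewrite /ok (Ex_deg2 _ _ (fun i j => (i <= j)%N%:R)) ?subsetDl // c1 c2.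
by rewrite !Eok.
Qed.

End Moments.

Section StrongLower.
Variables (R : realType) (n : nat) (o : bool) (a b : R).
Hypotheses (b0 : 0 <= b) (ba : b <= a) (a34 : a <= 3 / 4) (b12 : b <= 1 / 2).
Hypothesis n2 : (1 < n)%N.
Let W := wt o a b (n := n).
Let P := pr2 n.-1 n.-1 a b leq.
Implicit Types (s t : labelling n) (G : graph n) (u v : V n).

Let a1 : a <= 1. Proof. by rewrite (le_trans a34) //; lra. Qed.
Let a0 : 0 <= a. Proof. exact: le_trans ba. Qed.
Let a01 : 0 <= a <= 1. Proof. by rewrite a0. Qed.
Let b01 : 0 <= b <= 1. Proof. by rewrite b0 (le_trans ba). Qed.
Let w01 s e : 0 <= W s e <= 1. Proof. exact: wt01. Qed.
Let P0 : 0 <= P. Proof. exact: pr2_ge0. Qed.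
Let a1' : 1 / 4 <= 1 - a. Proof. have := a34; lra. Qed.
Let b1' : 1 / 2 <= 1 - b. Proof. have := b12; lra. Qed.
Let a1'' : 0 <= 1 - a. Proof. have := a1'; lra. Qed.
Let b1'' : 0 <= 1 - b. Proof. have := b1'; lra. Qed.
Let n_succ : n.-1 = (n - 2).+1. Proof. by case: n n2 => [|[|m]] //= _; rewrite !subSS subn0. Qed.

(** A missing trial of X is restored by one that fails, with probability at least 1/4. For Y the
    probability is at least 1/2, which gives the factor 8 of [iota_le]. *)
Let hot_le : pr2 (n - 2) n.-1 a b leq <= 4 * P.
Proof.
rewrite /P; set Q := pr2 (n - 2) _ _ _ _.
have Q0 : 0 <= Q by exact: pr2_ge0.
have : (1 - a) * Q <= pr2 n.-1 n.-1 a b leq.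
  rewrite {1}n_succ /pr2 /binE2 /= lerDr mulr_ge0 //.
  by apply: binE_ge0 => // k; apply: binE_ge0.
have := ler_wpM2r Q0 a1'; lra.
Qed.

Let iota_le : pr2 (n - 2) (n - 2) a b leq <= 8 * P.
Proof.
set I := pr2 _ _ _ _ _.
have I0 : 0 <= I by exact: pr2_ge0.
have h : (1 - a) * (1 - b) * I <= P.
  rewrite /P n_succ /pr2 binE2SS /= lerDr !addr_ge0 // mulr_ge0 ?mulr_ge0 //;
    by apply: binE_ge0 => // k; apply: binE_ge0.
have : 1 / 4 * (1 / 2) <= (1 - a) * (1 - b).
  by apply: ler_pM => //; lra.
move=> /(ler_wpM2r I0); lra.
Qed.

Let iota0 : 0 <= pr2 (n - 2) (n - 2) a b leq. Proof. exact: pr2_ge0. Qed.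

Let four_le s u v u' v' : balanced s -> u != u' -> v != v' ->
  s u' = s u -> s u != s v -> s v' = s v ->
  Ex (W s) (fun G => (swap_pair o s u v G)%:R * (swap_pair o s u' v' G)%:R) <=
  8 ^+ 6 * P ^+ 4.
Proof.
move=> bs uu vv su uv sv.
apply: le_trans (swap_pair_four o b0 ba a34 b12 bs uu vv su uv sv) _.
have -> : 8 ^+ 6 * P ^+ 4 = (8 * (8 * P) ^+ 2) ^+ 2 by ring.
have h : 8 * pr2 (n - 2) (n - 2) a b leq ^+ 2 <= 8 * (8 * P) ^+ 2.
  by rewrite ler_wpM2l // lerXn2r ?nnegrE ?mulr_ge0.
by rewrite lerXn2r // nnegrE mulr_ge0 // exprn_ge0 // mulr_ge0.
Qed.

Let three_le s u v v' : balanced s -> v != v' -> s u != s v -> s v' = s v ->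
  Ex (W s) (fun G => (swap_pair o s u v G)%:R * (swap_pair o s u v' G)%:R) <=
  8 ^+ 3 * P ^+ 3.
Proof.
move=> bs vv uv sv; have [ot|of_] : o \/ ~~ o by case: (o); [left|right].
  apply: le_trans (swap_pair_three_hot b0 ba a34 bs ot vv uv sv) _.
  rewrite -/P; apply: (@le_trans _ _ (P * (4 * P) ^+ 2)).
    by rewrite ler_wpM2l // lerXn2r ?nnegrE ?mulr_ge0 // pr2_ge0.
  have := exprn_ge0 3 P0; rewrite exprMn.
  have -> : P * (4 ^+ 2 * P ^+ 2) = 16 * P ^+ 3 by ring.
  have -> : 8 ^+ 3 * P ^+ 3 = 64 * (8 * P ^+ 3) by ring.
  lra.
have [u0 /andP[h1 h2]] : exists u0, (u != u0) && (s u0 == s u).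
  have := card_class (s u) bs; rewrite (cardsD1 u) inE eqxx => e.
  have : (0 < #|[set v | s v == s u] :\ u|)%N.
    by rewrite -(ltn_add2l 1) addn0 e.
  rewrite card_gt0 => /set0Pn[x]; rewrite !inE => /andP[xu sx]; exists x.
  by rewrite eq_sym xu sx.
apply: le_trans (swap_pair_three_cold b0 ba a34 b12 bs h1 vv (eqP h2) uv sv of_) _.
rewrite -/P; have -> : 8 ^+ 3 * P ^+ 3 = P * (8 * (8 * P) ^+ 2) by ring.
by rewrite ler_wpM2l // ler_wpM2l // lerXn2r ?nnegrE ?mulr_ge0.
Qed.

Definition swap_count s G : R :=
  \sum_(u | s u) \sum_(v | ~~ s v) (swap_pair o s u v G)%:R.

Let card_plus s : balanced s -> #|(fun u => s u)| = n.
Proof.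
by move=> bs; rewrite -[RHS](card_class true bs); apply: eq_card => u; rewrite !inE eqb_id.
Qed.

Let card_minus s : balanced s -> #|(fun u => ~~ s u)| = n.
Proof.
by move=> bs; rewrite -[RHS](card_class false bs); apply: eq_card => u; rewrite !inE eqbF_neg.
Qed.

Lemma Ex_swap_count s : balanced s ->
  Ex (W s) (swap_count s) = (n%:R * P) ^+ 2.
Proof.
move=> bs; rewrite /swap_count Ex_sum.
rewrite (eq_bigr (fun=> n%:R * P ^+ 2)) => [|u su].
  by rewrite sumr_const (card_plus bs) -[LHS]mulr_natl; ring.
rewrite Ex_sum (eq_bigr (fun=> P ^+ 2)) => [|v sv].
  by rewrite sumr_const (card_minus bs) -[LHS]mulr_natl.
by rewrite Ex_swap_pair // su (negPf sv).
Qed.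

Let F s u v G : R := (swap_pair o s u v G)%:R.

(** The pairs (u', v') are sorted by what they share with (u, v): everything for one pair, one
    vertex for at most n pairs on either side, nothing for at most n^2. *)
Let pair_sum s u v : balanced s -> s u -> ~~ s v ->
  \sum_(u' | s u') \sum_(v' | ~~ s v') Ex (W s) (fun G => F s u v G * F s u' v' G) <=
  P ^+ 2 + 2 * (n%:R * (8 ^+ 3 * P ^+ 3)) + n%:R ^+ 2 * (8 ^+ 6 * P ^+ 4).
Proof.
move=> bs su sv.
have uv : s u != s v by rewrite su (negPf sv).
have p2 := exprn_ge0 2 P0; have p3 := exprn_ge0 3 P0; have p4 := exprn_ge0 4 P0.
have p3' : 0 <= 8 ^+ 3 * P ^+ 3 by rewrite mulr_ge0 ?exprn_ge0.
have p4' : 0 <= 8 ^+ 6 * P ^+ 4 by rewrite mulr_ge0 ?exprn_ge0.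
set c3 := 8 ^+ 3 * _ in p3' *; set c4 := 8 ^+ 6 * _ in p4' *.
pose bound u' v' : R := (u' == u)%:R * (v' == v)%:R * P ^+ 2 +
   (u' == u)%:R * c3 + (v' == v)%:R * c3 + c4.
apply: (@le_trans _ _ (\sum_(u' | s u') \sum_(v' | ~~ s v') bound u' v')).
  apply: ler_sum => u' su'; apply: ler_sum => v' sv'; rewrite /bound.
  have uE : s u' = s u by rewrite su su'.
  have vE : s v' = s v by rewrite (negPf sv) (negPf sv').
  have [eu|nu] := eqVneq u' u; have [ev|nv] := eqVneq v' v.
  - rewrite eu ev !mul1r.
    have : Ex (W s) (fun G => F s u v G * F s u v G) = P ^+ 2.
      rewrite -(Ex_swap_pair o a b bs uv); apply: eq_Ex => G.
      by rewrite /F -natrM mulnb andbb.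
    by move=> ->; rewrite -!addrA lerDl !addr_ge0.
  - rewrite eu !mul1r !mul0r add0r addr0.
    have : Ex (W s) (fun G => F s u v G * F s u v' G) <= c3.
      by apply: three_le => //; rewrite eq_sym.
    by move=> h; apply: le_trans h _; rewrite lerDl.
  - rewrite ev !mul1r !mul0r !add0r.
    have : Ex (W s) (fun G => F s u v G * F s u' v G) <= c3.
      rewrite (eq_Ex _ (H := fun G => F s v u G * F s v u' G)); last first.
        by move=> G; rewrite /F /swap_pair andbC [swap_ok o s u' v G && _]andbC.
      by apply: three_le => //; rewrite eq_sym.
    by move=> h; apply: le_trans h _; rewrite lerDl.
  - rewrite !mul0r !add0r; by apply: four_le => //; rewrite eq_sym.
have S1 (x : V n) (A : pred (V n)) (c : R) : 0 <= c -> \sum_(y | A y) (y == x)%:R * c <= c.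
  move=> c0; rewrite big_mkcond (bigD1 x) //= eqxx mul1r big1 ?addr0; first by case: ifP.
  by move=> y /negPf ->; rewrite mul0r if_same.
have S2 u' : \sum_(v' | ~~ s v') bound u' v' <= (u' == u)%:R * P ^+ 2 +
    n%:R * ((u' == u)%:R * c3) + c3 + n%:R * c4.
  have cst (c : R) : \sum_(v' | ~~ s v') c = n%:R * c.
    by rewrite sumr_const (card_minus bs) -[LHS]mulr_natl.
  rewrite /bound !big_split /= !cst lerD2r lerD ?S1 // lerD2r.
  rewrite (eq_bigr (fun v' => (v' == v)%:R * ((u' == u)%:R * P ^+ 2))); last by move=> v' _; ring.
  by apply: S1; rewrite mulr_ge0.
have cst (c : R) : \sum_(u' | s u') c = n%:R * c.
  by rewrite sumr_const (card_plus bs) -[LHS]mulr_natl.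
apply: le_trans (ler_sum _ (fun u' _ => S2 u')) _.
rewrite !big_split /= !cst -mulr_sumr.
have h2 := S1 u (fun u' => s u') _ p2.
have h3 := ler_wpM2l (ler0n R n) (S1 u (fun u' => s u') _ p3').
have -> : n%:R * (n%:R * c4) = n%:R ^+ 2 * c4 by ring.
lra.
Qed.

Lemma Ex_swap_count_sqr s (x := n%:R * P) : balanced s ->
  Ex (W s) (fun G => swap_count s G ^+ 2) <=
  x ^+ 2 * (1 + 2 * (8 ^+ 3 * x) + 8 ^+ 6 * x ^+ 2).
Proof.
move=> bs.
rewrite (eq_Ex _ (H := fun G => \sum_(u | s u) \sum_(v | ~~ s v)
   \sum_(u' | s u') \sum_(v' | ~~ s v') (F s u v G * F s u' v' G))); last first.
  move=> G; rewrite expr2 {1}/swap_count mulr_suml; apply: eq_bigr => u _.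
  rewrite mulr_suml; apply: eq_bigr => v _; rewrite /swap_count mulr_sumr.
  by apply: eq_bigr => u' _; rewrite mulr_sumr.
rewrite Ex_sum.
apply: (@le_trans _ _ (\sum_(u | s u) \sum_(v | ~~ s v)
    (P ^+ 2 + 2 * (n%:R * (8 ^+ 3 * P ^+ 3)) + n%:R ^+ 2 * (8 ^+ 6 * P ^+ 4)))).
  apply: ler_sum => u su; rewrite Ex_sum; apply: ler_sum => v sv.
  apply: le_trans (pair_sum bs su sv); rewrite Ex_sum.
  by apply: ler_sum => u' _; rewrite Ex_sum.
set c := _ + n%:R ^+ 2 * _.
rewrite (eq_bigr (fun=> n%:R * c)) => [|u _]; last first.
  by rewrite sumr_const (card_minus bs) -[LHS]mulr_natl.
rewrite sumr_const (card_plus bs) -[leLHS]mulr_natl.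
suff -> : n%:R * (n%:R * c) = x ^+ 2 * (1 + 2 * (8 ^+ 3 * x) + 8 ^+ 6 * x ^+ 2) by [].
by rewrite /c /x; ring.
Qed.

Lemma swap_count_ambiguous s G : balanced s -> 0 < swap_count s G -> ambiguous o a b s G.
Proof.
move=> bs; rewrite lt0r => /andP[nz _].
have [[u v] /and3P[su sv /andP[Euv Evu]]|none] :=
  pickP (fun uv : V n * V n => [&& s uv.1, ~~ s uv.2 & swap_pair o s uv.1 uv.2 G]); last first.
  move: nz; rewrite /swap_count big1 ?eqxx // => u su; rewrite big1 // => v sv.
  by have := none (u, v); rewrite /= su sv /= => ->.
rewrite /= in su sv Euv Evu.
have uv : s u != s v by rewrite su (negPf sv).
have D := swap_lab_diffset uv.
apply/existsP; exists (swap_lab u v s); rewrite swap_lab_balanced bs /=.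
rewrite (swap_likelihood b0 ba a1 bs uv Euv Evu) andbT; apply/andP; split.
  by rewrite -diffset_eq0 -cards_eq0 D.
rewrite -(inv_eq (@neg_labK n)) -diffset_eq0 -cards_eq0 diffset_neg_card D.
by move: n2; clear; lia.
Qed.

Lemma ambiguous_prob s (x := n%:R * P) : balanced s ->
  x ^+ 2 <= Ex (W s) (fun G => (ambiguous o a b s G)%:R) *
     (1 + 2 * (8 ^+ 3 * x) + 8 ^+ 6 * x ^+ 2).
Proof.
move=> bs; have x0 : 0 <= x by rewrite mulr_ge0.
set D := 1 + _ + _.
have D0 : 0 < D.
  rewrite /D -addrA ltr_pwDl // addr_ge0 // mulr_ge0 ?exprn_ge0 //.
  by rewrite mulr_ge0 ?exprn_ge0.
have m1 := Ex_swap_count bs; have m2 := Ex_swap_count_sqr bs; rewrite -/x -/D in m1 m2.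
set pr := Ex _ _.
(* Second moment method through a quadratic minorant: if the count N is positive, 1 >= 2 N / D - (N
   / D)^2. Taking D as the bound on the ratio of the second to the first moment yields x^2 / D. *)
have key : 2 / D * x ^+ 2 - (D ^+ 2)^-1 * (x ^+ 2 * D) <= pr.
  apply: (@le_trans _ _ (Ex (W s) (fun G => 2 / D * swap_count s G +
     (- (D ^+ 2)^-1) * swap_count s G ^+ 2))).
    by rewrite ExD !ExZ m1 lerD2l mulNr lerN2 ler_wpM2l // invr_ge0 exprn_ge0 // ltW.
  rewrite /pr; apply: le_Ex => [e|G]; first exact: w01.
  have c0 : 0 <= swap_count s G.
    by apply: sumr_ge0 => u _; apply: sumr_ge0 => v _.
  have [z|nz] := eqVneq (swap_count s G) 0.
    by rewrite z expr0n /= !mulr0 addr0.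
  rewrite swap_count_ambiguous ?lt0r ?nz //=.
  have := sqr_ge0 (swap_count s G / D - 1).
  have -> : (swap_count s G / D - 1) ^+ 2 = 1 - (2 / D * swap_count s G +
     (- (D ^+ 2)^-1) * swap_count s G ^+ 2) by field; rewrite gt_eqF.
  by rewrite subr_ge0.
have e : 2 / D * x ^+ 2 - (D ^+ 2)^-1 * (x ^+ 2 * D) = x ^+ 2 / D.
  by field; rewrite gt_eqF.
by rewrite e ler_pdivrMr // in key.
Qed.

Lemma strong_lower (f : graph n -> labelling n) (x := n%:R * P) :
  x ^+ 2 <= 3 * ((balanced_count R n)^-1 * \sum_(s | balanced s)
    Ex (W s) (fun G => (~~ ((f G == s) || (f G == neg_lab s)))%:R)) *
    (1 + 2 * (8 ^+ 3 * x) + 8 ^+ 6 * x ^+ 2).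
Proof.
have x0 : 0 <= x by rewrite mulr_ge0.
set D := 1 + _ + _.
have D0 : 0 <= D.
  by rewrite /D !addr_ge0 // !mulr_ge0 ?exprn_ge0.
have N0 := balanced_count_gt0 R n.
have n0 : (0 < n)%N by exact: ltnW.
have := ambiguous_mass o b0 ba a1 f n0.
set E := \sum_(s : labelling n | _) Ex _ (fun G => (~~ ((f G == s) || (f G == neg_lab s)))%:R).
set A := \sum_(s | _) Ex _ (fun G => (ambiguous o a b s G)%:R) => AE.
have : balanced_count R n * x ^+ 2 <= A * D.
  have -> : balanced_count R n * x ^+ 2 = \sum_(s : labelling n | balanced s) x ^+ 2.
    rewrite sumr_const -[RHS]mulr_natl; congr (_%:R * _).
    by apply: eq_card => t; rewrite !inE.
  by rewrite /A mulr_suml; apply: ler_sum => s bs; exact: (ambiguous_prob bs).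
have := ler_wpM2r D0 AE => h1 h2.
rewrite mulrCA -mulrA -(ler_pM2l N0) mulVKf ?gt_eqF //.
exact: le_trans h2 h1.
Qed.

End StrongLower.

(** * The two thresholds *)

Section Recovery.
Variables (R : realType) (n : nat) (p q : R).
Hypotheses (hp : 0 <= p <= 1) (hq : 0 <= q <= 1).

Let a := Num.max p q.
Let b := Num.min p q.

Let b0 : 0 <= b.
Proof. by rewrite le_min; case/andP: hp => -> _; case/andP: hq => -> _. Qed.
Let ba : b <= a. Proof. by rewrite /b ge_min /a le_max lexx. Qed.
Let a1 : a <= 1.
Proof. by rewrite ge_max; case/andP: hp => _ ->; case/andP: hq => _ ->. Qed.

Let a01 : 0 <= a <= 1. Proof. by rewrite a1 (le_trans b0 ba). Qed.
Let b01 : 0 <= b <= 1. Proof. by rewrite b0 (le_trans ba a1). Qed.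

Definition fail_prob (f : graph n -> labelling n) : R :=
  model_prob p q (fun s G => ~~ ((f G == s) || (f G == neg_lab s))).

Lemma fail_prob_ge0 f : 0 <= fail_prob f. Proof. exact: model_prob_ge0. Qed.

Lemma Pn_le_rho : Pn n p q <= rho a b ^+ n.
Proof. by rewrite Pn_pr2; exact: pr2_leq_rho. Qed.

Lemma Pn_ge0 : 0 <= Pn n p q.
Proof. by rewrite Pn_pr2; exact: pr2_ge0. Qed.

(** The estimator precedes [eps], [K] and [d], because weak consistency asks one estimator to serve
    every [eps]. *)
Lemma Pn_weak_upper :
  exists f : graph n -> labelling n, forall (eps : R) (K : nat) (d : R),
    (0 < n)%N -> 1 <= K%:R * eps -> d = (64^-1) ^+ K ->
    Pn n p q < d * expR (- (8 / d + 1)) / 2 ->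
    model_prob p q (fun s G => eps < Delta s (f G)) <= (1 / 2) ^+ n.
Proof.
have [f hf] := likelihood_estimator (q <= p) a b (fun _ _ => true) (n := n).
exists f => eps K d n0 hK dE hP; apply: model_prob_le => s bs.
apply: (weak_upper b0 ba a1 (K := K)) => //.
have d0 : 0 < d by rewrite dE exprn_gt0 // invr_gt0.
have d1 : d <= 1 by rewrite dE exprn_ile1 ?invr_ge0 // invf_le1 // ler1n.
by rewrite -dE ltW // rho_pow_lt // -Pn_pr2.
Qed.

Lemma Pn_weak_lower (f : graph n -> labelling n) (eps : R) : (1 < n)%N -> 0 <= eps ->
  Pn n p q ^+ 4 <= 8 * (eps + model_prob p q (fun s G => eps < Delta s (f G))).
Proof.
move=> n1 eps0; rewrite model_probE.
apply: le_trans (weak_lower (q <= p) b0 ba a1 f n1 eps0).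
have r0 : 0 <= rho a b ^+ n := exprn_ge0 n (rho_ge0 a b).
by rewrite mulnC exprM lerXn2r ?nnegrE ?Pn_ge0 // Pn_le_rho.
Qed.

Lemma Pn_strong_upper1 (z : nat) : a + b <= 1 ->
  420 <= ln z%:R :> R -> (z ^ 24 <= n)%N -> (n <= z ^ 25)%N -> n%:R * Pn n p q <= 1 ->
  exists f : graph n -> labelling n,
    fail_prob f <= 192 * (n%:R * Pn n p q) + 4 * expR 4 * expR 1 / z%:R.
Proof.
move=> ab1 L420 zn nz; rewrite Pn_pr2 => nP.
have [f hf] := strong_upper b0 ba a1 (q <= p) L420 zn nz ab1 nP.
by exists f; apply: model_prob_le.
Qed.

(** If a > 3/4, then b <= 1/4 and 1 - rho >= (3/4 - 1/4)^2, so P(n) <= e^(-n/4) and n P(n) is small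
    outright; 64 comes from (n/8)^2 <= e^(n/4). Otherwise x is n P(n - 1), at least n P(n) by
    monotonicity. *)
Lemma Pn_strong_lower1 (f : graph n -> labelling n) : a + b <= 1 -> (1 < n)%N ->
  n%:R * Pn n p q <= 64 / n%:R \/
  exists x, n%:R * Pn n p q <= x /\
    x ^+ 2 <= 3 * fail_prob f * (1 + 2 * (8 ^+ 3 * x) + 8 ^+ 6 * x ^+ 2).
Proof.
move=> ab1 n1.
have b12 : b <= 1 / 2 by rewrite ler_pdivlMr // mulr_natr mulr2n (le_trans _ ab1) // lerD2r.
have nR : 0 < n%:R :> R by rewrite ltr0n ltnW.
have [a34|a34] := leP a (3 / 4).
  right; exists (n%:R * pr2 n.-1 n.-1 a b leq); split.
    by rewrite Pn_pr2 ler_wpM2l // pr2_leq_mono // leq_pred.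
  by rewrite /fail_prob model_probE; exact: (strong_lower (q <= p) b0 ba a34 b12 n1).
left; have b14 : b <= 1 / 4.
  by rewrite -(lerD2l a) (le_trans ab1) //; move: (ltW a34); lra.
have r34 : rho a b <= expR (- (1 / 4)).
  apply: le_trans (expR_ge1Dx _); have e := rho_sin a01 b01.
  have x0 : 0 <= a * (1 - b) by rewrite mulr_ge0 //; lra.
  have y0 : 0 <= b * (1 - a) by rewrite mulr_ge0 ?b0 // subr_ge0.
  have hx : 3 / 4 <= Num.sqrt (a * (1 - b)).
    rewrite -ler_sqr ?nnegrE ?sqrtr_ge0 // sqr_sqrtr // expr2.
    by apply: ler_pM => //; [exact: ltW|move: b14; lra].
  have hy : Num.sqrt (b * (1 - a)) <= 1 / 4.
    rewrite -ler_sqr ?nnegrE ?sqrtr_ge0 // sqr_sqrtr // expr2.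
    by apply: ler_pM => //; [rewrite subr_ge0|move: (ltW a34); lra].
  have : (1 / 2) ^+ 2 <= (Num.sqrt (a * (1 - b)) - Num.sqrt (b * (1 - a))) ^+ 2.
    by rewrite lerXn2r ?nnegrE //; lra.
  rewrite e; lra.
have Pr : Pn n p q <= expR (- (1 / 4)) ^+ n.
  apply: le_trans Pn_le_rho _.
  by rewrite lerXn2r // nnegrE ?expR_ge0 // rho_ge0.
rewrite ler_pdivlMr //.
have : (n%:R / 8) ^+ 2 <= expR (n%:R / 8) ^+ 2 :> R.
  rewrite lerXn2r ?nnegrE ?expR_ge0 ?divr_ge0 //.
  by apply: le_trans (expR_ge1Dx _); rewrite lerDr.
rewrite -expRM_natl => h.
have e : expR (2 * (n%:R / 8)) * expR (- (1 / 4)) ^+ n = 1 :> R.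
  rewrite -expRM_natl -expRD (_ : _ + _ = 0) ?expR0 //; lra.
have := ler_wpM2r (exprn_ge0 n (expR_ge0 (- (1 / 4)))) h; rewrite e => h1.
have h2 : n%:R * Pn n p q * n%:R <= n%:R ^+ 2 * expR (- (1 / 4)) ^+ n.
  by rewrite mulrAC -expr2 ler_wpM2l // exprn_ge0 // ltW.
apply: le_trans h2 _; rewrite !expr2 in h1 *; lra.
Qed.

End Recovery.

(** * Reduction to a + b <= 1 by complementing the graph *)

Section Complement.
Variables (R : realType) (n : nat) (p q : R).
Hypotheses (hp : 0 <= p <= 1) (hq : 0 <= q <= 1).

Let cp : 0 <= 1 - p <= 1. Proof. by case/andP: hp => h1 h2; rewrite subr_ge0 h2 lerBlDr lerDl. Qed.
Let cq : 0 <= 1 - q <= 1. Proof. by case/andP: hq => h1 h2; rewrite subr_ge0 h2 lerBlDr lerDl. Qed.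

Lemma max_compl : Num.max (1 - p) (1 - q) = 1 - Num.min p q.
Proof. by case: (leP p q) => h; [rewrite max_l|rewrite max_r]; rewrite // lerD2l lerN2 // ltW. Qed.

Lemma min_compl : Num.min (1 - p) (1 - q) = 1 - Num.max p q.
Proof. by case: (leP p q) => h; [rewrite min_r|rewrite min_l]; rewrite // lerD2l lerN2 // ltW. Qed.

Lemma Pn_compl : Pn n (1 - p) (1 - q) = Pn n p q.
Proof. by rewrite !Pn_pr2 max_compl min_compl pr2_compl. Qed.

Lemma fail_prob_compl (f : graph n -> labelling n) :
  fail_prob (1 - p) (1 - q) f = fail_prob p q (fun G => f (pairs n :\: G)).
Proof. by rewrite /fail_prob -model_prob_compl. Qed.

Lemma max_min_compl : 1 <= Num.max p q + Num.min p q ->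
  Num.max (1 - p) (1 - q) + Num.min (1 - p) (1 - q) <= 1.
Proof. by rewrite max_compl min_compl; lra. Qed.

Lemma Pn_strong_upper (z : nat) :
  420 <= ln z%:R :> R -> (z ^ 24 <= n)%N -> (n <= z ^ 25)%N -> n%:R * Pn n p q <= 1 ->
  exists f : graph n -> labelling n,
    fail_prob p q f <= 192 * (n%:R * Pn n p q) + 4 * expR 4 * expR 1 / z%:R.
Proof.
move=> L420 zn nz nP.
have [ab1|ab1] := leP (Num.max p q + Num.min p q) 1; first exact: Pn_strong_upper1 ab1 L420 zn nz nP.
rewrite -Pn_compl in nP *.
have [f hf] := Pn_strong_upper1 cp cq (max_min_compl (ltW ab1)) L420 zn nz nP.
by exists (fun G => f (pairs n :\: G)); rewrite -fail_prob_compl.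
Qed.

Lemma Pn_strong_lower (f : graph n -> labelling n) : (1 < n)%N ->
  n%:R * Pn n p q <= 64 / n%:R \/
  exists x, n%:R * Pn n p q <= x /\
    x ^+ 2 <= 3 * fail_prob p q f * (1 + 2 * (8 ^+ 3 * x) + 8 ^+ 6 * x ^+ 2).
Proof.
move=> n1.
have [ab1|ab1] := leP (Num.max p q + Num.min p q) 1; first exact: Pn_strong_lower1.
rewrite -Pn_compl.
have := Pn_strong_lower1 cp cq (fun G => f (pairs n :\: G)) (max_min_compl (ltW ab1)) n1.
suff -> : fail_prob (1 - p) (1 - q) (fun G => f (pairs n :\: G)) = fail_prob p q f by [].
by rewrite /fail_prob -[in RHS](subKr 1 p) -[in RHS](subKr 1 q) -[RHS]model_prob_compl.
Qed.

End Complement.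

(** * Passage to the limit *)

Import numFieldNormedType.Exports.
Local Open Scope classical_set_scope.

Lemma cvg_natP (R : realType) (u : nat -> R) (l : R) :
  u @ \oo --> l <->
  forall e : R, 0 < e -> exists N, forall n, (N <= n)%N -> `|l - u n| < e.
Proof.
split=> [/cvgrPdist_lt h e /h [N _ hN]|h].
  by exists N => n Nn; apply: hN.
apply/cvgrPdist_lt => e /h [N hN]; exists N => // n /= Nn; exact: hN.
Qed.

Lemma cvg_nat0P (R : realType) (u : nat -> R) : (forall n, 0 <= u n) ->
  (u @ \oo --> (0 : R) <->
   forall e : R, 0 < e -> exists N, forall n, (N <= n)%N -> u n < e).
Proof.
move=> u0; rewrite cvg_natP; split=> h e /h [N hN]; exists N => n /hN;
  by rewrite sub0r normrN ger0_norm.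
Qed.

Lemma exp_gap m : exists c, forall z, (c <= z)%N -> (z.+1 ^ m <= z ^ m.+1)%N.
Proof.
exists (2 ^ m)%N => z cz.
have z0 : (0 < z)%N by apply: leq_trans cz; rewrite expn_gt0.
apply: (@leq_trans ((2 * z) ^ m)).
  by case: m {cz} => [|m] //; rewrite leq_exp2r // mul2n -addnn -addn1 leq_add2l.
by rewrite expnMn expnS leq_mul2r cz orbT.
Qed.

(** Take the largest z with z^m <= n. Then n < (z + 1)^m, which is at most z^(m+1) for large z by
    [exp_gap]. *)
Lemma root_between m : exists c, forall K n, (c <= K)%N -> (0 < m)%N -> (K ^ m <= n)%N ->
  exists z, [/\ (K <= z)%N, (z ^ m <= n)%N & (n <= z ^ m.+1)%N].
Proof.
have [c hc] := exp_gap m; exists c => K n cK m0 Kn.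
have ex : exists z, (fun z => z ^ m <= n)%N z by exists K.
have ub z : (z ^ m <= n)%N -> (z <= n)%N.
  by apply: leq_trans; case: m m0 {hc Kn ex} => // m _; case: z => // z; rewrite -{1}(expn1 z.+1) leq_pexp2l.
have [z zn zmax] := ex_maxnP ex ub; exists z.
have Kz : (K <= z)%N by exact: zmax.
split=> //; apply: leq_trans (hc z (leq_trans cK Kz)).
by rewrite leqNgt; apply/negP => /ltnW /zmax; rewrite ltnn.
Qed.

Lemma nat_above (R : realType) (x : R) : exists K : nat, x < K%:R.
Proof.
exists (Num.bound `|x|); apply: le_lt_trans (ler_norm x) _.
exact: archi_boundP.
Qed.

Section Sequences.
Variables (R : realType) (p q : nat -> R).
Hypotheses (hp : forall n, 0 <= p n <= 1) (hq : forall n, 0 <= q n <= 1).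

Lemma strongP (A : estimator) : strongly_consistent p q A <->
  (fun n => fail_prob (p n) (q n) (A n)) @ \oo --> (0 : R).
Proof.
rewrite cvg_nat0P; last by move=> n; exact: fail_prob_ge0.
rewrite /strongly_consistent cvg_natP.
have e n : `|1 - model_prob (p n) (q n) (fun s G => (A n G == s) || (A n G == neg_lab s))| =
    fail_prob (p n) (q n) (A n).
  by rewrite -model_prob_not ger0_norm // fail_prob_ge0.
by split=> h d /h [N hN]; exists N => n /hN; rewrite e.
Qed.

(** The maps from graphs to labellings are finite in number. Taking an optimal one for every n
    avoids committing to a scale z, and also defines the estimator where [Pn_strong_upper] does not
    apply. *)
Lemma best_estimator n : exists f : graph n -> labelling n,
  forall g : graph n -> labelling n, fail_prob (p n) (q n) f <= fail_prob (p n) (q n) g.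
Proof.
have [f _ hf] := @arg_minP _ _ _ ([ffun=> [ffun=> true]] : {ffun graph n -> labelling n})
   xpredT (fun f => @fail_prob R n (p n) (q n) f) isT.
exists f => g; have := hf [ffun G => g G] isT.
rewrite /fail_prob /model_prob => h; apply: le_trans h _.
by apply: ler_sum => s _; apply: ler_sum => G _; rewrite ffunE.
Qed.

Lemma strong_sufficient :
  (fun n => n%:R * Pn n (p n) (q n)) @ \oo --> (0 : R) ->
  exists A : estimator, strongly_consistent p q A.
Proof.
move=> /cvg_nat0P h.
have {}h := h (fun n => mulr_ge0 (ler0n R n) (Pn_ge0 n (hp n) (hq n))).
exists (fun n => sval (cid (best_estimator n))); apply/strongP/cvg_nat0P => [n|e e0].
  exact: fail_prob_ge0.
set C : R := 4 * expR 4 * expR 1.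
have C0 : 0 < C by rewrite !mulr_gt0 ?expR_gt0.
have [c hc] := root_between 24.
have [K1 hK1] := nat_above (2 * C / e).
have [K2 hK2] := nat_above (expR (420 : R)).
pose K := (c + K1 + K2)%N.
have [N1 hN1] := h 1 ltr01.
(* 192 / 400 < 1/2, which leaves e/2 for the term C / z. *)
have [|N2 hN2] := h (e / 400); first by rewrite divr_gt0.
exists (N1 + N2 + K ^ 24)%N => n Nn.
have n1 : (N1 <= n)%N by apply: leq_trans Nn; rewrite -addnA leq_addr.
have n2 : (N2 <= n)%N by apply: leq_trans Nn; rewrite addnAC leq_addl.
have nK : (K ^ 24 <= n)%N by apply: leq_trans Nn; rewrite leq_addl.
have cK : (c <= K)%N by rewrite /K -addnA leq_addr.
have [z [Kz zn nz]] := hc K n cK isT nK.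
have K1z : (K1 <= z)%N by apply: leq_trans Kz; rewrite /K addnAC leq_addl.
have K2z : (K2 <= z)%N by apply: leq_trans Kz; rewrite /K leq_addl.
have z0 : 0 < z%:R :> R.
  apply: lt_le_trans (_ : K2%:R <= _); last by rewrite ler_nat.
  by apply: lt_trans hK2; rewrite expR_gt0.
have L420 : 420 <= ln z%:R :> R.
  rewrite -[leLHS]expRK ler_ln ?posrE ?expR_gt0 //.
  by rewrite (le_trans (ltW hK2)) // ler_nat.
have [f hf] := Pn_strong_upper (hp n) (hq n) L420 zn nz (ltW (hN1 n n1)).
case: cid => /= g hg; apply: le_lt_trans (hg f) _; apply: le_lt_trans hf _.
have Cz : C / z%:R < e / 2.
  rewrite ltr_pdivrMr //.
  have : 2 * C / e < z%:R by apply: lt_le_trans hK1 _; rewrite ler_nat.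
  by rewrite ltr_pdivrMr //; lra.
have := hN2 n n2; rewrite -/C; set y := n%:R * _ => hy; lra.
Qed.

Lemma strong_necessary (A : estimator) : strongly_consistent p q A ->
  (fun n => n%:R * Pn n (p n) (q n)) @ \oo --> (0 : R).
Proof.
move=> /strongP; rewrite cvg_nat0P; last by move=> n; exact: fail_prob_ge0.
move=> h; apply/cvg_nat0P => [n|e e0]; first by rewrite mulr_ge0 // Pn_ge0.
(* For x >= e the second moment factor is at most k x^2, so a failure probability below 1 / (3 k)
   contradicts the lower bound. *)
pose k : R := (e ^+ 2)^-1 + 2 * (8 ^+ 3 / e) + 8 ^+ 6.
have ei : 0 < e^-1 by rewrite invr_gt0.
have k0 : 0 < k.
  rewrite /k ltr_pwDr ?exprn_gt0 // addr_ge0 ?invr_ge0 ?exprn_ge0 ?(ltW e0) //.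
  by rewrite mulr_ge0 // divr_ge0 ?exprn_ge0 // ltW.
have [|N1 hN1] := h (3 * k)^-1; first by rewrite invr_gt0 mulr_gt0.
have [K hK] := nat_above (64 / e).
exists (N1 + K + 2)%N => n Nn.
have n1 : (N1 <= n)%N by apply: leq_trans Nn; rewrite -addnA leq_addr.
have nK : (K <= n)%N by apply: leq_trans Nn; rewrite addnAC leq_addl.
have n2 : (1 < n)%N by apply: leq_trans Nn; rewrite leq_addl.
have nR : 0 < n%:R :> R by rewrite ltr0n ltnW.
have [|[x [Px xle]]] := Pn_strong_lower (hp n) (hq n) (A n) n2.
  move=> /le_lt_trans; apply; rewrite ltr_pdivrMr // mulrC -ltr_pdivrMr //.
  by apply: lt_le_trans hK _; rewrite ler_nat.
apply: le_lt_trans Px _; rewrite ltNge; apply/negP => ex.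
have x0 : 0 < x by exact: lt_le_trans ex.
have hD : 1 + 2 * (8 ^+ 3 * x) + 8 ^+ 6 * x ^+ 2 <= x ^+ 2 * k.
  have xe : 1 <= x * e^-1 by rewrite ler_pdivlMr // mul1r.
  have -> : x ^+ 2 * k = (x * e^-1) ^+ 2 + 2 * (8 ^+ 3 * x * (x * e^-1)) + 8 ^+ 6 * x ^+ 2.
    by rewrite /k; field; rewrite gt_eqF.
  rewrite lerD2r lerD ?exprn_ege1 // ler_wpM2l // ler_peMr //.
  by rewrite mulr_ge0 ?exprn_ge0 // ltW.
have F0 : 0 <= fail_prob (p n) (q n) (A n) by exact: fail_prob_ge0.
have F3 : 0 <= 3 * fail_prob (p n) (q n) (A n) by rewrite mulr_ge0.
have := le_trans xle (ler_wpM2l F3 hD).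
have x2 : 0 < x ^+ 2 by rewrite exprn_gt0.
rewrite mulrCA -[leLHS]mulr1 ler_pM2l //.
have := hN1 n n1; rewrite -[(3 * k)^-1]mul1r ltr_pdivlMr ?mulr_gt0 // mulrA.
by rewrite [_ * 3]mulrC => lt /le_lt_trans /(_ lt); rewrite ltxx.
Qed.

Lemma weak_sufficient :
  (fun n => Pn n (p n) (q n)) @ \oo --> (0 : R) ->
  exists A : estimator, weakly_consistent p q A.
Proof.
move=> /cvg_nat0P h; have {}h := h (fun n => Pn_ge0 n (hp n) (hq n)).
exists (fun n => sval (cid (Pn_weak_upper n (hp n) (hq n)))) => eps eps0.
apply/cvg_nat0P => [n|e e0]; first exact: model_prob_ge0.
have [K hK] := nat_above eps^-1.
pose d : R := (64^-1) ^+ K.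
have d0 : 0 < d by rewrite exprn_gt0 // invr_gt0.
have [|N1 hN1] := h (d * expR (- (8 / d + 1)) / 2).
  by rewrite divr_gt0 // mulr_gt0 // expR_gt0.
have [M hM] := nat_above e^-1.
exists (N1 + M + 1)%N => n Nn.
have n1 : (N1 <= n)%N by apply: leq_trans Nn; rewrite -addnA leq_addr.
have nM : (M <= n)%N by apply: leq_trans Nn; rewrite addnAC leq_addl.
have n0 : (0 < n)%N by apply: leq_trans Nn; rewrite leq_addl.
case: cid => /= f hf.
have Ke : 1 <= K%:R * eps.
  by rewrite -ler_pdivrMr // div1r ltW.
apply: le_lt_trans (hf eps K d n0 Ke erefl (hN1 n n1)) _.
rewrite expr_div_n expr1n div1r -[ltRHS]invrK ltf_pV2 ?posrE ?invr_gt0 ?exprn_gt0 //.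
apply: lt_le_trans hM _; rewrite -natrX ler_nat; apply: leq_trans nM _.
exact/ltnW/ltn_expl.
Qed.

Lemma weak_necessary (A : estimator) : weakly_consistent p q A ->
  (fun n => Pn n (p n) (q n)) @ \oo --> (0 : R).
Proof.
move=> h; apply/cvg_nat0P => [n|e e0]; first exact: Pn_ge0.
have e4 : 0 < e ^+ 4 by rewrite exprn_gt0.
(* Both the tolerance and the error probability are taken as d, and 8 (d + d) = e^4 / 2. *)
pose d := e ^+ 4 / 32; have d0 : 0 < d by rewrite divr_gt0.
have := h d d0; rewrite cvg_nat0P; last by move=> n; exact: model_prob_ge0.
move=> /(_ d d0)[N hN]; exists (N + 2)%N => n Nn.
have n1 : (N <= n)%N by apply: leq_trans Nn; rewrite leq_addr.
have n2 : (1 < n)%N by apply: leq_trans Nn; rewrite leq_addl.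
have := Pn_weak_lower (hp n) (hq n) (A n) n2 (ltW d0); have := hN n n1.
set pr := model_prob _ _ _ => prd hP.
rewrite -(ltr_pXn2r (n := 4)) ?nnegrE ?Pn_ge0 ?(ltW e0) //.
by apply: le_lt_trans hP _; rewrite /d in prd *; lra.
Qed.

End Sequences.

Theorem theorem2p5 (R : realType) (p q : nat -> R)
  (hp : forall n, 0 <= p n <= 1) (hq : forall n, 0 <= q n <= 1) :
  ((exists A : estimator, strongly_consistent p q A) <->
     (fun n => n%:R * Pn n (p n) (q n)) @ \oo --> (0 : R)) /\
  ((exists A : estimator, weakly_consistent p q A) <->
     (fun n => Pn n (p n) (q n)) @ \oo --> (0 : R)).
Proof.
split; split.
- by move=> [A]; exact: strong_necessary.
- exact: strong_sufficient.
- by move=> [A]; exact: weak_necessary.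
- exact: weak_sufficient.
Qed.
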